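(* Let $C:f=0$ be a reduced curve of degree $d$ in $\mathbb{P}^2$ and let $L$ be a line in $\mathbb{P}^2$ which is not an irreducible component of $C$. Let $C'=C\cup L:f'=0$ and assume that $C$ is a free curve with exponents $(d_1,d_2)$. Let $r=|C\cap L|$ and $\epsilon=\epsilon(C,L)$. Then $C'$ is either free with exponents $(d_1',d_2')$ or plus-one generated with exponents $(d_1',d_2',d_3')$, and exactly one of the following holds: (1) $d_1'=d_1$ and $d_2'=d_2+1$; in this case $C'$ is free and $r=d_1+1-\epsilon$; (2) $d_1<d_2$, $d_1'=d_1+1$ and $d_2'=d_2$; in this case $C'$ is free and $r=d_2+1-\epsilon$; (3) $d_1'=d_1+1$ and $d_2'=d_2+1$; in this case $C'$ is plus-one generated and $r=d_3'+1-\epsilon$. Moreover, each of these three cases occurs for suitable $C$ and $L$. In particular, $C'$ is free if and only if $r\le d_2+1-\epsilon$.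
   Context: Let $S=\mathbb{C}[x,y,z]$. For a reduced homogeneous polynomial $f\in S$ of degree $d$ defining a plane curve $C:f=0$ (the paper works with reduced curves of degree $d\ge 3$), let $D_0(f)=\{(a,b,c)\in S^3 : af_x+bf_y+cf_z=0\}$. If $D_0(f)$ is minimally generated by $m$ homogeneous elements, of degrees $d_1\le\dots\le d_m$, these degrees are the exponents of $C$. $C$ is free if $m=2$, and plus-one generated if $m=3$ and $d_1+d_2=d$. For an isolated plane curve singularity $(X,q)$ set $\epsilon(X,q)=\mu(X,q)-\tau(X,q)$ (Milnor number minus Tjurina number; it is $0$ at smooth points). For curves $C_1,C_2$ without common components and $q\in C_1\cap C_2$, set $\epsilon(C_1,C_2)_q=\epsilon(C_1\cup C_2,q)-\epsilon(C_1,q)$ and $\epsilon(C_1,C_2)=\sum_{q\in C_1\cap C_2}\epsilon(C_1,C_2)_q$. *)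

(* Defs.v *)
From HB Require Import structures.
From mathcomp Require Import all_boot all_order all_algebra.
From mathcomp Require Import Rstruct complex.
From mathcomp Require Import mpoly.
From Stdlib Require Import ClassicalEpsilon.

Set Implicit Arguments.
Unset Strict Implicit.
Unset Printing Implicit Defensive.

Import Order.TTheory GRing.Theory Num.Theory.
Local Open Scope ring_scope.

Notation CC := (Rdefinitions.R[i]).
Notation P3 := {mpoly CC[3]}.
Notation P2 := {mpoly CC[2]}.

(* a/1 lies in I O_p : t * a in I for some t with t(p) <> 0 *)
Definition in_loc_ideal (gs : seq P2) (p : 'I_2 -> CC) (a : P2) : Prop :=
  exists t : P2, t.@[p] != 0 /\
    exists cs : seq P2, size cs = size gs /\
      t * a = \sum_(i < size gs) cs`_i * gs`_i.

(* the fractions a_i / s_i (s_i(p) <> 0) are C-linearly independent in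
   O_p / I O_p; sum_i c_i a_i/s_i = (sum_i c_i a_i prod_{j<>i} s_j)/prod s_j *)
Definition loc_indep (gs : seq P2) (p : 'I_2 -> CC) (k : nat)
    (a s : 'I_k -> P2) : Prop :=
  (forall i, (s i).@[p] != 0) /\
  forall c : 'I_k -> CC,
    in_loc_ideal gs p (\sum_(i < k) (c i)%:MP * (a i * \prod_(j < k | j != i) s j)) ->
    forall i, c i = 0.

Definition has_local_dim (gs : seq P2) (p : 'I_2 -> CC) (n : nat) : Prop :=
  (exists a s, @loc_indep gs p n a s) /\
  (forall k a s, @loc_indep gs p k a s -> (k <= n)%N).

(* the dimension (only meaningful when finite, which is the case for
   isolated singularities) *)
Definition local_dim (gs : seq P2) (p : 'I_2 -> CC) : nat :=
  epsilon (inhabits 0%N) (has_local_dim gs p).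

Definition pt := (CC * CC * CC)%type.

Definition coords (q : pt) : 'I_3 -> CC :=
  fun i => nth 0 [:: q.1.1; q.1.2; q.2] i.

(* normalized representative of a projective point: first nonzero coord = 1 *)
Definition normalized (q : pt) : Prop :=
  q.1.1 = 1 \/ (q.1.1 = 0 /\ q.1.2 = 1) \/ (q.1.1 = 0 /\ q.1.2 = 0 /\ q.2 = 1).

Definition X2_0 : P2 := 'X_ord0.
Definition X2_1 : P2 := 'X_ord_max.

Definition chart_sub (q : pt) : 3.-tuple P2 :=
  if q.2 != 0 then [tuple X2_0; X2_1; 1]
  else if q.1.2 != 0 then [tuple X2_0; 1; X2_1]
  else [tuple 1; X2_0; X2_1].

Definition chart_pt (q : pt) : 'I_2 -> CC :=
  let: (a, b, c) := q in
  if c != 0 then (fun i => nth 0 [:: a / c; b / c] i)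
  else if b != 0 then (fun i => nth 0 [:: a / b; c / b] i)
  else (fun i => nth 0 [:: b / a; c / a] i).

Definition dehom (F : P3) (q : pt) : P2 := F \mPo chart_sub q.

Definition milnor (F : P3) (q : pt) : nat :=
  let g := dehom F q in local_dim [:: g^`M(ord0); g^`M(ord_max)] (chart_pt q).

Definition tjurina (F : P3) (q : pt) : nat :=
  let g := dehom F q in local_dim [:: g; g^`M(ord0); g^`M(ord_max)] (chart_pt q).

Definition epsX (F : P3) (q : pt) : int := (milnor F q)%:Z - (tjurina F q)%:Z.

Definition eps_pair (F1 F2 : P3) (q : pt) : int := epsX (F1 * F2) q - epsX F1 q.

Definition enum_inter (f l : P3) (s : seq pt) : Prop :=
  uniq s /\
  forall q, q \in s <-> (normalized q /\ f.@[coords q] = 0 /\ l.@[coords q] = 0).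

Definition reduced (F : P3) : Prop :=
  forall g h : P3, F = g * g * h -> (msize g <= 1)%N.

Definition in_D0 (F : P3) (w : 'I_3 -> P3) : Prop :=
  \sum_(j < 3) w j * F^`M(j) = 0.

Definition in_span (m : nat) (v : 'I_m -> 'I_3 -> P3) (P : pred 'I_m)
    (w : 'I_3 -> P3) : Prop :=
  exists g : 'I_m -> P3, forall j, w j = \sum_(i < m | P i) g i * v i j.

Definition min_hom_gens (F : P3) (m : nat) (v : 'I_m -> 'I_3 -> P3)
    (dg : 'I_m -> nat) : Prop :=
  [/\ forall i, in_D0 F (v i),
      forall i, (exists j, v i j != 0) /\ (forall j, v i j \is (dg i).-homog),
      forall w, in_D0 F w -> in_span v predT w
    & forall i, ~ in_span v (fun i' => i' != i) (v i)].

Definition exponents (F : P3) (ds : seq nat) : Prop :=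
  exists m v dg, @min_hom_gens F m v dg /\ ds = sort leq [seq dg i | i <- enum 'I_m].

Definition is_free (F : P3) : Prop := exists d1 d2, exponents F [:: d1; d2].

(* plus-one generated, F of degree d *)
Definition is_pog (F : P3) (d : nat) : Prop :=
  exists d1 d2 d3, exponents F [:: d1; d2; d3] /\ (d1 + d2 = d)%N.

Definition setting (d d1 d2 : nat) (f l : P3) : Prop :=
  [/\ (3 <= d)%N, f \is d.-homog, f != 0 & reduced f] /\
  [/\ l \is 1.-homog, l != 0, ~ (exists h, f = l * h)
    & exponents f [:: d1; d2]].

Definition case1 (d1 d2 : nat) (F' : P3) : Prop :=
  exists ds, exponents F' ds /\ (2 <= size ds)%N /\
    nth 0%N ds 0 = d1 /\ nth 0%N ds 1 = d2.+1.
Definition case2 (d1 d2 : nat) (F' : P3) : Prop :=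
  (d1 < d2)%N /\ exists ds, exponents F' ds /\ (2 <= size ds)%N /\
    nth 0%N ds 0 = d1.+1 /\ nth 0%N ds 1 = d2.
Definition case3 (d1 d2 : nat) (F' : P3) : Prop :=
  exists ds, exponents F' ds /\ (2 <= size ds)%N /\
    nth 0%N ds 0 = d1.+1 /\ nth 0%N ds 1 = d2.+1.

Definition exactly_one3 (A B C : Prop) : Prop :=
  (A /\ ~ B /\ ~ C) \/ (~ A /\ B /\ ~ C) \/ (~ A /\ ~ B /\ C).

(* Main.v *)
(** If the curve [f = 0] is free, the derivations killing [f] have a basis of two
derivations [v_0, v_1] of degrees [d_1, d_2], and by Saito's criterion the cross
product of [v_0] and [v_1] is a nonzero constant times the gradient of [f].
Restrict [v_0 l] and [v_1 l] to the line [l = 0], let [gam] be the gcd of these two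
binary forms and [e] its degree.

A derivation kills [f l] exactly when it is [a v_0 + b v_1 - c E / (d + 1)], with [E]
the Euler derivation and [a (v_0 l) + b (v_1 l) = c l].  So these derivations are
the syzygies of [v_0 l, v_1 l] on the line, generated by [(l, 0)], [(0, l)] and
the lift of the reduced syzygy, of degrees [d_1 + 1], [d_2 + 1] and [d_1 + d_2 - e].
One of the first two is redundant when the reduced syzygy has a constant entry,
and this happens exactly for [e >= d_1].

Let [i] be the intersection multiplicity of curve and line at a common point, and
[e_q] the multiplicity of the point in [gam].  Adding the line increases the Milnor
number by [2 i - 1], which is seen by computing colengths along the branches of a
polar curve, and the Tjurina number by [i + e_q], because [e_q] is the minimal order on
the line of the coefficient transverse to it of a local logarithmic derivation.
Thus the point contributes [i - 1 - e_q] to [eps].  All zeros of [gam] lie on the curve,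
so summing over the points gives [r + eps = d - e], and the theorem follows from
[d_1 + d_2 = d - 1]. *)

Require Import Defs.
From HB Require Import structures.
From mathcomp Require Import all_boot all_order all_algebra.
From mathcomp Require Import Rstruct complex.
From mathcomp Require Import mpoly.
From mathcomp Require Import perm ring zify.
From Stdlib Require Import Classical ClassicalEpsilon.
Import Order.TTheory GRing.Theory Num.Theory.
Local Open Scope ring_scope.

Set Implicit Arguments.
Unset Strict Implicit.
Unset Printing Implicit Defensive.

(** * Unique factorization *)

(** The numbers mu and tau live in a localized polynomial ring, without completion, so the branches
    of the polar curve exist only as truncated Puiseux arcs after a base change [tau] to [tau ^+ e].
    An ideal of finite colength contains a power of the maximal ideal, so a fine truncation does not
    change it, and the base change multiplies every colength by [e], which cancels. The number
    chosen by [local_dim] is meaningful only if finite; finiteness comes from squarefreeness, since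
    a prime through the point dividing both partial derivatives would be a double factor. Hence the
    need for unique factorization, which Saito's criterion uses again.

    The increase 2 i - 1 splits as i + (i - 1). Dividing the Jacobian ideal of [tau * g] by [tau]
    costs i, the colength of (tau, g). The ideal of g_X and (tau g)_tau remains; on each of the i -
    1 arcs of g_X = 0, measured before ramification, its second generator has order one more than
    g_tau. *)

Section UFD.
Variable R : idomainType.
Implicit Types a b p : R.

Definition rdiv a b := exists c, b = c * a.

Definition prime_elt p :=
  [/\ p != 0, p \isn't a GRing.unit
    & forall a b, rdiv p (a * b) -> rdiv p a \/ rdiv p b].

Definition primes_prod a :=
  exists u (s : seq R), [/\ u \is a GRing.unit,
    (forall p, p \in s -> prime_elt p) & a = u * \prod_(p <- s) p].

Definition ufd := forall a, a != 0 -> primes_prod a.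

Lemma rdiv_mulr a b c : rdiv a b -> rdiv a (c * b).
Proof. by case=> d ->; exists (c * d); rewrite mulrA. Qed.

Lemma rdiv_mull a b c : rdiv a b -> rdiv a (b * c).
Proof. by rewrite mulrC; apply: rdiv_mulr. Qed.

Lemma rdivD a b c : rdiv a b -> rdiv a c -> rdiv a (b + c).
Proof. by move=> [d ->] [e ->]; exists (d + e); rewrite mulrDl. Qed.

Lemma rdivB a b c : rdiv a b -> rdiv a c -> rdiv a (b - c).
Proof. by move=> [d ->] [e ->]; exists (d - e); rewrite mulrBl. Qed.

Lemma rdiv0 a : rdiv a 0. Proof. by exists 0; rewrite mul0r. Qed.

Lemma rdiv_refl a : rdiv a a. Proof. by exists 1; rewrite mul1r. Qed.

Lemma rdiv_trans a b c : rdiv a b -> rdiv b c -> rdiv a c.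
Proof. by move=> ab [d ->]; apply: rdiv_mulr. Qed.

Lemma rdiv_unit a u : u \is a GRing.unit -> rdiv a u -> a \is a GRing.unit.
Proof. by move=> uu [c e]; move: uu; rewrite e unitrM => /andP[]. Qed.

Lemma prime_mulP p a b : prime_elt p -> ~ rdiv p a -> rdiv p (a * b) -> rdiv p b.
Proof. by case=> _ _ h na /h[]. Qed.

Lemma primes_prod_unit u : u \is a GRing.unit -> primes_prod u.
Proof. by move=> uu; exists u, [::]; split=> //; rewrite big_nil mulr1. Qed.

Lemma primes_prod_prime p : prime_elt p -> primes_prod p.
Proof.
move=> pp; exists 1, [:: p]; split; rewrite ?unitr1 ?big_seq1 ?mul1r //.
by move=> q; rewrite inE => /eqP ->.
Qed.

Lemma primes_prodM a b : primes_prod a -> primes_prod b -> primes_prod (a * b).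
Proof.
move=> [u [s [uu hs ->]]] [v [t [vu ht ->]]]; exists (u * v), (s ++ t).
split; first by rewrite unitrM uu.
  by move=> p; rewrite mem_cat => /orP[/hs|/ht].
by rewrite big_cat /= mulrACA.
Qed.

(** The prime [p] divides some factor [q], and [q], being prime, divides [p] in turn; the two are
    associated and the unit goes into [v]. The equation on sizes makes the number of primes an
    induction measure. *)
Lemma primes_prod_div u s p :
  u \is a GRing.unit -> (forall q, q \in s -> prime_elt q) -> prime_elt p ->
  rdiv p (u * \prod_(q <- s) q) ->
  exists v t, [/\ v \is a GRing.unit, (forall q, q \in t -> prime_elt q),
    size s = (size t).+1 & u * \prod_(q <- s) q = p * (v * \prod_(q <- t) q)].
Proof.
elim: s u => [|q s IH] u uu hs pp.
  rewrite big_nil mulr1 => hd; case: pp => _ /negP[]; exact: rdiv_unit hd.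
have hq : prime_elt q by apply: hs; rewrite mem_head.
have hs' r : r \in s -> prime_elt r by move=> rs; apply: hs; rewrite inE rs orbT.
rewrite big_cons mulrCA => hd; have [_ _ /(_ _ _ hd)[] hdq] := pp.
  have [k e] := hdq; have [q0 nuq /(_ k p)] := hq.
  rewrite -e => /(_ (rdiv_refl q)) [] [m em].
    case: (pp) => _ /negP[]; move/eqP: e; rewrite em mulrAC -subr_eq0.
    rewrite -{1}[q]mul1r -mulrBl mulf_eq0 (negbTE q0) orbF subr_eq0 => /eqP e.
    by move: (unitr1 R); rewrite e unitrM => /andP[].
  exists (k * u), s; split => //; last by rewrite e; ring.
  rewrite unitrM uu andbT; move/eqP: em; rewrite e mulrA -subr_eq0.
  rewrite -{1}[p]mul1r -mulrBl mulf_eq0 subr_eq0; case: (pp) => /negbTE -> _ _.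
  by rewrite orbF => /eqP em; move: (unitr1 R); rewrite em unitrM => /andP[].
have [v [t [uv ht sz e]]] := IH u uu hs' pp hdq.
exists v, (q :: t); split=> //; last 2 first.
- by rewrite /= sz.
- by rewrite e big_cons; ring.
by move=> r; rewrite inE => /orP[/eqP->|/ht].
Qed.

Lemma primes_prod_cancel p a : prime_elt p -> primes_prod (p * a) -> primes_prod a.
Proof.
move=> pp [u [s [uu hs e]]].
have [|v [t [uv ht _ e']]] := primes_prod_div uu hs pp.
  by rewrite -e mulrC; exists a.
exists v, t; split => //; case: pp => p0 _ _.
by apply: (mulfI p0); rewrite e.
Qed.

Lemma ufd_exists_prime a : ufd -> a != 0 -> a \isn't a GRing.unit ->
  exists2 p, prime_elt p & rdiv p a.
Proof.
move=> hR a0; case: (hR a a0) => u [[|p s] [uu hs ->]].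
  by rewrite big_nil mulr1 uu.
move=> _; exists p; first by apply: hs; rewrite mem_head.
by rewrite big_cons mulrCA; apply: rdiv_mull; apply: rdiv_refl.
Qed.

End UFD.

Lemma ufd_field (F : fieldType) : ufd F.
Proof. by move=> a a0; apply: primes_prod_unit; rewrite unitfE. Qed.

Lemma rmorph_rdiv (R S : idomainType) (f : {rmorphism R -> S}) a b :
  rdiv a b -> rdiv (f a) (f b).
Proof. by case=> c ->; exists (f c); rewrite rmorphM. Qed.

Lemma ufd_iso (R S : idomainType) (f : {rmorphism R -> S}) (g : {rmorphism S -> R}) :
  cancel f g -> cancel g f -> ufd S -> ufd R.
Proof.
move=> fK gK hS a a0.
have [|u [s [uu hs e]]] := hS (f a); first by rewrite -(rmorph0 f) (can_eq fK).
exists (g u), [seq g p | p <- s]; split; first exact: rmorph_unit.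
  move=> _ /mapP[p /hs [p0 up hp] ->]; split.
  - by rewrite -(rmorph0 g) (can_eq gK).
  - by apply: contra up => /(rmorph_unit f); rewrite gK.
  move=> b c /(rmorph_rdiv f); rewrite gK rmorphM => /hp[] /(rmorph_rdiv g);
    by rewrite fK; tauto.
by rewrite big_map -rmorph_prod -rmorphM -e fK.
Qed.

(** * Gauss's lemma: polynomials over a factorial domain *)

Section UFDPoly.
Variable R : idomainType.

Lemma rdiv_polyC (c : R) (a : {poly R}) :
  rdiv c%:P a <-> forall i, rdiv c a`_i.
Proof.
split=> [[b ->] i|h]; first by rewrite coefMC; exists b`_i.
have h' i := constructive_indefinite_description _ (h i).
exists (\poly_(i < size a) sval (h' i)); apply/polyP=> i.
rewrite coefMC coef_poly; case: ltnP => hi; last by rewrite nth_default ?mul0r.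
by case: (h' i).
Qed.

(** Descent on sizes: [p] divides the product of the leading coefficients, hence one of them, and
    removing that leading term keeps the product divisible while the total size drops. *)
Lemma prime_polyC (p : R) : prime_elt p -> prime_elt p%:P.
Proof.
move=> [p0 up hp]; split; first by rewrite polyC_eq0.
  by rewrite poly_unitE coefC eqxx (negbTE up) andbF.
move=> a b; have [n] := ubnP (size a + size b); elim: n a b => // n IH a b.
have [->|a0] := eqVneq a 0; first by left; apply: rdiv0.
have [->|b0] := eqVneq b 0; first by right; apply: rdiv0.
rewrite ltnS => hn hab.
have lt_lead (c : {poly R}) : c != 0 ->
    (size (c - lead_coef c *: 'X^((size c).-1))%R < size c)%N.
  move=> c0; case E: (size c) => [|k].
    by move/eqP: E; rewrite size_poly_eq0 (negbTE c0).
  rewrite ltnS; apply/leq_sizeP => j; rewrite coefB coefZ coefXn leq_eqVlt /=.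
  case/orP=> [/eqP<-|hj]; first by rewrite lead_coefE E eqxx mulr1 subrr.
  by rewrite gtn_eqF // mulr0 subr0 nth_default ?E.
have rdiv_lead (c : {poly R}) k : rdiv p (lead_coef c) -> rdiv p%:P (lead_coef c *: 'X^k).
  by move=> hc; apply/rdiv_polyC => i; rewrite coefZ; apply: rdiv_mull.
have : rdiv p (lead_coef a * lead_coef b).
  by rewrite -lead_coefM; move/rdiv_polyC: hab => /(_ (size (a * b)).-1).
case/hp => hl.
  have [||h|] := IH (a - lead_coef a *: 'X^((size a).-1)) b _ _; last by right.
  - by apply: leq_trans hn; rewrite ltn_add2r lt_lead.
  - by rewrite mulrBl; apply: rdivB => //; apply: rdiv_mull; apply: rdiv_lead.
  by left; rewrite -[a](subrK (lead_coef a *: 'X^((size a).-1))); apply: rdivD => //; apply: rdiv_lead.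
have [|||h] := IH a (b - lead_coef b *: 'X^((size b).-1)) _ _; last 1 first.
- by right; rewrite -[b](subrK (lead_coef b *: 'X^((size b).-1))); apply: rdivD => //; apply: rdiv_lead.
- by apply: leq_trans hn; rewrite ltn_add2l lt_lead.
- by rewrite mulrBr; apply: rdivB => //; apply: rdiv_mulr; apply: rdiv_lead.
by left.
Qed.

Lemma primes_prod_polyC (c : R) : primes_prod c -> primes_prod c%:P.
Proof.
move=> [u [s [uu hs ->]]]; exists u%:P, [seq p%:P | p <- s]; split.
- have u0 : u != 0 by apply: contraTneq uu => ->; rewrite unitr0.
  by rewrite poly_unitE size_polyC coefC eqxx uu u0.
- by move=> _ /mapP[p /hs hp ->]; apply: prime_polyC.
by rewrite big_map -rmorph_prod -polyCM.
Qed.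

Definition primitive (a : {poly R}) := forall p, prime_elt p -> ~ rdiv p%:P a.

Hypothesis hR : ufd R.

(** Termination is the point: a constant prime dividing [a] divides its leading coefficient, and
    dividing it out shortens the factorization of that coefficient. *)
Lemma content_primitive (a : {poly R}) : a != 0 ->
  exists c a', [/\ c != 0, primitive a' & a = c%:P * a'].
Proof.
move=> a0; have : lead_coef a != 0 by rewrite lead_coef_eq0.
move=> /hR [u [s]]; have [n] := ubnP (size s); elim: n a u s a0 => // n IH a u s a0.
rewrite ltnS => hn [uu hs e].
have [[p [pp [b eb]]]|npa] := classic (exists p, prime_elt p /\ rdiv p%:P a); last first.
  by exists 1, a; split; rewrite ?oner_neq0 ?mul1r // => p pp pa; apply: npa; exists p.
have b0 : b != 0 by apply: contraNneq a0 => b0; rewrite eb b0 mul0r.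
have eq_lead : lead_coef a = p * lead_coef b by rewrite eb lead_coefM lead_coefC mulrC.
have [|v [t [uv ht sz e']]] := primes_prod_div uu hs pp.
  by rewrite -e eq_lead mulrC; exists (lead_coef b).
have p0 : p != 0 by case: pp.
have [||c [a' [c0 pa' ea']]] := IH b v t b0.
- by rewrite -ltnS -sz.
- by split=> //; apply: (mulfI p0); rewrite -e' -e.
by exists (p * c), a'; split; rewrite ?mulf_neq0 // eb ea' polyCM; ring.
Qed.

(** A prime of [k] divides [b * q] for the quotient [q] but not the primitive [b], so by Gauss it
    divides [q]; the primes of [k] are cancelled one at a time. *)
Lemma primitive_rdiv (k : R) (a b : {poly R}) :
  k != 0 -> primitive b -> rdiv b (k%:P * a) -> rdiv b a.
Proof.
move=> k0 pb; have [u [s [uu hs ->]]] := hR k0.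
elim: s hs => [|p s IH] hs; last first.
  have pp : prime_elt p by apply: hs; rewrite mem_head.
  rewrite big_cons mulrCA polyCM -mulrA => -[q e].
  have : rdiv p%:P q.
    have : rdiv p%:P (b * q) by rewrite mulrC -e mulrC; exists ((u * \prod_(j <- s) j)%:P * a).
    by apply: prime_mulP; [apply: prime_polyC | apply: pb].
  case=> q' eq'; apply: IH => [r rs|]; first by apply: hs; rewrite inE rs orbT.
  exists q'; have p0 : p%:P != 0 by rewrite polyC_eq0; case: pp.
  by apply: (mulfI p0); rewrite e eq'; ring.
rewrite big_nil mulr1 => -[q e]; exists (u^-1%:P * q).
by rewrite -mulrA -e mulrA -polyCM mulVr // mul1r.
Qed.

(** Irreducibility and coprimality are meant over the fraction field. There [a] divides one of the
    two factors, which in the ring means up to a constant, and [primitive_rdiv] removes that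
    constant. *)
Lemma primitive_irreducible_prime (a : {poly R}) :
  primitive a -> irreducible_poly a -> prime_elt a.
Proof.
move=> pa irr; split.
- exact: irredp_neq0.
- by rewrite poly_unitE; case: irr => + _; case: (size a) => [|[]].
move=> b c [d ed].
have nz k (q : {poly R}) : k != 0 -> rdiv a (k *: q) -> rdiv a q.
  by move=> knz; rewrite -mul_polyC; apply: primitive_rdiv.
have [cop|ncop] := boolP (coprimep a b).
  have : a %| b * c by rewrite ed dvdp_mulIr.
  rewrite Gauss_dvdpr // => /Pdiv.Idomain.dvdpP[[k q] /= k0 e].
  by right; apply: (nz k) => //; exists q.
have : a %| b.
  have := irr (gcdp a b) ncop (dvdp_gcdl _ _).
  by move=> /eqp_dvdl <-; apply: dvdp_gcdr.
move=> /Pdiv.Idomain.dvdpP[[k q] /= k0 e].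
by left; apply: (nz k) => //; exists q.
Qed.

Theorem ufd_poly : ufd {poly R}.
Proof.
move=> a; have [n] := ubnP (size a); elim: n a => // n IH a; rewrite ltnS => hn a0.
have [sz1|sz1] := leqP (size a) 1.
  by rewrite (size1_polyC sz1); apply/primes_prod_polyC/hR; rewrite -polyC_eq0 -size1_polyC.
have [irr|nirr] := classic (irreducible_poly a).
  have [c [a' [c0 pa' e]]] := content_primitive a0; rewrite e.
  apply: primes_prodM; first exact/primes_prod_polyC/hR.
  apply/primes_prod_prime/primitive_irreducible_prime => //.
  have eqa : a %= a' by rewrite e mul_polyC eqp_scale.
  split; first by rewrite -(eqp_size eqa).
  by move=> q szq hq; rewrite -(eqp_rtrans eqa); apply: irr => //; rewrite (eqp_dvdr _ eqa).
have [q [szq qa nqa]] : exists q : {poly R}, [/\ size q != 1, q %| a & ~ q %= a].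
  apply: NNPP => H; apply: nirr; split=> // q szq qa.
  by apply: NNPP => nqa; apply: H; exists q.
have lt_q : (size q < size a)%N.
  by rewrite ltn_neqAle dvdp_leq // andbT dvdp_size_eqp //; apply/negP.
(* The splitting of [a] holds over the fraction field; in the ring only [k *: a] factors, so the
   primes of [k] are cancelled afterwards. *)
have /Pdiv.Idomain.dvdpP[[k r] /= k0 e] := qa.
have q0 : q != 0 by apply: contraTneq qa => ->; rewrite dvd0p.
have r0 : r != 0.
  by apply/eqP => r0; move/eqP: e; rewrite r0 mul0r -mul_polyC mulf_eq0 polyC_eq0 (negbTE k0) (negbTE a0).
have lt_r : (size r < size a)%N.
  have -> : size a = (size r + size q).-1 by rewrite -size_mul // -e size_scale.
  have : (size q != 0)%N by rewrite size_poly_eq0.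
  by move: szq; case: (size q) => [|[|m]] // _ _; rewrite addnS /= addnS ltnS leq_addr.
have : primes_prod (k%:P * a).
  by rewrite mul_polyC e; apply: primes_prodM; apply: IH => //; apply: leq_trans hn.
have [u [s [uu hs ->]]] := hR k0.
elim: s hs => [|p s IHs] hs; last first.
  have pp : prime_elt p by apply: hs; rewrite mem_head.
  rewrite big_cons mulrCA polyCM -mulrA => /primes_prod_cancel h.
  by apply: IHs => [t ts|]; [apply: hs; rewrite inE ts orbT | apply/h/prime_polyC].
rewrite big_nil mulr1 => h.
have -> : a = (u^-1)%:P * (u%:P * a) by rewrite mulrA -polyCM mulVr // mul1r.
apply: primes_prodM => //; apply/primes_prod_polyC/primes_prod_unit.
by rewrite unitrV.
Qed.

End UFDPoly.

(** * Approximate Newton-Puiseux theorem *)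

Section NewtonPuiseux.
Variable C : numClosedFieldType.
Notation K := {poly C}.
Notation W := {poly {poly C}}.
Implicit Types (a b c p : W) (q : K).

(* [W] stands for the plane: the outer variable of [W] is the first coordinate,
   [tau] the second one, and [tau = 0] is the line that will be added to the curve.
   [ev0] restricts to that line and [ram e] substitutes [tau ^+ e] for [tau]. *)
Definition tau : W := 'X%:P.
Definition ev0 : {rmorphism W -> K} := map_poly (horner_eval (0 : C)).
Definition cst : {rmorphism K -> W} := map_poly (@polyC C).
Definition ram e : {rmorphism W -> W} := map_poly (comp_poly ('X^e : K)).

Lemma ev0_cst q : ev0 (cst q) = q.
Proof.
rewrite /ev0 /cst /= -map_poly_comp map_poly_id // => c _ /=.
by rewrite horner_evalE hornerC.
Qed.

Lemma ev0_tau : ev0 tau = 0.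
Proof. by rewrite /ev0 /tau /= map_polyC /= horner_evalE hornerX. Qed.

Lemma coef_ev0 a i : (ev0 a)`_i = (a`_i).[0].
Proof. by rewrite coef_map /= horner_evalE. Qed.

Lemma tau0 : tau != 0. Proof. by rewrite polyC_eq0 polyX_eq0. Qed.

Lemma rdiv_X0 q : q.[0] = 0 -> rdiv 'X q.
Proof. by move/eqP/factor_theorem => [c]; rewrite subr0 => ->; exists c. Qed.

Lemma ev0_eq0 a : ev0 a = 0 -> exists c, a = tau * c.
Proof.
move=> h; suff [c ->] : rdiv tau a by exists c; rewrite mulrC.
by apply/rdiv_polyC => i; apply: rdiv_X0; rewrite -coef_ev0 h coef0.
Qed.

(** Lifting by one power of [tau] at a time. The Bezout solution of the linearized equation is
    reduced modulo [w], so the corrections to the first factor stay below its degree and it remains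
    monic; the quotient of that division goes to the second factor, whose degree is not controlled
    here. *)
Lemma hensel p (w u : K) N : ev0 p = w * u -> w \is monic -> coprimep w u ->
  exists W1 U1 c, [/\ W1 \is monic, size W1 = size w, ev0 W1 = w, ev0 U1 = u
    & p = W1 * U1 + tau ^+ N.+1 * c].
Proof.
move=> ep mw /Bezout_eq1_coprimepP [[s r] /= bez].
elim: N => [|N [W1 [U1 [c [mW sW eW eU e]]]]].
  have [c ec] : exists c, p - cst w * cst u = tau * c.
    by apply: ev0_eq0; rewrite rmorphB rmorphM /= !ev0_cst ep subrr.
  exists (cst w), (cst u), c; split; rewrite ?ev0_cst //.
  - exact: monic_map.
  - by rewrite size_map_inj_poly //; apply: polyC_inj.
  - by rewrite expr1 -ec addrC subrK.
have w0 : w != 0 by apply: monic_neq0.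
pose a := (ev0 c * r) %% w; pose b := ev0 c * s + (ev0 c * r) %/ w * u.
have eab : ev0 c = a * u + b * w.
  rewrite -[LHS]mulr1 -bez /b; rewrite mulrDr !mulrA.
  by rewrite {1}(divp_eq (ev0 c * r) w) /a; ring.
have szd : (size (tau ^+ N.+1 * cst a)%R < size W1)%N.
  rewrite sW -rmorphXn mul_polyC; apply: leq_ltn_trans (size_scale_leq _ _) _.
  by rewrite size_map_inj_poly ?ltn_modp //; apply: polyC_inj.
have [d ed] : exists d, c - cst a * U1 - cst b * W1 = tau * d.
  by apply: ev0_eq0; rewrite !rmorphB !rmorphM /= !ev0_cst eW eU eab; ring.
exists (W1 + tau ^+ N.+1 * cst a), (U1 + tau ^+ N.+1 * cst b),
  (d - tau ^+ N * cst a * cst b); split.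
- by rewrite monicE lead_coefDl.
- by rewrite size_polyDl.
- by rewrite rmorphD rmorphM rmorphXn /= ev0_tau expr0n mul0r addr0.
- by rewrite rmorphD rmorphM rmorphXn /= ev0_tau expr0n mul0r addr0.
rewrite e; have -> : c = cst a * U1 + cst b * W1 + tau * d by rewrite -ed; ring.
by rewrite !exprS; ring.
Qed.

Lemma ram_tau e : ram e tau = tau ^+ e.
Proof. by rewrite /ram /tau /= map_polyC /= comp_polyX rmorphXn. Qed.

Lemma ramX e : ram e 'X = 'X. Proof. exact: map_polyX. Qed.

Lemma ramC e q : ram e q%:P = (q \Po 'X^e)%:P.
Proof. exact: map_polyC. Qed.

Lemma ram_ram e f a : ram e (ram f a) = ram (f * e) a.
Proof.
rewrite /ram /= -map_poly_comp; apply: eq_map_poly => q /=.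
by rewrite -comp_polyA rmorphXn /= comp_polyX -exprM mulnC.
Qed.

Lemma ram_prod e (xs : seq K) :
  ram e (\prod_(x <- xs) ('X - x%:P)) = \prod_(x <- xs) ('X - (x \Po 'X^e)%:P).
Proof.
by rewrite rmorph_prod; apply: eq_bigr => x _; rewrite rmorphB /= ramX ramC.
Qed.

Lemma mup0_split q : q != 0 -> exists2 v, v.[0] != 0 & q = 'X^(mup 0 q) * v.
Proof.
move=> q0; have [k [v]] := multiplicity_XsubC q 0; rewrite q0 /= => hv e.
exists v => //; rewrite {2}e mupMr // mup_XsubCX eqxx mulrC {1}e subr0.
by [].
Qed.

Lemma coef_XsubC_exp (R : comNzRingType) (z : R) n :
  (('X - z%:P) ^+ n.+1)`_n = - (z *+ n.+1) /\ (('X - z%:P) ^+ n.+1)`_n.+1 = 1.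
Proof.
have h m : (('X - z%:P) ^+ m)`_m = 1.
  have /monicP := monic_exp m (monicXsubC z).
  by rewrite lead_coefE size_exp_XsubC.
split; last exact: h.
elim: n => [|n IH]; first by rewrite expr1 coefB coefX coefC /= sub0r.
by rewrite exprSr mulrBr coefB coefMX coefMC /= IH h mul1r [in RHS]mulrS opprD addrC.
Qed.

(** If all roots agree, the polynomial is the power n + 1 of X - z, whose coefficient at n is -(n +
    1) z; in characteristic zero its vanishing forces z = 0, the excluded case. *)
Lemma split_reduction (c : K) n :
  c \is monic -> size c = n.+2 -> c`_n = 0 -> c != 'X^(n.+1) ->
  exists w v, [/\ c = w * v, w \is monic, coprimep w v & (1 < size w <= n.+1)%N].
Proof.
move=> mc sc cn cX.
have [|z rz] := closed_rootP c _; rewrite ?sc //.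
have c0 : c != 0 by apply: monic_neq0.
have [m [v]] := multiplicity_XsubC c z; rewrite c0 /= => hv ec.
have cop : coprimep (('X - z%:P) ^+ m) v.
  by rewrite coprimep_expl // coprimep_sym coprimep_XsubC.
have m0 : (0 < m)%N.
  by case: m ec cop => // ec _; move: rz hv; rewrite ec expr0 mulr1 => ->.
exists (('X - z%:P) ^+ m), v; split=> //; first by rewrite mulrC.
  by rewrite monic_exp ?monicXsubC.
rewrite size_exp_XsubC ltnS m0 /= ltnS.
have v0 : v != 0 by apply: contraNneq c0 => v0; rewrite ec v0 mul0r.
have sz : (size v + m = n.+2)%N.
  by rewrite -sc ec size_mul ?expf_neq0 ?polyXsubC_eq0 // size_exp_XsubC addnS.
have : (0 < size v)%N by rewrite size_poly_gt0.
case E: (size v) sz => [|[|k]] //; last by move=> sz _; lia.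
rewrite add1n => -[em] _; have mv : v \is monic.
  by move: mc; rewrite ec monicMr // monic_exp ?monicXsubC.
have v1 : v = 1.
  by rewrite (size1_polyC (eq_leq E)); move/monicP: mv; rewrite lead_coefE E => ->.
case/eqP: cX; move: cn; rewrite ec v1 mul1r em.
have [-> _] := coef_XsubC_exp z n => /eqP.
by rewrite oppr_eq0 mulrn_eq0 /= => /eqP ->; rewrite subr0.
Qed.

(** The error is divided by the monic first factor and the quotient moved into the second one. What
    remains has degree below that of [p], so the product of the factors is monic of the size of [p],
    and the second factor is monic too. *)
Lemma hensel_monic p (w u : K) N : p \is monic ->
  ev0 p = w * u -> w \is monic -> coprimep w u -> (size w <= size p)%N ->
  exists W1 U1 c, [/\ W1 \is monic, U1 \is monic, size W1 = size w,
    (size W1 + size U1 = (size p).+1)%N & p = W1 * U1 + tau ^+ N * c].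
Proof.
move=> mp ep mw cop szw; have [W1 [U [c [mW sW eW eU e]]]] := hensel N ep mw cop.
pose d := tau * c; have ec := Pdiv.RingMonic.rdivp_eq mW d.
set Q := Pdiv.CommonRing.rdivp d W1 in ec; set r := Pdiv.CommonRing.rmodp d W1 in ec.
pose U1 := U + tau ^+ N * Q.
have {}e : p = W1 * U1 + tau ^+ N * r.
  by rewrite e exprSr -mulrA -/d ec /U1; ring.
have szr : (size (tau ^+ N * r)%R < size W1)%N.
  rewrite -rmorphXn mul_polyC; apply: leq_ltn_trans (size_scale_leq _ _) _.
  by apply: Pdiv.CommonRing.ltn_rmodpN0; apply: monic_neq0.
have eWU : W1 * U1 = p - tau ^+ N * r by rewrite e addrK.
have {}szr : (size (- (tau ^+ N * r))%R < size p)%N.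
  by rewrite size_polyN; apply: leq_trans szr _; rewrite sW.
have mWU : W1 * U1 \is monic by rewrite eWU monicE lead_coefDl // (monicP mp).
have mU : U1 \is monic by rewrite -(monicMl _ mW).
exists W1, U1, r; split=> //.
rewrite -(size_polyDl szr) -eWU size_monicM // ?monic_neq0 // prednK // addn_gt0.
by rewrite size_poly_gt0 monic_neq0.
Qed.

Lemma coef_prod_scaled (s : K) (ys : seq K) j : (j <= size ys)%N ->
  (\prod_(y <- ys) ('X - (s * y)%:P))`_j =
  s ^+ (size ys - j) * (\prod_(y <- ys) ('X - y%:P))`_j.
Proof.
elim: ys j => [|y ys IH] j /=.
  by rewrite leqn0 => /eqP ->; rewrite !big_nil mul1r.
rewrite !big_cons !mulrBl !coefB !coefXM !coefCM.
case: j => [|j] /=; first by move=> _; rewrite IH // !subn0 exprS; ring.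
rewrite ltnS => hj; rewrite IH // subSS.
have [lt|ge] := ltnP j (size ys); last first.
  rewrite !(@nth_default _ _ _ j.+1) ?size_prod_XsubC // !mulr0 !subr0 //.
by rewrite IH // -[in RHS](subnSK lt) exprS -(subnSK lt) exprS; ring.
Qed.

Lemma tau_coef N a i : (tau ^+ N * a)`_i = 'X^N * a`_i.
Proof. by rewrite -rmorphXn coefCM. Qed.

Lemma rdiv_tau N a : (forall i, rdiv 'X^N a`_i) -> exists c, a = tau ^+ N * c.
Proof.
move=> h; have [c ->] : rdiv ('X^N : K)%:P a by apply/rdiv_polyC.
by exists c; rewrite mulrC -rmorphXn.
Qed.

(** Translating the approximate roots undoes the shift, so the coefficient below the leading one may
    be assumed to vanish. *)
Lemma puiseux_shift (F : W) (s : K) n N :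
  (exists e xs c, [/\ (0 < e)%N, size xs = n &
    ram e (F \Po ('X + s%:P)) = \prod_(x <- xs) ('X - x%:P) + tau ^+ (e * N) * c]) ->
  exists e xs c, [/\ (0 < e)%N, size xs = n &
    ram e F = \prod_(x <- xs) ('X - x%:P) + tau ^+ (e * N) * c].
Proof.
move=> [e [xs [c [e0 sx h]]]]; pose s' := s \Po 'X^e.
exists e, [seq x + s' | x <- xs], (c \Po ('X - s'%:P)); split; rewrite ?size_map //.
have -> : ram e F = ram e (F \Po ('X + s%:P)) \Po ('X - s'%:P).
  rewrite [in RHS]/ram /= map_comp_poly /= rmorphD /= -!/(ram e _) ramX ramC.
  rewrite -comp_polyA comp_polyD comp_polyX comp_polyC subrK.
  by rewrite comp_polyXr.
rewrite h comp_polyD comp_polyM -!rmorphXn comp_polyC rmorph_prod /= big_map.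
congr (_ + _); apply: eq_bigr => x _.
by rewrite comp_polyB comp_polyX comp_polyC polyCD opprD addrA addrAC.
Qed.

Lemma coef_tschirnhaus (F : W) n : F \is monic -> size F = n.+2 ->
  exists s : K, (F \Po ('X + s%:P))`_n = 0.
Proof.
move=> mF sF; pose s := - ((n.+1)%:R^-1 *: F`_n); exists s.
pose r := F - 'X^(n.+1) - (F`_n)%:P * 'X^n.
have szr : (size r <= n)%N.
  apply/leq_sizeP => j hj; rewrite !coefB coefXn coefCM coefXn.
  move: hj; rewrite leq_eqVlt => /orP[/eqP<-|].
    by rewrite eqxx mulr1 ltn_eqF // subr0 subrr.
  rewrite leq_eqVlt => /orP[/eqP<-|hj]; last first.
    by rewrite nth_default ?sF // (gtn_eqF hj) (gtn_eqF (ltnW hj)) mulr0 !subr0.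
  by rewrite eqxx gtn_eqF // mulr0 subr0; move/monicP: mF; rewrite lead_coefE sF => ->; rewrite subrr.
have eF : F = 'X^(n.+1) + (F`_n)%:P * 'X^n + r by rewrite /r; ring.
rewrite {1}eF; move: r szr {eF} => r szr.
rewrite !comp_polyD comp_polyM comp_polyC !rmorphXn /= comp_polyX !coefD coefCM.
rewrite [(r \Po _)`_n]nth_default ?size_comp_poly2 ?size_XaddC // addr0.
have -> : 'X + s%:P = 'X - (- s)%:P by rewrite polyCN opprK.
have [-> _] := coef_XsubC_exp (- s) n.
have -> : (('X - (- s)%:P) ^+ n)`_n = 1.
  by case: n {szr r sF} s => [|n] s; [rewrite expr0 coef1 | have [] := coef_XsubC_exp (- s) n].
rewrite mulr1 mulNrn opprK /s mulNrn -scaler_nat scalerA mulfV ?pnatr_eq0 //.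
by rewrite scale1r addNr.
Qed.

(** After ramification the minimal slope of the Newton polygon is rescaled to zero; the reduction at
    [tau = 0] then has two distinct roots, Hensel's lemma splits the polynomial, and induction on
    the degree treats both factors. Ramification also multiplies the precision, hence the exponent
    [e * N]. *)
Lemma newton_puiseux n (F : W) N : F \is monic -> size F = n.+1 ->
  exists e xs c, [/\ (0 < e)%N, size xs = n &
    ram e F = \prod_(x <- xs) ('X - x%:P) + tau ^+ (e * N) * c].
Proof.
have [m] := ubnP n; elim: m n F N => // m IH n F N; rewrite ltnS => hm mF sF.
case: n hm sF => [|n] hm sF.
  exists 1%N, [::], 0; split=> //; rewrite big_nil mulr0 addr0.
  have -> : F = 1 by rewrite (size1_polyC (eq_leq sF)); move/monicP: mF; rewrite lead_coefE sF => ->.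
  exact: rmorph1.
have [s hs] := coef_tschirnhaus mF sF; apply: (puiseux_shift (s := s)).
set F1 := F \Po _ in hs *.
have sF1 : size F1 = n.+2 by rewrite size_comp_poly2 ?size_XaddC.
have mF1 : F1 \is monic.
  by rewrite monicE lead_coef_comp ?size_XaddC // (monicP mF) lead_coefXaddC expr1n mulr1.
move: F1 hs sF1 mF1 => {F mF sF s} F hs sF mF.
(* When the lower coefficients are invisible at precision [N], all approximate roots can be taken to
   be 0; otherwise some slope exists. *)
have [allN|] := classic (forall j : 'I_n.+1, rdiv 'X^N F`_j).
  have [c hc] : exists c, F - 'X^(n.+1) = tau ^+ N * c.
    apply: rdiv_tau => i; rewrite coefB coefXn.
    have [lt|] := ltnP i n.+1.
      by rewrite ltn_eqF // subr0; apply: (allN (Ordinal lt)).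
    rewrite leq_eqVlt => /orP[/eqP<-|hi].
      by move/monicP: mF; rewrite lead_coefE sF => ->; rewrite eqxx subrr; apply: rdiv0.
    by rewrite nth_default ?sF // gtn_eqF // subr0; apply: rdiv0.
  exists 1%N, (nseq n.+1 0), c; split; rewrite ?size_nseq //.
  have -> : \prod_(x <- nseq n.+1 (0 : K)) ('X - x%:P) = 'X^(n.+1) :> W.
    by rewrite big_nseq subr0 -Monoid.iteropE.
  rewrite mul1n -hc addrC subrK /ram /= map_poly_id // => q _.
  by rewrite /= expr1 comp_polyXr.
move=> /not_all_ex_not[j1 hj1].
have hj1' : F`_j1 != 0 by apply/eqP => h; apply: hj1; rewrite h; apply: rdiv0.
(* Each denominator n + 1 - j of a slope divides the factorial, so all slopes are integral after
   this ramification. *)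
pose fn := (n.+1)`!.
have fnE (j : 'I_n.+1) : exists2 g, (0 < g)%N & (fn = g * (n.+1 - j))%N.
  have /dvdnP[g hg] : (n.+1 - j %| fn)%N by rewrite dvdn_fact // subn_gt0 ltn_ord leq_subr.
  by exists g => //; have := fact_gt0 n.+1; rewrite -/fn hg muln_gt0 => /andP[].
pose o (j : 'I_n.+1) := mup 0 F`_j.
pose w (j : 'I_n.+1) := (o j * (fn %/ (n.+1 - j)))%N.
have wE (j : 'I_n.+1) : (w j * (n.+1 - j) = o j * fn)%N.
  have [g g0 e] := fnE j; rewrite /w e mulnK ?subn_gt0 //; lia.
have [j0 hj0 minj0] := @arg_minnP _ j1 [pred j : 'I_n.+1 | F`_j != 0] w hj1'.
pose k := w j0; pose F2 := ram fn F.
have coefF2 i : F2`_i = F`_i \Po 'X^fn by rewrite coef_map.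
have oE (j : 'I_n.+1) : F`_j != 0 ->
    exists2 v : K, v.[0] != 0 & F2`_j = 'X^(w j * (n.+1 - j)) * v.
  move=> /mup0_split [v hv ev]; exists (v \Po 'X^fn).
    by rewrite horner_comp hornerXn expr0n gtn_eqF ?fact_gt0.
  by rewrite coefF2 ev comp_polyM rmorphXn /= comp_polyX -exprM wE mulnC.
have divF2 i : (i <= n.+1)%N -> rdiv 'X^(k * (n.+1 - i)) F2`_i.
  rewrite leq_eqVlt => /orP[/eqP->|lt].
    by rewrite subnn muln0 expr0; exists (F2`_n.+1); rewrite mulr1.
  have [h|h] := eqVneq F`_i 0; first by rewrite coefF2 h comp_poly0; apply: rdiv0.
  have [v _ ->] := oE (Ordinal lt) h; apply: rdiv_mull.
  exists ('X^((w (Ordinal lt) - k) * (n.+1 - i))); rewrite -exprD /= -mulnDl subnK //.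
  exact: minj0.
have sF2 : size F2 = n.+2.
  rewrite size_map_poly_id0 ?sF // (monicP mF); rewrite rmorph1; exact: oner_neq0.
have mF2 : F2`_n.+1 = 1.
  by rewrite coefF2; move/monicP: mF; rewrite lead_coefE sF => ->; apply: rmorph1.
(* These are the coefficients of F2 (tau^k X) / tau^(k (n + 1)). Minimality of the slope [k] makes
   the divisions exact, and the coefficient at [j0] becomes nonzero at [tau = 0]. *)
pose g i := F2`_i %/ 'X^(k * (n.+1 - i)).
have gE i : (i <= n.+1)%N -> F2`_i = g i * 'X^(k * (n.+1 - i)).
  by move=> /divF2 [c hc]; rewrite /g hc mulpK // expf_neq0 ?polyX_eq0.
pose G := \poly_(i < n.+2) g i.
have gn : g n.+1 = 1 by rewrite -mF2 (gE n.+1) // subnn muln0 expr0 mulr1.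
have sG : size G = n.+2 by rewrite size_poly_eq //= gn oner_neq0.
have mG : G \is monic by rewrite monicE lead_coefE sG /= coef_poly ltnSn gn.
have sG0 : size (ev0 G) = n.+2.
  by rewrite size_map_poly_id0 ?sG // (monicP mG) /= horner_evalE hornerC oner_neq0.
have mG0 : ev0 G \is monic.
  by rewrite monicE lead_coefE sG0 /= coef_ev0 coef_poly ltnSn gn hornerC.
have Gn : (ev0 G)`_n = 0.
  rewrite coef_ev0 coef_poly ltnW // /g coefF2 hs comp_poly0 div0p horner0 //.
have GnX : ev0 G != 'X^(n.+1).
  apply/eqP => h; have := coef_ev0 G j0; rewrite h coefXn (ltn_eqF (ltn_ord j0)) coef_poly (leqW (ltn_ord j0)).
  have [v hv ev] := oE j0 hj0; rewrite /g ev mulrC mulpK ?expf_neq0 ?polyX_eq0 //.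
  by move=> /esym/eqP; rewrite (negbTE hv).
have [u [v [euv mu cop /andP[szu1 szu2]]]] := split_reduction mG0 sG0 Gn GnX.
have [|G1 [G2 [c0 [mG1 mG2 sG1 sG2 eG]]]] := hensel_monic (fn * N) mG euv mu cop.
  by rewrite sG; apply: leqW.
have [n1 en1] : exists n1, size G1 = n1.+1 by exists (size u).-1; rewrite sG1 prednK // ltnW.
have [n2 en2] : exists n2, size G2 = n2.+1 
  by exists (size G2).-1; move: sG1 sG2 szu1 szu2; rewrite sG; clear; lia.
have n12 : (n1 + n2 = n.+1 /\ 0 < n1 /\ 0 < n2)%N.
  by move: sG1 sG2 szu1 szu2; rewrite sG en1 en2; clear; lia.
have [|e1 [xs1 [c1 [e10 sx1 h1]]]] := IH n1 G1 (fn * N)%N _ mG1 en1.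
  by move: n12 hm; clear; lia.
have [|e2 [xs2 [c2 [e20 sx2 h2]]]] := IH n2 G2 (fn * N)%N _ mG2 en2.
  by move: n12 hm; clear; lia.
(* The two factors need the ramifications [e1] and [e2]; both are refined to the product, and [s]
   undoes the rescaling of the variable. *)
pose E := (e1 * e2)%N; pose s : K := 'X^(k * E).
pose ys := [seq x \Po 'X^e2 | x <- xs1] ++ [seq x \Po 'X^e1 | x <- xs2].
have sys : size ys = n.+1 by rewrite size_cat !size_map sx1 sx2; case: n12.
have [c hc] : exists c, ram E G = \prod_(y <- ys) ('X - y%:P) + tau ^+ (E * (fn * N)) * c.
  rewrite eG rmorphD !rmorphM /= {1}/E -[ram (e1 * e2) G1]ram_ram.
  rewrite {1}/E mulnC -[ram (e2 * e1) G2]ram_ram h1 h2 !rmorphD !rmorphM /= !ram_prod.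
  rewrite big_cat !big_map /= !rmorphXn /= !ram_tau -!exprM.
  set P1 := \prod_(_ <- _) _; set P2 := \prod_(_ <- _) _.
  have -> : (e2 * (e1 * (fn * N)) = E * (fn * N))%N by rewrite mulnA [(e2 * e1)%N]mulnC.
  have -> : (e1 * (e2 * (fn * N)) = E * (fn * N))%N by rewrite mulnA.
  set T := tau ^+ _.
  exists (P1 * ram e1 c2 + ram e2 c1 * P2 + T * (ram e2 c1 * ram e1 c2) + ram E c0).
  by rewrite /ram /=; ring.
exists (fn * E)%N, [seq s * y | y <- ys].
suff [d hd] : exists d, ram E F2 - \prod_(y <- ys) ('X - (s * y)%:P) = tau ^+ (fn * E * N) * d.
  exists d; split; rewrite ?size_map ?muln_gt0 ?fact_gt0 ?e10 //.
  by rewrite big_map -ram_ram -/F2 -hd addrC subrK.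
apply: rdiv_tau => i; rewrite coefB.
have [lt|ge] := leqP i n.+1; last first.
  rewrite !nth_default ?subrr ?size_prod_XsubC ?sys //; first exact: rdiv0.
  by apply: leq_trans (size_poly _ _) _; rewrite sF2.
rewrite coef_prod_scaled ?sys // coef_map /= gE // comp_polyM rmorphXn /= comp_polyX.
rewrite -exprM; have -> : (E * (k * (n.+1 - i)) = k * E * (n.+1 - i))%N by rewrite mulnA [(E * k)%N]mulnC.
have -> : g i \Po 'X^E = (ram E G)`_i by rewrite coef_map coef_poly ltnS lt.
have -> : 'X^(k * E * (n.+1 - i)) = s ^+ (n.+1 - i) by rewrite -exprM.
rewrite [X in X - _]mulrC -mulrBr hc coefD [X in X - _]addrC addrK tau_coef.
have -> : (E * (fn * N) = fn * E * N)%N by rewrite mulnCA mulnA.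
by apply/rdiv_mulr/rdiv_mull/rdiv_refl.
Qed.

(* Truncated Puiseux series, which are enough to compute colengths: modulo a high
   power of [tau], the branches of [p = 0] through the origin become the arcs [X = xs_i]. *)
Lemma arcs p N : ev0 p != 0 -> exists e xs U c,
  [/\ (0 < e)%N, size xs = mup 0 (ev0 p), all (fun x => root x 0) xs,
      (ev0 U).[0] != 0 &
      ram e p = U * \prod_(x <- xs) ('X - x%:P) + tau ^+ (e * N) * c].
Proof.
move=> p0; have [v v0 ev] := mup0_split p0; set m := mup _ _ in ev *.
have cop : coprimep 'X^m v by rewrite coprimep_expl // coprimep_sym coprimepX.
have [W1 [U1 [c [mW sW eW eU e]]]] := hensel N ev (monicXn _ _) cop.
rewrite size_polyXn in sW.
have [e1 [xs [c1 [e10 sx h1]]]] := newton_puiseux N.+1 mW sW.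
exists e1, xs, (ram e1 U1), (tau ^+ e1 * (c1 * ram e1 U1 + ram e1 c)).
have ev0r a : ev0 (ram e1 a) = ev0 a.
  rewrite /ev0 /ram /= -map_poly_comp; apply: eq_map_poly => q /=.
  by rewrite !horner_evalE horner_comp hornerXn expr0n gtn_eqF.
split=> //; last 2 first.
- by rewrite ev0r eU.
- rewrite e rmorphD !rmorphM /= h1 rmorphXn /= ram_tau -exprM mulnSr exprD; ring.
have := congr1 ev0 h1; rewrite ev0r eW rmorphD !rmorphM rmorphXn /= ev0_tau expr0n.
rewrite muln_eq0 gtn_eqF //= mul0r addr0 rmorph_prod /= => eX.
apply/allP => x xin; rewrite rootE; apply/eqP.
have : root ('X^m : K) x.[0].
  rewrite eX rootE horner_prod (big_rem x xin) /= rmorphB /= map_polyX map_polyC /=.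
  by rewrite horner_evalE hornerXsubC subrr mul0r.
by rewrite rootE hornerXn expf_eq0 => /andP[_ /eqP].
Qed.

End NewtonPuiseux.

(** * Dimensions of quotients of ideals *)

Section Qdim.
Variables (F : fieldType) (R : comNzRingType) (kap : {rmorphism F -> R}).
Implicit Types (J K H : R -> Prop).

Definition ideal J :=
  [/\ J 0, forall a b, J a -> J b -> J (a + b) & forall a b, J b -> J (a * b)].

Definition lcomb n (c : 'I_n -> F) (b : 'I_n -> R) := \sum_i kap (c i) * b i.

Definition free_mod J n (b : 'I_n -> R) :=
  forall c, J (lcomb c b) -> forall i, c i = 0.

Definition span_mod J n (b : 'I_n -> R) a := exists c, J (a - lcomb c b).

(* [n] is the dimension of the image of [K] in [R / J]. *)
Definition qdim K J n := exists b : 'I_n -> R,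
  [/\ forall i, K (b i), free_mod J b & forall a, K a -> span_mod J b a].

Lemma idealB J a b : ideal J -> J a -> J b -> J (a - b).
Proof. by case=> _ hD hM ja jb; apply: hD => //; rewrite -mulN1r; apply: hM. Qed.

Lemma ideal_sum J (I : finType) (f : I -> R) :
  ideal J -> (forall i, J (f i)) -> J (\sum_i f i).
Proof. by case=> h0 hD _ hf; apply: (big_ind J). Qed.

Lemma ideal_mulr J a b : ideal J -> J a -> J (a * b).
Proof. by case=> _ _ hM ja; rewrite mulrC; apply: hM. Qed.

Lemma lcombB n (c d : 'I_n -> F) b :
  lcomb (fun i => c i - d i) b = lcomb c b - lcomb d b.
Proof. by rewrite -sumrB; apply: eq_bigr => i _; rewrite rmorphB mulrBl. Qed.

(** With more vectors than coordinates, the coordinate matrix has a nonzero row in its left kernel,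
    which is a relation among the [b i]. *)
Lemma free_mod_le K J n k (b : 'I_k -> R) : ideal J -> qdim K J n ->
  (forall i, K (b i)) -> free_mod J b -> (k <= n)%N.
Proof.
move=> idJ [b' [_ _ span]] Kb free; rewrite leqNgt; apply/negP => lt.
pose c i := sval (constructive_indefinite_description _ (span _ (Kb i))).
have hc i : J (b i - lcomb (c i) b').
  by rewrite /c; case: constructive_indefinite_description.
pose A : 'M[F]_(k, n) := \matrix_(i, j) c i j.
have : kermx A != 0.
  rewrite -mxrank_eq0 mxrank_ker subn_eq0 -ltnNge.
  exact: leq_ltn_trans (rank_leq_col A) lt.
case/matrix0Pn=> i0 [j0 nz]; pose v j := kermx A i0 j.
suff : v j0 = 0 by move/eqP; rewrite (negbTE nz).
apply: free; have -> : lcomb v b = \sum_j kap (v j) * (b j - lcomb (c j) b').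
  rewrite /lcomb -[LHS]subr0; have {2}-> : (0 : R) = \sum_j kap (v j) * lcomb (c j) b'.
    have h0 i : \sum_j v j * c j i = 0.
      have e0 : (kermx A *m A) i0 i = 0 by rewrite mulmx_ker mxE.
      by rewrite -[RHS]e0 [RHS]mxE; apply: eq_bigr => j _; rewrite [A j i]mxE.
    under eq_bigr do rewrite /lcomb mulr_sumr.
    rewrite exchange_big /= big1 // => i _.
    under eq_bigr do rewrite mulrA -rmorphM.
    by rewrite -mulr_suml -rmorph_sum h0 rmorph0 mul0r.
  by rewrite -sumrB; apply: eq_bigr => j _; rewrite mulrBr.
by apply: ideal_sum => // j; case: idJ => _ _; apply.
Qed.

Lemma qdim_uniq K J n m : ideal J -> qdim K J n -> qdim K J m -> n = m.
Proof.
move=> idJ hn hm; apply/eqP; rewrite eqn_leq.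
have [b [Kb fb _]] := hn; have [b' [Kb' fb' _]] := hm.
by rewrite (free_mod_le idJ hm Kb fb) (free_mod_le idJ hn Kb' fb').
Qed.

Lemma qdim_ext K K' J J' n : (forall a, K a <-> K' a) -> (forall a, J a <-> J' a) ->
  qdim K J n -> qdim K' J' n.
Proof.
move=> eK eJ [b [Kb fb sb]]; exists b; split=> [i|c /eJ /fb //|a /eK /sb [c hc]].
  exact/eK.
by exists c; apply/eJ.
Qed.

Lemma qdim_trans H K J m n : ideal J -> ideal K -> (forall a, J a -> K a) ->
  (forall a, K a -> H a) -> qdim H K m -> qdim K J n -> qdim H J (m + n).
Proof.
move=> idJ idK JK KH [b [Hb fb sb]] [b' [Kb' fb' sb']].
pose join T (f : 'I_m -> T) (g : 'I_n -> T) i :=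
  match split i with inl j => f j | inr j => g j end.
have lcj c d : lcomb (join F c d) (join R b b') = lcomb c b + lcomb d b'.
  rewrite /lcomb big_split_ord /=; congr (_ + _); apply: eq_bigr => i _; rewrite /join.
    by rewrite (unsplitK (inl i)).
  by rewrite (unsplitK (inr i)).
have K_lcomb d : K (lcomb d b').
  by apply: ideal_sum => // i; case: idK => _ _; apply; apply: Kb'.
exists (join R b b'); split.
- by move=> i; rewrite /join; case: split => j //; apply/KH.
- move=> c hc.
  pose c1 i := c (lshift n i); pose c2 i := c (rshift m i).
  have ec : lcomb c (join R b b') = lcomb c1 b + lcomb c2 b'.
    rewrite -lcj; apply: eq_bigr => i _; congr (kap _ * _).
    by rewrite /join -(congr1 c (splitK i)); case: (split i).
  rewrite ec in hc; have z1 : forall i, c1 i = 0.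
    apply: fb; rewrite -[lcomb c1 b](addrK (lcomb c2 b')).
    by apply: idealB => //; apply: JK.
  have z2 : forall i, c2 i = 0.
    apply: fb'; have -> // : lcomb c2 b' = lcomb c1 b + lcomb c2 b'.
    by rewrite /lcomb [X in X + _]big1 ?add0r // => i _; rewrite z1 rmorph0 mul0r.
  by move=> i; rewrite -(splitK i); case: (split i) => j /=; [apply: z1 | apply: z2].
move=> a /sb [c /sb' [d hd]]; exists (join F c d).
by rewrite lcj opprD addrA.
Qed.

(** Multiplication by [m] induces an isomorphism from R / (J : m) onto (J + m R) / J. *)
Lemma qdim_colon H J m n : ideal J ->
  (forall h, H h <-> exists r, J (h - m * r)) ->
  qdim (fun _ => True) (fun a => J (m * a)) n -> qdim H J n.
Proof.
move=> idJ hH [b [_ fb sb]]; exists (fun i => m * b i).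
have e c : lcomb c (fun i => m * b i) = m * lcomb c b.
  by rewrite /lcomb mulr_sumr; apply: eq_bigr => i _; rewrite mulrCA.
split=> [i|c|a /hH[r hr]].
- by apply/hH; exists (b i); rewrite subrr; case: idJ.
- by rewrite e => /fb.
have [c hc] := sb r I; exists c; rewrite e.
have -> : a - m * lcomb c b = (a - m * r) + m * (r - lcomb c b) by ring.
by case: idJ => _ hD _; apply: hD.
Qed.

Lemma qdim_of_span K J n (b : 'I_n -> R) : ideal J -> (forall i, K (b i)) ->
  (forall a, K a -> span_mod J b a) -> exists m, qdim K J m.
Proof.
elim: n b => [|n IH] b idJ Kb sb; first by exists 0%N, b; split=> // c _ [].
have [fb|] := classic (free_mod J b); first by exists n.+1, b.
move=> nfree; have [c [hc [i0 ci]]] : exists c, J (lcomb c b) /\ exists i, c i != 0.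
  apply: NNPP => H; apply: nfree => c hc i; apply/eqP/negPn/negP => ci.
  by apply: H; exists c; split=> //; exists i.
apply: (IH (fun j => b (lift i0 j))) => // a /sb [d hd].
pose t := d i0 / c i0.
exists (fun j => d (lift i0 j) - t * c (lift i0 j)).
have idJ' := idJ; case: idJ' => _ hD hM.
suff -> : a - lcomb (fun j => d (lift i0 j) - t * c (lift i0 j)) (fun j => b (lift i0 j))
  = (a - lcomb d b) + kap t * lcomb c b by apply: hD => //; apply: hM.
have -> : kap t * lcomb c b = lcomb (fun i => t * c i) b.
  by rewrite /lcomb mulr_sumr; apply: eq_bigr => i _; rewrite rmorphM mulrA.
rewrite -[RHS]addrA -[X in _ = a + X]opprK opprD opprK -lcombB; congr (_ - _).
by rewrite /lcomb [RHS](bigD1_ord i0) //= divfK // subrr rmorph0 mul0r add0r.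
Qed.

Lemma qdim_fintype J H (I : finType) (b : I -> R) :
  (forall i, H (b i)) ->
  (forall c : I -> F, J (\sum_i kap (c i) * b i) -> forall i, c i = 0) ->
  (forall a, H a -> exists c : I -> F, J (a - \sum_i kap (c i) * b i)) ->
  qdim H J #|I|.
Proof.
move=> Hb fb sb; have [h [g [hK gK]]] : exists (h : 'I_#|I| -> I) g,
    cancel h g /\ cancel g h.
  by exists enum_val, enum_rank; split; [apply: enum_valK | apply: enum_rankK].
have e (c : I -> F) : \sum_i kap (c i) * b i = lcomb (c \o h) (b \o h).
  by rewrite (reindex h) //; exists g => x _.
exists (b \o h); split=> [i|c hc i|a /sb[c]]; first exact: Hb.
  have ec : c =1 (c \o g) \o h by move=> j /=; rewrite hK.
  rewrite ec; apply: (fb (c \o g)); rewrite e; suff -> : lcomb ((c \o g) \o h) (b \o h) = lcomb c (b \o h) by [].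
  by apply: eq_bigr => j _; rewrite -ec.
by rewrite e; exists (c \o h).
Qed.

Lemma qdim_of_span_fin J H (I : finType) (b : I -> R) : ideal J ->
  (forall i, H (b i)) ->
  (forall a, H a -> exists c : I -> F, J (a - \sum_i kap (c i) * b i)) ->
  exists m, qdim H J m.
Proof.
move=> idJ Hb sb; have [h [g [hK gK]]] : exists (h : 'I_#|I| -> I) g,
    cancel h g /\ cancel g h.
  by exists enum_val, enum_rank; split; [apply: enum_valK | apply: enum_rankK].
apply: (@qdim_of_span _ _ _ (b \o h)) => // [i|a /sb[c]]; first exact: Hb.
by rewrite (reindex h) => [hc|]; [exists (c \o h) | exists g => x _].
Qed.

End Qdim.

(** * Colengths of ideals of the local ring at the origin *)

Section Local.
Variable C : numClosedFieldType.
Notation K := {poly C}.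
Notation W := {poly {poly C}}.
Notation tau := (tau C).
Notation ev0 := (ev0 C).
Notation cst := (cst C).
Notation ram := (ram C).
Implicit Types (a b c f p : W) (J : W -> Prop).

Definition kap : {rmorphism C -> W} := (@polyC K) \o (@polyC C).
Definition at0 : {rmorphism W -> C} := horner_eval (0 : C) \o ev0.

Lemma at0E a : at0 a = (ev0 a).[0].
Proof. by rewrite /at0 /= horner_evalE. Qed.

Lemma at0_tau : at0 tau = 0. Proof. by rewrite at0E ev0_tau horner0. Qed.

Lemma at0_polyC (q : K) : at0 q%:P = q.[0].
Proof. by rewrite at0E /= map_polyC /= hornerC horner_evalE. Qed.

Lemma ev0X : ev0 ('X : W) = 'X. Proof. exact: map_polyX. Qed.

Lemma at0_X : at0 'X = 0. Proof. by rewrite at0E ev0X hornerX. Qed.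

Lemma at0_kap (z : C) : at0 (kap z) = z.
Proof. by rewrite at0_polyC hornerC. Qed.

Lemma at0_cst (q : K) : at0 (cst q) = q.[0].
Proof. by rewrite at0E ev0_cst. Qed.

Lemma at0_unit u : u \is a GRing.unit -> at0 u != 0.
Proof. by move=> /(rmorph_unit at0); rewrite unitfE. Qed.

(* Membership in the extension of the ideal (a, b, c) to the local ring of W
   at the origin, for elements of W. *)
Definition sat3 a b c f :=
  exists s, at0 s != 0 /\ exists u v w, s * f = u * a + v * b + w * c.

Definition saturated J := forall s f, at0 s != 0 -> J (s * f) -> J f.

(** An ideal with this property contains a power of (X, tau). Elements nonzero at the origin are
    then already invertible in the quotient of W, so colengths can be computed without
    localizing. *)
Definition prim J := exists M, J 'X^M /\ J (tau ^+ M).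

Lemma sat3_ideal a b c : ideal (sat3 a b c).
Proof.
split.
- exists 1; split; first by rewrite rmorph1 oner_neq0.
  by exists 0, 0, 0; ring.
- move=> f g [s [hs [u [v [w e]]]]] [s' [hs' [u' [v' [w' e']]]]].
  exists (s * s'); split; first by rewrite rmorphM mulf_neq0.
  exists (s' * u + s * u'), (s' * v + s * v'), (s' * w + s * w').
  have -> : s * s' * (f + g) = s' * (s * f) + s * (s' * g) by ring.
  by rewrite e e'; ring.
- move=> f g [s [hs [u [v [w e]]]]]; exists s; split=> //.
  exists (f * u), (f * v), (f * w).
  by rewrite mulrCA e; ring.
Qed.

Lemma sat3_saturated a b c : saturated (sat3 a b c).
Proof.
move=> s f hs [t [ht [u [v [w e]]]]]; exists (t * s); split.
  by rewrite rmorphM mulf_neq0.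
by exists u, v, w; rewrite -mulrA.
Qed.

Lemma sat3_comb a b c f u v w : f = u * a + v * b + w * c -> sat3 a b c f.
Proof.
move=> e; exists 1; split; first by rewrite rmorph1 oner_neq0.
by exists u, v, w; rewrite mul1r.
Qed.

Lemma sat3_gen1 a b c : sat3 a b c a.
Proof. by apply: (sat3_comb (u := 1) (v := 0) (w := 0)); ring. Qed.

Lemma sat3_gen2 a b c : sat3 a b c b.
Proof. by apply: (sat3_comb (u := 0) (v := 1) (w := 0)); ring. Qed.

Lemma sat3_gen3 a b c : sat3 a b c c.
Proof. by apply: (sat3_comb (u := 0) (v := 0) (w := 1)); ring. Qed.

Lemma sat3_le J a b c f : ideal J -> saturated J -> J a -> J b -> J c ->
  sat3 a b c f -> J f.
Proof.
move=> [h0 hD hM] sJ ja jb jc [s [hs [u [v [w e]]]]]; apply: (sJ s) => //.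
by rewrite e; apply: (hD); [apply: (hD)|]; apply: (hM).
Qed.

Lemma sat3_sub a b c a' b' c' f : sat3 a' b' c' a -> sat3 a' b' c' b ->
  sat3 a' b' c' c -> sat3 a b c f -> sat3 a' b' c' f.
Proof. exact: (sat3_le (sat3_ideal _ _ _) (@sat3_saturated _ _ _)). Qed.

Lemma sat30 a b c : sat3 a b c 0.
Proof. by case: (sat3_ideal a b c). Qed.

Hint Resolve sat3_ideal sat3_saturated sat3_gen1 sat3_gen2 sat3_gen3 sat30 : core.

Lemma prim_le J J' : (forall f, J f -> J' f) -> prim J -> prim J'.
Proof. by move=> h [M [hX ht]]; exists M; split; apply: h. Qed.

Lemma split0 a : exists b c, a = kap (at0 a) + 'X * b + tau * c.
Proof.
have [c hc] : exists c, a - cst (ev0 a) = tau * c.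
  by apply: ev0_eq0; rewrite rmorphB /= ev0_cst subrr.
have [q hq] : rdiv 'X (ev0 a - (at0 a)%:P).
  by apply: rdiv_X0; rewrite hornerD hornerN hornerC at0E subrr.
exists (cst q), c; rewrite -[LHS](subrK (cst (ev0 a))) hc addrC; congr (_ + _).
rewrite -[ev0 a](subrK (at0 a)%:P) hq rmorphD rmorphM /= map_polyX map_polyC /=.
by rewrite addrC mulrC.
Qed.

Lemma exprD_ideal J a b M : ideal J -> J (a ^+ M) -> J (b ^+ M) ->
  J ((a + b) ^+ (M + M)).
Proof.
move=> idJ ja jb; rewrite exprDn; apply: ideal_sum => // i; rewrite -mulr_natr.
apply: ideal_mulr => //; case: (leqP M i) => hi.
  rewrite -(subnK hi) exprD mulrA; case: (idJ) => _ _; exact.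
have hi' : (M <= M + M - i)%N by lia.
rewrite -(subnK hi') exprD mulrAC; case: (idJ) => _ _; exact.
Qed.

(** Up to the constant [at0 s], the element [s] is 1 minus an element of (X, tau), nilpotent modulo
    [J]; the inverse is a finite geometric series. *)
Lemma prim_inv J s : ideal J -> prim J -> at0 s != 0 -> exists s', J (1 - s * s').
Proof.
move=> idJ [M [hX ht]] hs; have [b [c e]] := split0 s.
have idM := idJ; case: idM => _ _ hM.
pose n := 1 - kap (at0 s)^-1 * s.
have jn : J (n ^+ (M + M)).
  have -> : n = (- kap (at0 s)^-1 * b) * 'X + (- kap (at0 s)^-1 * c) * tau.
    have h1 : kap (at0 s)^-1 * kap (at0 s) = 1 by rewrite -rmorphM mulVf // rmorph1.
    by rewrite /n {2}e -{1}h1; ring.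
  by apply: exprD_ideal => //; rewrite exprMn; apply: hM.
exists (kap (at0 s)^-1 * \sum_(i < M + M) n ^+ i).
suff -> : 1 - s * (kap (at0 s)^-1 * \sum_(i < M + M) n ^+ i) = n ^+ (M + M) by [].
have := subrX1 n (M + M); have -> : n - 1 = - (kap (at0 s)^-1 * s) by rewrite /n; ring.
by move/eqP; rewrite subr_eq => /eqP ->; ring.
Qed.

Lemma sat_lift J s h m r : ideal J -> prim J -> at0 s != 0 ->
  J (s * h - m * r) -> exists r', J (h - m * r').
Proof.
move=> idJ pJ hs jh; have [s' js] := prim_inv idJ pJ hs; exists (s' * r).
have -> : h - m * (s' * r) = s' * (s * h - m * r) + h * (1 - s * s') by ring.
by case: idJ => _ hD hM; apply: (hD); apply: (hM).
Qed.

Lemma prim_saturated J : ideal J -> prim J -> saturated J.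
Proof.
move=> idJ pJ s f hs js; have [s' j1] := prim_inv idJ pJ hs.
have -> : f = s' * (s * f) + f * (1 - s * s') by ring.
by case: idJ => _ hD hM; apply: (hD); apply: (hM).
Qed.

(** The powers of [xi] below [k] form a basis. This serves both for the order along an arc X = x
    (tau) and for the order along the line [tau = 0]. *)
Lemma qdim_valuation (phi : {rmorphism W -> K}) xi J k :
  (forall z, phi (kap z) = z%:P) -> phi xi = 'X ->
  (forall a, J a <-> rdiv 'X^k (phi a)) -> qdim kap (fun _ => True) J k.
Proof.
move=> phik phix hJ; exists (fun i : 'I_k => xi ^+ i).
have e (c : 'I_k -> C) : phi (lcomb kap c (fun i : 'I_k => xi ^+ i)) =
    \poly_(i < k) (if insub i is Some j then c j else 0).
  rewrite rmorph_sum poly_def; apply: eq_bigr => i _.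
  by rewrite rmorphM rmorphXn /= phik phix mul_polyC valK.
split=> // [c /hJ|a _].
  rewrite e => -[q eq] i; have := congr1 (fun r : K => r`_i) eq.
  by rewrite coef_poly ltn_ord valK coefMXn ltn_ord.
exists (fun i => (phi a)`_i); apply/hJ; rewrite rmorphB e.
exists (drop_poly k (phi a)); apply/eqP; rewrite subr_eq; apply/eqP/polyP => i.
rewrite coefD coefMXn coef_drop_poly coef_poly; case: ltnP => hi.
  by rewrite insubT add0r.
by rewrite addr0 subnK.
Qed.

Lemma prime_tau : prime_elt tau.
Proof.
split; first exact: tau0.
  by apply/negP => /at0_unit; rewrite at0_tau eqxx.
move=> a b [c e].
have : ev0 (a * b) = 0 by rewrite e rmorphM /= ev0_tau mulr0.
rewrite rmorphM => /eqP; rewrite mulf_eq0 => /orP[] /eqP /ev0_eq0 [d ->];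
  by [left; exists d; rewrite mulrC | right; exists d; rewrite mulrC].
Qed.

Lemma ufdW : ufd W.
Proof. by apply: ufd_poly; apply: ufd_poly; apply: ufd_field. Qed.

(** Coprimality is over the fraction field of the polynomials in [tau]. A nontrivial common divisor
    is [p] up to such coefficients; since [p] has positive degree in the outer variable, it divides
    no nonzero one of them, and primality would make it divide [b]. *)
Lemma prime_coprimep p b : prime_elt p -> (1 < size p)%N -> ~ rdiv p b ->
  coprimep p b.
Proof.
move=> pp sp npb; rewrite coprimep_def; apply/negPn/negP => sg.
have p0 : p != 0 by case: pp.
have g0 : gcdp p b != 0 by rewrite gcdp_eq0 negb_and p0.
have nconst (k : K) : k != 0 -> ~ rdiv p k%:P.
  move=> k0 [c e]; have c0 : c != 0.
    by apply/eqP => c0; move/eqP: e; rewrite c0 mul0r polyC_eq0 (negbTE k0).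
  have := size_polyC k; rewrite e size_mul // k0 /=.
  move: c0 sp; rewrite -size_poly_gt0.
  by case: (size c) => // n; case: (size p) => [|[|m]] //= _ _; lia.
have /Pdiv.Idomain.dvdpP[[k r] /= k0 e] := dvdp_gcdl p b.
have hpr : rdiv p r \/ rdiv p (gcdp p b).
  by case: (pp) => _ _; apply; exists k%:P; rewrite -e mul_polyC.
have [[r' er]|[d ed]] := hpr.
  have : k%:P = r' * gcdp p b.
    by apply: (mulIf p0); rewrite mul_polyC e er; ring.
  move/(congr1 (fun q : W => size q)); rewrite size_polyC k0 size_mul //=; last first.
    by apply/eqP => r0; move/eqP: e; rewrite er r0 !mul0r -mul_polyC mulf_eq0 polyC_eq0 (negbTE k0) (negbTE p0).
  have : (0 < size r')%N.
    rewrite size_poly_gt0; apply/eqP => r0; move/eqP: e.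
    by rewrite er r0 !mul0r -mul_polyC mulf_eq0 polyC_eq0 (negbTE k0) (negbTE p0).
  move: sg g0; rewrite -size_poly_gt0.
  by case: (size r') => // n; case: (size _) => [|[|m]] //= _ _ _; lia.
have /Pdiv.Idomain.dvdpP[[k' q] /= k'0 e'] := dvdp_gcdr p b.
apply: (nconst k' k'0); case: pp => _ _ /(_ k'%:P b)[] //.
by rewrite mul_polyC e' ed; exists (q * d); rewrite mulrA.
Qed.

(** The Bezout relation eliminates the outer variable and leaves a nonzero polynomial in [tau], a
    power of [tau] times a unit at the origin. Primes off the origin, and those free of the outer
    variable, which divide [tau], are treated apart. *)
Lemma tau_pow_prime p b : prime_elt p -> ~ (at0 p = 0 /\ rdiv p b) ->
  exists k, sat3 p b 0 (tau ^+ k).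
Proof.
move=> pp; have [p0|p0] := eqVneq (at0 p) 0; last first.
  by move=> _; exists 0%N, p; split=> //; exists 1, 0, 0; ring.
move=> npb; have {}npb : ~ rdiv p b by move=> h; apply: npb.
have [sp|sp] := ltnP 1 (size p); last first.
  have [q eq] : rdiv 'X (p`_0) by apply: rdiv_X0; rewrite -at0_polyC -size1_polyC.
  have ep : p = q%:P * tau by rewrite (size1_polyC sp) eq polyCM.
  exists 1%N; rewrite expr1; case: (pp) => _ _ /(_ q%:P tau)[]; first by rewrite -ep; apply: rdiv_refl.
    case=> c e; have p_neq0 : p != 0 by case: pp.
    have : 1 = c * tau by apply: (mulIf p_neq0); rewrite {1}ep e; ring.
    by move/(congr1 at0)/eqP; rewrite rmorph1 rmorphM at0_tau mulr0 oner_eq0.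
  by case=> c e; apply: (sat3_comb (u := c) (v := 0) (w := 0)); rewrite e; ring.
have /Bezout_coprimepP[[u v] /= /eqp_size] := prime_coprimep pp sp npb.
rewrite size_poly1 => /eqP/size_poly1P[q q0 e].
have [w w0 ew] := mup0_split q0; exists (mup 0 q), w%:P.
rewrite at0_polyC; split=> //; exists u, v, 0.
by rewrite e mul0r addr0 -rmorphXn -polyCM mulrC -ew.
Qed.

(** On the line [a] is a power of X times a unit, so that product agrees with [a] modulo [tau], and
    a high power of it lies in [J]. *)
Lemma X_pow_of_tau J a k : ideal J -> saturated J -> J a -> J (tau ^+ k) ->
  ev0 a != 0 -> exists m, J 'X^m.
Proof.
move=> idJ sJ ja jt /mup0_split [v v0 ev]; set m := mup _ _ in ev.
have [c hc] : exists c, a - cst (ev0 a) = tau * c.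
  by apply: ev0_eq0; rewrite rmorphB /= ev0_cst subrr.
exists (m * (k + k.+1))%N; apply: (sJ (cst v ^+ (k + k.+1))).
  by rewrite rmorphXn expf_neq0 // at0_cst.
have -> : cst v ^+ (k + k.+1) * 'X^(m * (k + k.+1)) = (a + - (tau * c)) ^+ (k + k.+1).
  rewrite exprM -exprMn; congr (_ ^+ _).
  by rewrite -hc opprB addrC subrK ev rmorphM rmorphXn /= map_polyX mulrC.
rewrite addnS exprSr; apply: ideal_mulr => //.
have [k0|k0] := posnP k.
  rewrite k0 !expr0 in jt *; exact: jt.
apply: exprD_ideal => //.
  by rewrite -(prednK k0) exprS; apply: ideal_mulr.
by rewrite exprNn exprMn mulrCA; apply: ideal_mulr.
Qed.

Lemma prim_intro J m k : ideal J -> J 'X^m -> J (tau ^+ k) -> prim J.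
Proof.
move=> [_ _ hM] jx jt; exists (m + k)%N; split; last by rewrite exprD; apply: (hM).
by rewrite addnC exprD; apply: (hM).
Qed.

(** Two plane curves without common component through the origin meet there in finite length. Each
    prime of [a] contributes a power of [tau], and these multiply; a power of X comes from whichever
    of [a], [b] is not divisible by the prime [tau]. *)
Lemma prim_no_common_prime a b :
  (forall p, prime_elt p -> at0 p = 0 -> rdiv p a -> rdiv p b -> False) ->
  prim (sat3 a b 0).
Proof.
move=> ncp.
have [k hk] : exists k, sat3 a b 0 (tau ^+ k).
  have [a0|a0] := eqVneq a 0.
    have b0 : b != 0.
      by apply/eqP => b0; apply: (ncp tau prime_tau at0_tau); rewrite ?a0 ?b0; apply: rdiv0.
    have [u [s [uu hs e]]] := ufdW b0.
    suff hb : at0 b != 0 by exists 0%N, b; split=> //; exists 0, 1, 0; ring.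
    rewrite e rmorphM; apply: mulf_neq0; first exact: at0_unit.
    rewrite rmorph_prod prodf_seq_neq0.
    apply/allP => p ps /=; apply/eqP => p0; apply: (ncp p) => //; first exact: hs.
      by rewrite a0; apply: rdiv0.
    by rewrite e (big_rem p ps); apply/rdiv_mulr/rdiv_mull/rdiv_refl.
  have [u [s [uu hs e]]] := ufdW a0.
  have {ncp} ncp p : p \in s -> ~ (at0 p = 0 /\ rdiv p b).
    move=> ps [p0 pb]; apply: (ncp p) => //; first exact: hs.
    by rewrite e (big_rem p ps); apply/rdiv_mulr/rdiv_mull/rdiv_refl.
  rewrite e; move: hs ncp => {e a0}; elim: s => [|p s IH] hs ncp.
    rewrite big_nil mulr1; exists 0%N, u; split; first exact: at0_unit.
    by exists 1, 0, 0; ring.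
  have [||k [S [hS [u1 [v1 [w1 e1]]]]]] := IH.
  - by move=> q qs; apply: hs; rewrite inE qs orbT.
  - by move=> q qs; apply: ncp; rewrite inE qs orbT.
  have [||j [S' [hS' [u2 [v2 [w2 e2]]]]]] := @tau_pow_prime p b.
  - by apply: hs; rewrite mem_head.
  - by apply: ncp; rewrite mem_head.
  exists (j + k)%N, (S * S'); split; first by rewrite rmorphM mulf_neq0.
  pose A := \prod_(q <- s) q; rewrite big_cons -/A.
  exists (u1 * u2), (u1 * u * A * v2 + v1 * u2 * p + v1 * v2 * b), 0.
  have -> : S * S' * tau ^+ (j + k) = (S * tau ^+ k) * (S' * tau ^+ j).
    by rewrite exprD; ring.
  by rewrite e1 e2 -/A; ring.
suff [m hm] : exists m, sat3 a b 0 'X^m by apply: prim_intro hm hk.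
have [a0|a0] := eqVneq (ev0 a) 0; last exact: (X_pow_of_tau _ _ (sat3_gen1 a b 0) hk).
have [b0|b0] := eqVneq (ev0 b) 0; last exact: (X_pow_of_tau _ _ (sat3_gen2 a b 0) hk).
case: (ncp tau prime_tau at0_tau).
  by have [c ->] := ev0_eq0 a0; exists c; rewrite mulrC.
by have [c ->] := ev0_eq0 b0; exists c; rewrite mulrC.
Qed.

Lemma rdiv_Xn_unit (q r : K) k : r.[0] != 0 -> rdiv 'X^k (r * q) -> rdiv 'X^k q.
Proof.
move=> r0 [c e]; have : 'X^k %| r * q by apply/dvdpP; exists c.
rewrite Gauss_dvdpr; last by rewrite coprimep_expl // coprimep_sym coprimepX.
by move/dvdpP => [d ->]; exists d.
Qed.

Lemma horner_at0 (x : K) s : root x 0 -> (s.[x]).[0] = at0 s.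
Proof.
move=> /eqP x0; rewrite at0E; have := horner_map (horner_eval (0 : C)) s x.
by rewrite /= !horner_evalE x0 => <-.
Qed.

Lemma sat3_line (x : K) b f : root x 0 -> b.[x] != 0 ->
  sat3 ('X - x%:P) b 0 f <-> rdiv 'X^(mup 0 b.[x]) f.[x].
Proof.
move=> x0 bx; have [v v0 ev] := mup0_split bx; set k := mup _ _ in ev *.
split=> [[s [hs [u [v' [w e]]]]]|[c ec]].
  apply: (@rdiv_Xn_unit _ s.[x]); first by rewrite (horner_at0 s x0); exact: hs.
  exists (v'.[x] * v).
  have -> : s.[x] * f.[x] = v'.[x] * b.[x].
    by rewrite -hornerM e !hornerD !hornerM hornerXsubC subrr mulr0 add0r horner0 mulr0 addr0.
  by rewrite ev mulrA mulrAC.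
exists v%:P; split; first by rewrite at0_polyC.
have [g hg] : rdiv ('X - x%:P) (f - f.[x]%:P).
  by apply/factor_theorem; rewrite rootE hornerD hornerN hornerC subrr.
have [g' hg'] : rdiv ('X - x%:P) (b - b.[x]%:P).
  by apply/factor_theorem; rewrite rootE hornerD hornerN hornerC subrr.
exists (v%:P * g - c%:P * g'), c%:P, 0.
have -> : f = g * ('X - x%:P) + f.[x]%:P by rewrite -hg subrK.
have -> : b = g' * ('X - x%:P) + b.[x]%:P by rewrite -hg' subrK.
rewrite ec ev !polyCM; move: ('X - x%:P) ('X^k)%:P v%:P c%:P => m t v1 c1.
by ring.
Qed.

Lemma qdim_line (x : K) b : root x 0 -> b.[x] != 0 ->
  qdim kap (fun _ => True) (sat3 ('X - x%:P) b 0) (mup 0 b.[x]).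
Proof.
move=> x0 bx; apply: (@qdim_valuation (horner_eval x) tau) => [z||a].
- by rewrite /= horner_evalE hornerC.
- by rewrite /= horner_evalE hornerC.
by rewrite /= horner_evalE; apply: sat3_line.
Qed.

(** One arc is split off at a time: adding ['X - x%:P] leaves the order of [b] on that arc, and the
    colon by it is the ideal of the other arcs, because [b] does not vanish identically on the arc
    removed. *)
Lemma qdim_arcs (xs : seq K) b :
  all (fun x => root x 0) xs -> all (fun x => b.[x] != 0) xs ->
  prim (sat3 (\prod_(x <- xs) ('X - x%:P)) b 0) ->
  qdim kap (fun _ => True) (sat3 (\prod_(x <- xs) ('X - x%:P)) b 0)
    (\sum_(x <- xs) mup 0 b.[x])%N.
Proof.
elim: xs => [|x xs IH] /=.
  rewrite !big_nil => _ _ _; exists (fun=> 0); split=> [||a _]; first by [].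
    by move=> c _ [].
  exists (fun=> 0); apply: (sat3_comb (u := a - lcomb kap (fun=> 0) (fun=> 0 : W)) (v := 0) (w := 0)).
  by ring.
rewrite !big_cons => /andP[x0 xs0] /andP[bx bxs].
have hl := qdim_line x0 bx; set P := \prod_(_ <- _) _.
have [m em] : exists m, m = 'X - x%:P by exists ('X - x%:P).
rewrite -!em in hl * => pJ.
have sub1 f : sat3 (m * P) b 0 f -> sat3 m b 0 f.
  by apply: sat3_sub => //; apply: (sat3_comb (u := P) (v := 0) (w := 0)); ring.
have sub2 f : sat3 (m * P) b 0 f -> sat3 P b 0 f.
  by apply: sat3_sub => //; apply: (sat3_comb (u := m) (v := 0) (w := 0)); ring.
apply: qdim_trans hl _ => //.
apply: (@qdim_colon _ _ _ _ _ m) => //.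
  move=> h; split=> [[s [hs [u [v [w e]]]]]|[r hr]].
    apply: (@sat_lift _ s _ _ u) => //.
    by rewrite e; apply: (sat3_comb (u := 0) (v := v) (w := 0)); ring.
  rewrite -(subrK (m * r) h); case: (sat3_ideal m b 0) => _ hD hM.
  by apply: hD; [apply: sub1 | rewrite mulrC; apply: hM].
apply: qdim_ext (IH xs0 bxs (prim_le sub2 pJ)) => // f.
split=> [[s [hs [u [v [w e]]]]]|[s [hs [u [v [w e]]]]]].
  exists s; split=> //; exists u, (m * v), 0; rewrite mulrCA e /P; ring.
have [v' ev] : rdiv m v.
  rewrite em; apply/factor_theorem; rewrite rootE.
  have := congr1 (fun q : W => q.[x]) e; rewrite /= em !hornerD !hornerM hornerXsubC subrr.
  rewrite horner0 !(mul0r, mulr0, add0r, addr0) => /esym/eqP.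
  by rewrite mulf_eq0 (negbTE bx) orbF.
exists s; split=> //; exists u, v', 0.
apply: (@mulfI _ m); first by rewrite em polyXsubC_eq0.
rewrite mulrCA e ev /P; ring.
Qed.

End Local.

(** * Colength under the base change [tau] to [tau ^+ e] *)

Section Ramified.
Variable C : numClosedFieldType.
Notation K := {poly C}.
Notation W := {poly {poly C}}.
Notation tau := (tau C).
Notation ev0 := (ev0 C).
Notation cst := (cst C).
Notation ram := (ram C).
Notation at0 := (at0 C).
Notation kap := (kap C).
Notation top := (fun _ : W => True).
Implicit Types (a b c f p : W) (J : W -> Prop).
Hint Resolve sat3_ideal sat3_saturated sat3_gen1 sat3_gen2 sat3_gen3 sat30 : core.

Section Sec.
Variables (e : nat) (e0 : (0 < e)%N).

(** The coefficients at exponents congruent to [j] modulo [e]. For [j < e] this is the coordinate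
    along [tau ^+ j] when polynomials are viewed as a free module of rank [e] over those in
    [tau ^+ e]. *)
Definition sec1 j (q : K) : K := \poly_(i < size q) q`_(e * i + j).
Definition sec j a : W := \poly_(i < size a) sec1 j a`_i.

Lemma coef_sec1 j q i : (sec1 j q)`_i = q`_(e * i + j).
Proof.
rewrite coef_poly; case: ltnP => // h; rewrite nth_default //.
by apply: leq_trans h _; rewrite -[X in (X <= _)%N]mul1n; apply: leq_trans (leq_addr _ _); rewrite leq_mul2r e0 orbT.
Qed.

Lemma coef_sec j a i : (sec j a)`_i = sec1 j a`_i.
Proof.
rewrite coef_poly; case: ltnP => // h; rewrite nth_default //.
by apply/polyP => k; rewrite coef_sec1 !coef0.
Qed.

Lemma sec1D j q r : sec1 j (q + r) = sec1 j q + sec1 j r.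
Proof. by apply/polyP => i; rewrite coefD !coef_sec1 coefD. Qed.

Lemma secD j a b : sec j (a + b) = sec j a + sec j b.
Proof. by apply/polyP => i; rewrite coefD !coef_sec coefD sec1D. Qed.

Lemma sec1_sum j (I : finType) (f : I -> K) :
  sec1 j (\sum_i f i) = \sum_i sec1 j (f i).
Proof. by apply/polyP => k; rewrite coef_sec1 !coef_sum; apply: eq_bigr => i _; rewrite coef_sec1. Qed.

Lemma sec_sum j (I : finType) (f : I -> W) :
  sec j (\sum_i f i) = \sum_i sec j (f i).
Proof.
apply/polyP => k; rewrite coef_sec !coef_sum sec1_sum.
by apply: eq_bigr => i _; rewrite coef_sec.
Qed.

Lemma sec1_ram j q r : (j < e)%N -> sec1 j ((q \Po 'X^e) * r) = q * sec1 j r.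
Proof.
move=> je; elim/poly_ind: q r => [|q c IH] r; first by rewrite comp_poly0 !mul0r; apply/polyP => i; rewrite coef_sec1 !coef0.
have hX s : sec1 j ('X^e * s) = 'X * sec1 j s.
  apply/polyP => i; rewrite coef_sec1 coefXnM coefXM.
  case: i => [|i]; first by rewrite muln0 add0n je.
  by rewrite coef_sec1 mulnS -addnA ltnNge leq_addr addKn.
have hC s : sec1 j (c%:P * s) = c%:P * sec1 j s.
  by apply/polyP => i; rewrite coefCM !coef_sec1 coefCM.
rewrite comp_polyD comp_polyM comp_polyX comp_polyC !mulrDl sec1D.
by rewrite -[_ * 'X^e * r]mulrA IH hX hC mulrA.
Qed.

Lemma sec_ram j a b : (j < e)%N -> sec j (ram e a * b) = a * sec j b.
Proof.
move=> je; apply/polyP => l; rewrite coef_sec !coefM sec1_sum.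
by apply: eq_bigr => i _; rewrite coef_map /= sec1_ram // coef_sec.
Qed.

Lemma sec_tau i j : (i < e)%N -> (j < e)%N -> sec j (tau ^+ i) = (i == j)%:R.
Proof.
move=> ie je; rewrite -rmorphXn; apply/polyP => l; apply/polyP => k.
have -> : ((i == j)%:R : W) = ((i == j)%:R : C)%:P%:P by rewrite !polyC_natr.
rewrite coef_sec !coefC.
case: eqP => _; last by rewrite coef_sec1 !coef0.
rewrite coef_sec1 coefXn coefC.
case: k => [|k] /=; first by rewrite muln0 add0n eq_sym.
by rewrite gtn_eqF // mulnS -addnA; apply: leq_trans ie (leq_addr _ _).
Qed.

Lemma sec_sumK a : a = \sum_(j < e) ram e (sec j a) * tau ^+ j.
Proof.
apply/polyP => l; rewrite coef_sum; apply/polyP => k; rewrite coef_sum.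
pose j0 := Ordinal (ltn_pmod k e0).
have E (j : 'I_e) : (ram e (sec j a) * tau ^+ j)`_l`_k =
    if (j <= k)%N && (e %| k - j)%N then a`_l`_k else 0.
  rewrite -rmorphXn coefMC coef_map /= coef_sec coefMXn ltnNge.
  case: leqP => //= h; rewrite coef_comp_poly_Xn //; case: ifP => // h'.
  by rewrite coef_sec1 mulnC divnK // subnK.
rewrite (eq_bigr _ (fun j _ => E j)) (bigD1 j0) //= leq_mod.
have -> : (e %| k - k %% e)%N by rewrite {1}(divn_eq k e) addnK dvdn_mull.
rewrite big1 ?addr0 // => j /eqP nj; case: ifP => // /andP[jk dk]; case: nj.
apply: val_inj => /=; move: dk; rewrite -eqn_mod_dvd // => /eqP ->.
by rewrite modn_small.
Qed.
End Sec.

Lemma at0_ram e a : (0 < e)%N -> at0 (ram e a) = at0 a.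
Proof.
move=> e0; rewrite !at0E; congr (_.[0]); apply/polyP => i.
by rewrite !coef_ev0 coef_map /= horner_comp hornerXn expr0n gtn_eqF.
Qed.

Lemma sat3_ram e a b f : (0 < e)%N ->
  sat3 a b 0 f -> sat3 (ram e a) (ram e b) 0 (ram e f).
Proof.
move=> e0 [s [hs [u [v [w h]]]]]; exists (ram e s); split; first by rewrite at0_ram.
exists (ram e u), (ram e v), 0; rewrite -rmorphM h mulr0 addr0 rmorphD !rmorphM.
by rewrite mul0r addr0.
Qed.

Lemma ramXn e n : ram e 'X^n = 'X^n.
Proof. exact: map_polyXn. Qed.

Lemma ram_tauXn e n : ram e (tau ^+ n) = tau ^+ (e * n).
Proof. by rewrite rmorphXn exprM; congr (_ ^+ _); apply: ram_tau. Qed.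

Lemma prim_ram e a b : (0 < e)%N ->
  prim (sat3 a b 0) -> prim (sat3 (ram e a) (ram e b) 0).
Proof.
move=> e0 [M [hX ht]]; apply: (@prim_intro _ _ M (e * M)) => //.
  by have := sat3_ram e0 hX; rewrite ramXn.
by have := sat3_ram e0 ht; rewrite ram_tauXn.
Qed.

(** The operators [sec] are linear only over the image of [ram], so a denominator from the
    localization cannot pass through them. With powers of both variables as further generators the
    ideal is saturated as it stands: denominators disappear and all generators come from [ram]. *)
Lemma sat3_ram_powers e a b M f : (0 < e)%N ->
  sat3 a b 0 'X^M -> sat3 a b 0 (tau ^+ M) -> sat3 (ram e a) (ram e b) 0 f ->
  exists u v w z, f = u * ram e a + v * ram e b + w * ram e (tau ^+ M) + z * ram e 'X^M.
Proof.
move=> e0 hX ht.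
pose J f := exists u v w z,
  f = u * ram e a + v * ram e b + w * ram e (tau ^+ M) + z * ram e 'X^M.
have idJ : ideal J.
  split; first by exists 0, 0, 0, 0; ring.
    move=> g h [u [v [w [z ->]]]] [u' [v' [w' [z' ->]]]].
    by exists (u + u'), (v + v'), (w + w'), (z + z'); ring.
  move=> g h [u [v [w [z ->]]]].
  by exists (g * u), (g * v), (g * w), (g * z); ring.
apply: (sat3_le idJ).
- apply: prim_saturated => //; apply: (@prim_intro _ _ M (e * M)) => //.
    by exists 0, 0, 0, 1; rewrite ramXn; ring.
  by exists 0, 0, 1, 0; rewrite ram_tauXn; ring.
- by exists 1, 0, 0, 0; ring.
- by exists 0, 1, 0, 0; ring.
- by exists 0, 0, 0, 0; ring.
Qed.

Lemma ram_kap e (z : C) : ram e (kap z) = kap z.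
Proof. by rewrite ramC comp_polyC. Qed.

(** W is free over the image of [ram e] with basis the powers of [tau] below [e]; their products
    with the image of a basis form a basis of the new quotient. *)
Lemma qdim_ram e a b n : (0 < e)%N -> prim (sat3 a b 0) ->
  qdim kap top (sat3 a b 0) n ->
  qdim kap top (sat3 (ram e a) (ram e b) 0) (e * n).
Proof.
move=> e0 [M [hX ht]] [bas [_ fb sb]].
have -> : (e * n = #|{: 'I_e * 'I_n}|)%N by rewrite card_prod !card_ord.
pose B (ji : 'I_e * 'I_n) := ram e (bas ji.2) * tau ^+ ji.1.
have sumB (c : 'I_e * 'I_n -> C) : \sum_ji kap (c ji) * B ji =
    \sum_(j < e) ram e (lcomb kap (fun i => c (j, i)) bas) * tau ^+ j.
  rewrite (eq_bigr (fun ji => kap (c (ji.1, ji.2)) * (ram e (bas ji.2) * tau ^+ ji.1))); last by case.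
  rewrite -(pair_bigA _ (fun j i => kap (c (j, i)) * (ram e (bas i) * tau ^+ j))) /=.
  apply: eq_bigr => j _; rewrite rmorph_sum mulr_suml; apply: eq_bigr => i _.
  by rewrite rmorphM -[ram e (kap _)]/(ram e (kap _)) ram_kap mulrA.
apply: (@qdim_fintype _ _ _ _ _ _ B) => // [c|a' _].
  rewrite sumB => /(sat3_ram_powers e0 hX ht) [u [v [w [z eq]]]] [j i].
  have : sat3 a b 0 (lcomb kap (fun i => c (j, i)) bas).
    have := congr1 (sec e j) eq; rewrite sec_sum //.
    rewrite (bigD1 j) //= sec_ram // sec_tau // eqxx mulr1 big1 ?addr0 => [->|k nkj]; last first.
      by rewrite sec_ram // sec_tau // -[_ == _]/(k == j) (negbTE nkj) mulr0.
    rewrite !secD // ![_ * ram e _]mulrC !sec_ram //.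
    case: (sat3_ideal a b 0) => _ hD hM.
    by do 3?[apply: (hD)]; rewrite mulrC; apply: (hM).
  by move/fb; apply.
have hc j := sb (sec e j a') I.
pose c j := sval (constructive_indefinite_description _ (hc j)).
exists (fun ji : 'I_e * 'I_n => c ji.1 ji.2); rewrite sumB {1}(sec_sumK e0 a') -sumrB.
apply: ideal_sum => // j; rewrite -mulrBl -rmorphB; apply: ideal_mulr => //.
apply: sat3_ram => //.
exact: (svalP (constructive_indefinite_description _ (hc j))).
Qed.

End Ramified.

(** * Orders along the branches of a polar curve *)

Section LocalInvariants.
Variable C : numClosedFieldType.
Notation K := {poly C}.
Notation W := {poly {poly C}}.
Notation tau := (tau C).
Notation ev0 := (ev0 C).
Notation cst := (cst C).
Notation ram := (ram C).
Notation at0 := (at0 C).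
Notation kap := (kap C).
Notation top := (fun _ : W => True).
Implicit Types (a b c f g p : W) (q r : K) (J : W -> Prop).
Hint Resolve sat3_ideal sat3_saturated sat3_gen1 sat3_gen2 sat3_gen3 sat30 : core.

Lemma mup0_eq k v : v.[0] != 0 -> mup 0 ('X^k * v : K) = k.
Proof.
move=> v0; rewrite mupMl ?rootE // -['X]subr0 -polyC0 mup_XsubCX eqxx //.
Qed.

Lemma mup0M q r : q != 0 -> r != 0 -> mup 0 (q * r) = (mup 0 q + mup 0 r)%N.
Proof. exact: mupM. Qed.

Lemma mup0_Xn k : mup 0 ('X^k : K) = k.
Proof. by rewrite -['X]subr0 -polyC0 mup_XsubCX eqxx. Qed.

Lemma mup0_deriv q : q != 0 -> q.[0] = 0 ->
  q^`() != 0 /\ mup 0 q = (mup 0 q^`()).+1.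
Proof.
move=> /mup0_split [v v0 ->]; case: (mup 0 q) => [|k].
  by rewrite expr0 mul1r => /eqP; rewrite (negbTE v0).
move=> _; pose w := v *+ k.+1 + 'X * v^`().
have w0 : w.[0] != 0.
  by rewrite hornerD hornerMn hornerM hornerX mul0r addr0 mulrn_eq0.
have -> : ('X^(k.+1) * v)^`() = 'X^k * w.
  by rewrite derivM derivXn /= /w exprS mulrnAl; ring.
rewrite !mup0_eq //; split=> //; rewrite mulf_neq0 ?expf_neq0 ?polyX_eq0 //.
by apply: contraNneq w0 => ->; rewrite horner0.
Qed.

Lemma mup0_perturb q r (c : K) M : q = r + 'X^M * c -> r != 0 -> (mup 0 r < M)%N ->
  q != 0 /\ mup 0 q = mup 0 r.
Proof.
move=> -> /mup0_split [v v0 ev] lt; set k := mup 0 r in ev lt *.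
have e : r + 'X^M * c = 'X^k * (v + 'X^(M - k) * c).
  by rewrite ev mulrDr mulrA -exprD subnKC // ltnW.
have w0 : (v + 'X^(M - k) * c).[0] != 0.
  by rewrite hornerD hornerM hornerXn expr0n subn_eq0 leqNgt lt mul0r addr0.
rewrite e mup0_eq //; split=> //; rewrite mulf_neq0 ?expf_neq0 ?polyX_eq0 //.
by apply: contraNneq w0 => ->; rewrite horner0.
Qed.

(** The derivative across the line, in the inner variable; [deriv] on W is the one along the
    line. *)
Definition dy a : W := map_poly (@deriv C) a.

Lemma coef_dy a i : (dy a)`_i = (a`_i)^`().
Proof. by rewrite coef_map_id0 // deriv0. Qed.

Lemma dy_tauM a : dy (tau * a) = a + tau * dy a.
Proof.
apply/polyP => i; rewrite coef_dy coefD !coefCM coef_dy derivM derivX mul1r.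
by [].
Qed.

Lemma dyM a b : dy (a * b) = dy a * b + a * dy b.
Proof.
apply/polyP => i; rewrite coef_dy coefD !coefM (raddf_sum (@deriv C)) -big_split /=.
by apply: eq_bigr => j _; rewrite derivM !coef_dy.
Qed.

Lemma deriv_tauM a : (tau * a)^`() = tau * a^`().
Proof. by rewrite derivM derivC mul0r add0r. Qed.

Lemma arc_deriv e (x : K) a :
  ((ram e a).[x])^`() =
  (ram e a^`()).[x] * x^`() + (ram e (dy a)).[x] * ('X^(e.-1) *+ e).
Proof.
elim/poly_ind: a => [|a c IH].
  have -> : dy 0 = 0 by apply/polyP => i; rewrite coef_dy !coef0 deriv0.
  by rewrite deriv0 !rmorph0 !horner0 deriv0 !mul0r addr0.
have -> : dy (a * 'X + c%:P) = dy a * 'X + (c^`())%:P.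
  by apply/polyP => -[|i]; rewrite coef_dy !coefD !coefMX !coefC coef_dy derivD ?derivC //= ?deriv0 ?add0r ?addr0.
rewrite derivMXaddC !rmorphD !rmorphM -![GRing.RMorphism.sort _ _]/(ram e _) !ramX !ramC.
rewrite !hornerD !hornerM !hornerX !hornerC derivD derivM IH.
rewrite deriv_comp derivXn; ring.
Qed.

(** A Nakayama argument justifies the truncation: the error is [tau ^+ (e * N')], which lies in the
    ramified ideal, times an element vanishing at the origin. So the product of the arcs can replace
    [p] next to [b]. The same power of [tau] bounds the order of [b] on every arc. *)
Lemma arcs_colength p b N' N e (xs : seq K) U c n :
  prim (sat3 p b 0) -> sat3 p b 0 (tau ^+ N') -> (N' < N)%N -> (0 < e)%N ->
  all (fun x => root x 0) xs -> at0 U != 0 ->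
  ram e p = U * \prod_(x <- xs) ('X - x%:P) + tau ^+ (e * N) * c ->
  qdim kap top (sat3 p b 0) n ->
  [/\ all (fun x => (ram e b).[x] != 0) xs,
      all (fun x => mup 0 (ram e b).[x] <= e * N')%N xs &
      (e * n = \sum_(x <- xs) mup 0 (ram e b).[x])%N].
Proof.
move=> pJ ht ltN e0 xs0 U0; set P := \prod_(_ <- _) _ => eP qn.
have [rp erp] : exists rp, rp = ram e p by exists (ram e p).
have [rb erb] : exists rb, rb = ram e b by exists (ram e b).
have := sat3_ram e0 ht; rewrite ram_tauXn -erp -erb => ht'.
have [s [hs [u [v [w es]]]]] := ht'.
pose d := tau ^+ (e * (N - N')) * c.
have d0 : at0 d = 0.
  rewrite rmorphM rmorphXn /= -![horner_eval 0 _]/(at0 _) at0_tau expr0n.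
  by rewrite muln_eq0 subn_eq0 leqNgt ltN gtn_eqF //= mul0r.
have eP' : rp = U * P + tau ^+ (e * N') * d.
  by rewrite erp eP /d mulrA -exprD -mulnDr subnKC // ltnW.
have es' : s * rp = s * (U * P) + d * (u * rp + v * rb).
  rewrite eP' mulrDr; congr (_ + _).
  have -> : s * (tau ^+ (e * N') * d) = d * (s * tau ^+ (e * N')) by ring.
  by rewrite es -eP' mulr0 addr0.
have sdu : at0 (s - d * u) != 0.
  by rewrite rmorphB rmorphM -![GRing.RMorphism.sort _ _]/(at0 _) d0 mul0r subr0.
have J12 : sat3 P rb 0 rp.
  exists (s - d * u); split=> //; exists (s * U), (d * v), 0.
  by rewrite mulrBl es'; ring.
have J21 : sat3 rp rb 0 P.
  exists (s * U); split; first by rewrite rmorphM mulf_neq0.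
  exists (s - d * u), (- d * v), 0.
  have -> : s * U * P = s * rp - d * (u * rp + v * rb) by rewrite es'; ring.
  by ring.
have eqJ f : sat3 rp rb 0 f <-> sat3 P rb 0 f by split; apply: sat3_sub.
have nz : all (fun x => rb.[x] != 0) xs /\ all (fun x => mup 0 rb.[x] <= e * N')%N xs.
  have /eqJ [s2 [hs2 [u2 [v2 [w2 e2]]]]] := ht'.
  have H x : x \in xs -> rb.[x] != 0 /\ (mup 0 rb.[x] <= e * N')%N.
    move=> xin; have rx : root x 0 by move/allP: xs0; apply.
    have s20 : (s2.[x]).[0] != 0 by rewrite (horner_at0 s2 rx); exact: hs2.
    have Px : P.[x] = 0.
      by rewrite /P (big_rem x xin) /= hornerM hornerXsubC subrr mul0r.
    have := congr1 (fun q : W => q.[x]) e2; rewrite /= hornerM -rmorphXn hornerC.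
    rewrite !hornerD !hornerM Px mulr0 add0r horner0 mulr0 addr0 mulrC => eqx.
    have nz0 : 'X^(e * N') * s2.[x] != 0.
      rewrite mulf_neq0 ?expf_neq0 ?polyX_eq0 //.
      by apply: contraNneq s20 => ->; rewrite horner0.
    move: (nz0); rewrite eqx mulf_eq0 negb_or => /andP[v2x rbx]; split=> //.
    have := mup0_eq (e * N') s20; rewrite eqx mup0M // => <-.
    exact: leq_addl.
  by split; apply/allP => x /H[].
case: nz => nz1 nz2; split; rewrite -?erb //.
have q1 := qdim_ram e0 pJ qn; rewrite -erp -erb in q1.
have pJ' := prim_ram e0 pJ; rewrite -erp -erb in pJ'.
have q2 := qdim_arcs xs0 nz1 (prim_le (fun f => proj1 (eqJ f)) pJ').
have {}q2 := qdim_ext (fun=> iff_refl True) (fun f => iff_sym (eqJ f)) q2.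
exact: (qdim_uniq (sat3_ideal rp rb 0) q1 q2).
Qed.

Lemma prim_tau_le a b c N M : (N <= M)%N ->
  sat3 a b c (tau ^+ N) -> sat3 a b c (tau ^+ M).
Proof.
move=> h ht; rewrite -(subnK h) exprD.
by case: (sat3_ideal a b c) => _ _ hM; apply: hM.
Qed.

Lemma ev0_deriv a : ev0 a^`() = (ev0 a)^`().
Proof. by rewrite /ev0 /= deriv_map. Qed.

(** On an arc of g_X = 0 the chain rule leaves, up to the truncation, only the derivative in [tau].
    So g has order e more than g_tau, and tau g has order e more than (tau g)_tau; hence (tau g)_tau
    exceeds g_tau by exactly [e] on each of the i - 1 arcs, where i is the order of g on the
    line. *)
Lemma milnor_polar g n n' : at0 g = 0 -> ev0 g != 0 ->
  prim (sat3 g^`() (dy g) 0) -> prim (sat3 g^`() (dy (tau * g)) 0) ->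
  qdim kap top (sat3 g^`() (dy g) 0) n ->
  qdim kap top (sat3 g^`() (dy (tau * g)) 0) n' ->
  n' = (n + (mup 0 (ev0 g)).-1)%N.
Proof.
move=> g0 eg0 p1 p2 q1 q2.
have [N1 [_ t1]] := p1; have [N2 [_ t2]] := p2.
pose N' := maxn N1 N2.
have {}t1 := prim_tau_le (leq_maxl N1 N2) t1; have {}t2 := prim_tau_le (leq_maxr N1 N2) t2.
have ep := ev0_deriv g.
have [dg0 mg] : (ev0 g)^`() != 0 /\ mup 0 (ev0 g) = (mup 0 (ev0 g)^`()).+1.
  by apply: mup0_deriv => //; rewrite -at0E.
(* Two extra units of precision: along an arc the derivative of [tau * g] can have order up to
   [e * N' + 2 * e - 1], which must stay below the truncation. *)
have [|e [xs [U [c [e0 sx rx U0 eP]]]]] := @arcs C g^`() N'.+2; first by rewrite ep.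
rewrite ep in sx; rewrite -at0E in U0.
have lt1 : (N' < N'.+2)%N by [].
have [z1 b1 s1] := arcs_colength p1 t1 lt1 e0 rx U0 eP q1.
have [z2 b2 s2] := arcs_colength p2 t2 lt1 e0 rx U0 eP q2.
have key x : x \in xs ->
    mup 0 (ram e (dy (tau * g))).[x] = (mup 0 (ram e (dy g)).[x] + e)%N.
  move=> xin.
  have x0 : root x 0 by move/allP: rx; apply.
  have {z1}z1 : (ram e (dy g)).[x] != 0 by move/allP: z1 => /(_ _ xin).
  have {b1}b1 : (mup 0 (ram e (dy g)).[x] <= e * N')%N by move/allP: b1 => /(_ _ xin).
  have {z2}z2 : (ram e (dy (tau * g))).[x] != 0 by move/allP: z2 => /(_ _ xin).
  have Px : (\prod_(x <- xs) ('X - x%:P)).[x] = 0.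
    by rewrite (big_rem x xin) /= hornerM hornerXsubC subrr mul0r.
  have gp : (ram e g^`()).[x] = 'X^(e * N'.+2) * c.[x].
    by rewrite eP hornerD hornerM Px mulr0 add0r hornerM -rmorphXn hornerC.
  have mE : (e%:R : K) != 0 by rewrite -polyC_natr polyC_eq0 pnatr_eq0 -lt0n.
  have mXe (q : K) : q != 0 -> q * ('X^(e.-1) *+ e) != 0 /\
      mup 0 (q * ('X^(e.-1) *+ e)) = (mup 0 q + e.-1)%N.
    move=> q0; have x1 : ('X^(e.-1) *+ e : K) = 'X^(e.-1) * e%:R by rewrite mulr_natr.
    have y0 : ('X^(e.-1) *+ e : K) != 0 by rewrite x1 mulf_neq0 ?expf_neq0 ?polyX_eq0.
    rewrite mulf_neq0 // mup0M // x1 mup0_eq // -polyC_natr hornerC pnatr_eq0 -lt0n //.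
  have [r0 mr] := mXe _ z1.
  have ltN : (mup 0 (ram e (dy g)).[x] + e.-1 < e * N'.+2)%N.
    by rewrite !mulnS; move: b1 e0; move: (mup 0 _) => k; clear; lia.
  have E1 : ((ram e g).[x])^`() =
      (ram e (dy g)).[x] * ('X^(e.-1) *+ e) + 'X^(e * N'.+2) * (c.[x] * x^`()).
    by rewrite arc_deriv gp addrC mulrA.
  have [d0 md] := mup0_perturb E1 r0 (eq_ind_r (fun k => k < _)%N ltN mr).
  have g00 : ((ram e g).[x]).[0] = 0 by rewrite (horner_at0 _ x0) at0_ram.
  have gn0 : (ram e g).[x] != 0 by apply: contraNneq d0 => ->; rewrite deriv0.
  have [_ mg1] := mup0_deriv gn0 g00.
  have tz : (ram e (tau * g)).[x] = 'X^e * (ram e g).[x].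
    by rewrite rmorphM hornerM -[X in X.[x] * _]/(ram e tau) ram_tau -rmorphXn hornerC.
  have tzn0 : (ram e (tau * g)).[x] != 0 by rewrite tz mulf_neq0 ?expf_neq0 ?polyX_eq0.
  have tz0 : ((ram e (tau * g)).[x]).[0] = 0 by rewrite tz hornerM g00 mulr0.
  have [dz0 mz] := mup0_deriv tzn0 tz0.
  have mz' : mup 0 (ram e (tau * g)).[x] = (mup 0 (ram e (dy g)).[x] + e + e)%N.
    rewrite tz mup0M ?expf_neq0 ?polyX_eq0 // mup0_Xn mg1 md mr.
    by rewrite -addnS prednK // addnC.
  have E2 : (ram e (dy (tau * g))).[x] * ('X^(e.-1) *+ e) =
      ((ram e (tau * g)).[x])^`() + 'X^(e * N'.+2) * (- ('X^e * c.[x] * x^`())).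
    rewrite arc_deriv deriv_tauM rmorphM hornerM -![GRing.RMorphism.sort _ _]/(ram e _) gp.
    by rewrite ram_tau -rmorphXn hornerC; ring.
  have lt2 : (mup 0 ((ram e (tau * g)%R).[x])^`() < e * N'.+2)%N.
    by rewrite -ltnS -mz mz' !mulnS; move: b1 e0; move: (mup 0 _) => k; clear; lia.
  have [_ m2] := mup0_perturb E2 dz0 lt2.
  have [_ m3] := mXe _ z2.
  move: m2 mz mz'; rewrite m3 => <- ->; move: (mup 0 (ram e (dy g)).[x]) e0 => k1 e0.
  by move: (mup 0 _) e0 => k2; clear; lia.
apply/eqP; rewrite -(eqn_pmul2l e0); apply/eqP.
rewrite s2 (eq_big_seq _ key) big_split /= -s1 mulnDr mg /= -sx; congr (_ + _)%N.
by rewrite big_const_seq count_predT iter_addn_0.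
Qed.

(** If a prime [p] through the origin divides both partial derivatives, then [z] is constant along
    the branches of p = 0 there, hence zero on them. So [p] divides [z], and differentiating z = p w
    shows that it divides [z] twice. *)
Lemma no_square_prim z : z != 0 -> at0 z = 0 ->
  (forall p, prime_elt p -> at0 p = 0 -> ~ rdiv (p * p) z) ->
  prim (sat3 z^`() (dy z) 0).
Proof.
move=> z0 az nsq; apply: prim_no_common_prime => p pp p0 px py.
(* The branch [tau = 0] is not an arc parametrized by [tau], so it needs its own argument. *)
have [ep|ep] := eqVneq (ev0 p) 0.
  have [c ec] := ev0_eq0 ep.
  have tp : rdiv tau p by exists c; rewrite ec mulrC.
  have [w ew] : exists w, z = tau * w.
    apply: ev0_eq0; have : (ev0 z)^`() = 0.
      have [d ed] := rdiv_trans tp px; rewrite -ev0_deriv ed rmorphM.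
      by rewrite -[X in _ * X]/(ev0 tau) ev0_tau mulr0.
    move=> dz; have [//|nz] := eqVneq (ev0 z) 0.
    have [|] := mup0_deriv nz; first by rewrite -at0E.
    by rewrite dz eqxx.
  have [d ed] : rdiv tau w.
    have [d ed] := rdiv_trans tp py; exists (d - dy w); rewrite mulrBl -ed ew dy_tauM.
    by rewrite mulrC; ring.
  apply: (nsq tau (prime_tau C) (at0_tau C)).
  by exists d; rewrite ew ed; ring.
have sp : (1 < size p)%N.
  rewrite ltnNge; apply/negP => /size1_polyC e1; move: ep p0; rewrite e1 at0_polyC.
  rewrite /ev0 /= map_polyC /= horner_evalE => /eqP h h'; apply: h.
  by rewrite h' polyC0.
have dp : p^`() != 0.
  apply/eqP => /(congr1 (fun q : W => q`_(size p).-2)); rewrite coef_deriv coef0.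
  have -> : (size p).-2.+1 = (size p).-1 by move: sp; case: (size p) => [|[]].
  rewrite -lead_coefE -mulr_natr => /eqP; rewrite mulf_eq0 lead_coef_eq0.
  case: pp => /negbTE -> _ _; rewrite -polyC_natr polyC_eq0 pnatr_eq0.
  by move: sp; case: (size p) => [|[]].
have [[w ew]|npz] := classic (rdiv p z).
  have : rdiv p (p^`() * w).
    have -> : p^`() * w = z^`() - p * w^`() by rewrite ew derivM; ring.
    by apply: rdivB => //; rewrite mulrC; apply/rdiv_mulr/rdiv_refl.
  case: (pp) => p_neq0 _ h /h [[d ed]|[d ed]].
    have d0 : d != 0 by apply/eqP => d0; move: dp; rewrite ed d0 mul0r eqxx.
    have := lt_size_deriv p_neq0; rewrite ed size_mul //.
    by move: d0; rewrite -size_poly_gt0; case: (size d) => // k _; rewrite addSn ltnNge leq_addl.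
  by apply: (nsq p pp p0); exists d; rewrite ew ed; ring.
(* The contradiction is one of orders: on an arc [p] and [z] are both divisible by
   ['X^(e * (mup 0 r).+1)], whereas their combination [r \Po 'X^e] has order [e * mup 0 r]. *)
have /Bezout_coprimepP[[u v] /= /eqp_size] := prime_coprimep pp sp npz.
rewrite size_poly1 => /eqP/size_poly1P[r r0 er].
have [e [xs [U [c [e0 sx rx U0 eP]]]]] := arcs (mup 0 r).+1 ep.
have [_ mp] := mup0_deriv ep (etrans (esym (at0E p)) p0).
case: xs sx rx eP => [|x xs] sx rx eP; first by rewrite mp in sx.
have x0 : root x 0 by move/allP: rx; apply; apply: mem_head.
rewrite big_cons in eP.
have gp : (ram e p).[x] = 'X^(e * (mup 0 r).+1) * c.[x].
  by rewrite eP hornerD !hornerM hornerXsubC subrr mul0r mulr0 add0r -rmorphXn hornerC.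
have [dx edx] := px; have [d ed] := py.
set M := (e * _)%N in gp.
have [c1 E1] : exists c1 : K, ((ram e z).[x])^`() = 'X^M * c1.
  exists ((ram e dx).[x] * c.[x] * x^`() + (ram e d).[x] * c.[x] * ('X^(e.-1) *+ e)).
  rewrite arc_deriv edx ed !rmorphM !hornerM -![GRing.RMorphism.sort _ _]/(ram e _) gp.
  by move: (ram e dx).[x] (ram e d).[x] c.[x] x^`() ('X^M) ('X^(e.-1) *+ e) => a1 a2 a3 a4 a5 a6; clear; ring.
have zz : ((ram e z).[x]).[0] = 0 by rewrite (horner_at0 _ x0) at0_ram.
have [c2 E2] : exists c2 : K, (ram e z).[x] = 'X^M * c2.
  have [->|nz] := eqVneq (ram e z).[x] 0; first by exists 0; rewrite mulr0.
  have [dn0 mz] := mup0_deriv nz zz.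
  have [w w0 ew] := mup0_split nz.
  have leM : (M <= mup 0 (ram e z).[x])%N.
    rewrite mz E1; have c10 : c1 != 0 by apply: contraNneq dn0 => c10; rewrite E1 c10 mulr0.
    by rewrite mup0M ?expf_neq0 ?polyX_eq0 // mup0_Xn; apply/leqW/leq_addr.
  by exists ('X^(mup 0 (ram e z).[x] - M) * w); rewrite mulrA -exprD subnKC.
have : r \Po 'X^e = 'X^M * ((ram e u).[x] * c.[x] + (ram e v).[x] * c2).
  have := congr1 (fun f => (ram e f).[x]) er.
  rewrite /= rmorphD !rmorphM -![GRing.RMorphism.sort _ _]/(ram e _) ramC hornerC => <-.
  rewrite hornerD !hornerM gp E2.
  by move: (ram e u).[x] (ram e v).[x] c.[x] ('X^M) => a1 a2 a3 a4; clear; ring.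
have [w w0 ew] := mup0_split r0.
rewrite {1}ew comp_polyM comp_Xn_poly -exprM /M mulnS exprD => E3.
have : w \Po 'X^e = 'X^e * ((ram e u).[x] * c.[x] + (ram e v).[x] * c2).
  apply: (@mulfI _ ('X^(e * mup 0 r))); first by rewrite expf_neq0 ?polyX_eq0.
  by rewrite E3 mulrA [_ * 'X^e]mulrC.
move/(congr1 (fun q : K => q.[0])); rewrite horner_comp hornerM !hornerXn expr0n gtn_eqF //=.
by rewrite mul0r => /eqP; rewrite (negbTE w0).
Qed.

End LocalInvariants.

(** * Milnor and Tjurina numbers after adding the line *)

Section LineAddition.
Variable C : numClosedFieldType.
Notation K := {poly C}.
Notation W := {poly {poly C}}.
Notation tau := (tau C).
Notation ev0 := (ev0 C).
Notation cst := (cst C).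
Notation at0 := (at0 C).
Notation kap := (kap C).
Notation top := (fun _ : W => True).
Implicit Types (a b c f g p : W) (q r : K) (J : W -> Prop).
Hint Resolve sat3_ideal sat3_saturated sat3_gen1 sat3_gen2 sat3_gen3 sat30 : core.

Lemma prim_qdim J : ideal J -> prim J -> exists n, qdim kap top J n.
Proof.
move=> idJ [M [hX ht]]; have [_ hD hM] := idJ.
pose bas (ij : 'I_M * 'I_M) : W := 'X^(ij.1) * tau ^+ ij.2.
apply: (qdim_of_span_fin (b := bas) idJ) => //; rewrite {}/bas.
move=> f _; exists (fun ij : 'I_M * 'I_M => f`_(ij.1)`_(ij.2)).
have -> : \sum_(ij : 'I_M * 'I_M) kap f`_(ij.1)`_(ij.2) * ('X^(ij.1) * tau ^+ ij.2) =
    \sum_(i < M) (take_poly M f`_i)%:P * 'X^i.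
  rewrite -(pair_bigA _ (fun i j : 'I_M => kap f`_i`_j * ('X^i * tau ^+ j))) /=.
  apply: eq_bigr => i _; rewrite /take_poly poly_def rmorph_sum mulr_suml.
  apply: eq_bigr => j _; rewrite -mul_polyC rmorphM rmorphXn /= -/tau.
  by rewrite mulrA mulrAC.
have {1}-> : f = \sum_(i < M) (f`_i)%:P * 'X^i + drop_poly M f * 'X^M.
  rewrite -[LHS](poly_take_drop M); congr (_ + _); rewrite /take_poly poly_def.
  by apply: eq_bigr => i _; rewrite mul_polyC.
rewrite addrAC -sumrB; apply: (hD); last exact: hM.
apply: ideal_sum => // i; rewrite -mulrBl; apply: ideal_mulr => //.
rewrite -polyCB; have -> : f`_i - take_poly M f`_i = drop_poly M f`_i * 'X^M.
  by rewrite -{1}[f`_i](poly_take_drop M) addrAC subrr add0r.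
by rewrite polyCM rmorphXn; apply: (hM).
Qed.

Lemma qdim_ev0 J k : (forall a, J a <-> rdiv 'X^k (ev0 a)) -> qdim kap top J k.
Proof.
apply: (@qdim_valuation _ ev0 'X) => [z|]; last exact: ev0X.
by rewrite /ev0 /= map_polyC /= horner_evalE hornerC.
Qed.

Lemma sat3_tau a f : ev0 a != 0 ->
  sat3 tau a 0 f <-> rdiv 'X^(mup 0 (ev0 a)) (ev0 f).
Proof.
move=> /mup0_split [v v0 ev]; set k := mup _ _ in ev *.
split=> [[s [hs [u [v' [w e]]]]]|[c ec]].
  apply: (@rdiv_Xn_unit _ _ (ev0 s)); first by rewrite -at0E.
  rewrite -rmorphM e !rmorphD !rmorphM -[X in _ * X + _ + _]/(ev0 tau) ev0_tau.
  rewrite -[X in _ + _ * X + _]/(ev0 a) rmorph0 !mulr0 add0r addr0 ev.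
  by apply/rdiv_mulr/rdiv_mull/rdiv_refl.
have [d hd] : exists d, f - cst (ev0 f) = tau * d.
  by apply: ev0_eq0; rewrite rmorphB /= ev0_cst subrr.
have [d' hd'] : exists d', a - cst (ev0 a) = tau * d'.
  by apply: ev0_eq0; rewrite rmorphB /= ev0_cst subrr.
exists (cst v); split; first by rewrite at0_cst.
exists (cst v * d - cst c * d'), (cst c), 0.
have -> : f = tau * d + cst (ev0 f) by rewrite -hd subrK.
have -> : a = tau * d' + cst (ev0 a) by rewrite -hd' subrK.
rewrite ec ev [cst (c * _)]rmorphM [cst (_ * v)]rmorphM -![GRing.RMorphism.sort _ _]/(cst _).
by move: (cst v) (cst c) (cst 'X^k) tau => x y z t; clear; ring.
Qed.

Lemma qdim_tau a : ev0 a != 0 -> qdim kap top (sat3 tau a 0) (mup 0 (ev0 a)).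
Proof. by move=> a0; apply: qdim_ev0 => f; apply: sat3_tau. Qed.

Lemma ev0_mul_tau a : ev0 (a * tau) = 0.
Proof. by rewrite rmorphM -[X in _ * X]/(ev0 tau) ev0_tau mulr0. Qed.

Lemma tau_dvd_mul a s : ev0 a != 0 -> rdiv tau (s * a) -> rdiv tau s.
Proof.
move=> a0 [c e]; have := congr1 ev0 e; rewrite !rmorphM -[X in _ = _ * X]/(ev0 tau) ev0_tau mulr0.
by move/eqP; rewrite mulf_eq0 (negbTE a0) orbF => /eqP /ev0_eq0 [d ->]; exists d; rewrite mulrC.
Qed.

(* For [J = I'] with [I' + (m)] and [I' : m] both known, dim O/I' is the sum of
   the dimensions of the two quotients. *)
Lemma qdim_add_colon J m (H : W -> Prop) n k : ideal J -> prim J -> ideal H ->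
  (forall f, J f -> H f) -> H m ->
  (forall h : W, H h -> exists s r : W, at0 s != 0 /\ J (s * h - m * r)) ->
  qdim kap top H n -> qdim kap top (fun a => J (m * a)) k ->
  qdim kap top J (n + k).
Proof.
move=> idJ pJ idH JH Hm hH qH qm; apply: qdim_trans qH _ => //.
apply: (@qdim_colon _ _ _ _ _ m) => // h; split=> [/hH[s [r [hs hr]]]|[r hr]].
  exact: sat_lift hr.
by rewrite -(subrK (m * r) h); case: (idH) => _ hD hM; apply: hD; [apply: JH | rewrite mulrC; apply: hM].
Qed.

(** Adding [tau] to the Jacobian ideal (tau g_X, g + tau g_tau) gives (tau, g), and its colon by
    [tau] is (g_X, (tau g)_tau) because [tau] does not divide [g]. *)
Lemma milnor_line g k : ev0 g != 0 ->
  prim (sat3 (tau * g)^`() (dy (tau * g)) 0) ->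
  qdim kap top (sat3 g^`() (dy (tau * g)) 0) k ->
  qdim kap top (sat3 (tau * g)^`() (dy (tau * g)) 0) (mup 0 (ev0 g) + k).
Proof.
move=> g0; rewrite deriv_tauM; have [z ez] : exists z, z = dy (tau * g) by exists (dy (tau * g)).
have ezz : z = g + tau * dy g by rewrite ez dy_tauM.
rewrite -ez => pJ qk; apply: (qdim_add_colon (m := tau) _ pJ _ _ _ _ (qdim_tau g0)) => //.
- move=> f; apply: sat3_sub => //; first by apply: (sat3_comb (u := g^`()) (v := 0) (w := 0)); ring.
  by apply: (sat3_comb (u := dy g) (v := 1) (w := 0)); rewrite ezz; ring.
- move=> h [s [hs [u [v [w e]]]]]; exists s, (u - v * dy g); split=> //.
  by apply: (sat3_comb (u := 0) (v := v) (w := 0)); rewrite e ezz; ring.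
apply: qdim_ext qk => // f; split=> [[s [hs [u [v [w e]]]]]|[s [hs [u [v [w e]]]]]].
  by exists s; split=> //; exists u, (tau * v), 0; rewrite mulrCA e; ring.
have [v' ev] : rdiv tau v.
  apply: (@tau_dvd_mul g) => //; exists (s * f - u * g^`() - v * dy g).
  have -> : v * g = s * (tau * f) - u * (tau * g^`()) - v * (tau * dy g).
    by rewrite e ezz; ring.
  by ring.
exists s; split=> //; exists u, v', 0; apply: (mulfI (tau0 C)).
by rewrite mulrCA e ev; ring.
Qed.

(** The colon of the new Tjurina ideal by [tau] is (g, g_X, tau g_tau), and adding g_tau to that
    gives the old one. If a g_tau lies in (g, g_X, tau g_tau), then up to a unit [a] agrees modulo
    [tau] with the transverse coefficient of a logarithmic derivation; so the second colon consists
    of the [a] of order at least [e] on the line. *)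
Lemma tjurina_line g t e : ev0 g != 0 ->
  prim (sat3 (tau * g) (tau * g)^`() (dy (tau * g))) ->
  prim (sat3 g g^`() (dy g)) ->
  (forall u v c, u * g^`() + v * dy g = c * g -> rdiv 'X^e (ev0 v)) ->
  (exists u v c, u * g^`() + v * dy g = c * g /\
     exists w : K, ev0 v = 'X^e * w /\ w.[0] != 0) ->
  qdim kap top (sat3 g g^`() (dy g)) t ->
  qdim kap top (sat3 (tau * g) (tau * g)^`() (dy (tau * g))) (mup 0 (ev0 g) + (t + e)).
Proof.
move=> g0; rewrite deriv_tauM; have [z ez] : exists z, z = dy (tau * g) by exists (dy (tau * g)).
have ezz : z = g + tau * dy g by rewrite ez dy_tauM.
rewrite -ez => pJ pI H1 H2 qt.
pose J1 := sat3 g g^`() (tau * dy g).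
have colon f : sat3 (tau * g) (tau * g^`()) z (tau * f) <-> J1 f.
  split=> [[s [hs [u [v [w e']]]]]|[s [hs [u [v [w e']]]]]].
    have [w' ew] : rdiv tau w.
      apply: (@tau_dvd_mul g) => //; exists (s * f - u * g - v * g^`() - w * dy g).
      have -> : w * g = s * (tau * f) - u * (tau * g) - v * (tau * g^`()) - w * (tau * dy g).
        by rewrite e' ezz; ring.
      by ring.
    exists s; split=> //; exists (u + w'), v, w'; apply: (mulfI (tau0 C)).
    by rewrite mulrCA e' ew ezz; ring.
  exists s; split=> //; exists (u - w), v, (tau * w).
  by rewrite mulrCA e' ezz; ring.
have pJ1 : prim J1.
  case: pJ => M [hX ht]; exists M; split; apply/colon.
    by case: (sat3_ideal (tau * g) (tau * g^`()) z) => _ _; apply.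
  by case: (sat3_ideal (tau * g) (tau * g^`()) z) => _ _; apply.
have qK : qdim kap top (fun a => J1 (dy g * a)) e.
  apply: qdim_ev0 => a; split=> [[s [hs [u [v [w e']]]]]|[d ed]].
    apply: (@rdiv_Xn_unit _ _ (ev0 s)); first by rewrite -at0E.
    have e1 : ev0 (s * a - w * tau) = ev0 s * ev0 a.
      by rewrite rmorphB !rmorphM -[X in _ - _ * X]/(ev0 tau) ev0_tau mulr0 subr0.
    have := H1 (- v) (s * a - w * tau) u; rewrite e1; apply.
    have -> : (s * a - w * tau) * dy g = s * (dy g * a) - w * (tau * dy g) by ring.
    by rewrite e'; ring.
  have [u [v [c [e1 [w [ew w0]]]]]] := H2.
  have [b eb] : exists b, cst w * a - cst d * v = tau * b.
    apply: ev0_eq0; rewrite rmorphB !rmorphM -![GRing.RMorphism.sort _ _]/(ev0 _).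
    by rewrite !ev0_cst ed ew; ring.
  exists (cst w); split; first by rewrite at0_cst.
  exists (cst d * c), (- cst d * u), b.
  have -> : cst w * (dy g * a) = dy g * (cst w * a - cst d * v) + cst d * (v * dy g) by ring.
  have -> : v * dy g = c * g - u * g^`() by rewrite -e1; ring.
  by rewrite eb; ring.
have qJ1 : qdim kap top J1 (t + e).
  apply: (qdim_add_colon (m := dy g) _ pJ1 _ _ _ _ qt qK) => //; first exact: sat3_ideal.
    move=> f; apply: sat3_sub => //.
    by apply: (sat3_comb (u := 0) (v := 0) (w := tau)); ring.
  move=> h [s [hs [u [v [w e']]]]]; exists s, w; split=> //.
  by apply: (sat3_comb (u := u) (v := v) (w := 0)); rewrite e'; ring.
apply: (qdim_add_colon (m := tau) _ pJ _ _ _ _ (qdim_tau g0)) => //.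
- move=> f; apply: sat3_sub => //.
  + by apply: (sat3_comb (u := g) (v := 0) (w := 0)); ring.
  + by apply: (sat3_comb (u := g^`()) (v := 0) (w := 0)); ring.
  + by apply: (sat3_comb (u := dy g) (v := 1) (w := 0)); rewrite ezz; ring.
- move=> h [s [hs [u [v [w e']]]]]; exists s, (u - v * dy g); split=> //.
  by apply: (sat3_comb (u := 0) (v := 0) (w := v)); rewrite e' ezz; ring.
by apply: qdim_ext qJ1 => // f; apply: iff_sym.
Qed.

Lemma prim_tjurina g : prim (sat3 g^`() (dy g) 0) -> prim (sat3 g g^`() (dy g)).
Proof. by apply: prim_le => f; apply: sat3_sub. Qed.

(** Only the prime [tau] could acquire a square, and it does not divide [g]. *)
Lemma rdiv_sq_tauM g p : prime_elt p -> at0 p = 0 -> ev0 g != 0 ->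
  rdiv (p * p) (tau * g) -> rdiv (p * p) g.
Proof.
move=> pp p0 g0 [c ec].
have [pt|npt] := classic (rdiv p tau).
  have tp : rdiv tau p.
    have [d ed] := pt; have p_neq0 : p != 0 by case: pp.
    have [_ _ /(_ d p)] := prime_tau C; rewrite -ed => /(_ (rdiv_refl _)) [[d' ed']|//].
    have : 1 = d' * p by apply: (mulfI (tau0 C)); rewrite {1}ed ed'; ring.
    by move/(congr1 at0)/eqP; rewrite rmorph1 rmorphM p0 mulr0 oner_eq0.
  have [d ed] := tp; have : g = c * d * p.
    by apply: (mulfI (tau0 C)); rewrite ec {1}ed; ring.
  by move=> eg; move: g0; rewrite eg ed mulrA ev0_mul_tau eqxx.
have [d ed] : rdiv p g by apply: (prime_mulP pp npt); rewrite ec; exists (c * p); ring.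
have : rdiv p d.
  apply: (prime_mulP pp npt); exists c; have p_neq0 : p != 0 by case: pp.
  by apply: (mulIf p_neq0); rewrite -mulrA -ed ec; ring.
by case=> d' ed'; exists d'; rewrite ed ed'; ring.
Qed.

Theorem local_line_addition g e : at0 g = 0 -> ev0 g != 0 ->
  (forall p, prime_elt p -> at0 p = 0 -> ~ rdiv (p * p) g) ->
  (forall u v c, u * g^`() + v * dy g = c * g -> rdiv 'X^e (ev0 v)) ->
  (exists u v c, u * g^`() + v * dy g = c * g /\
     exists w : K, ev0 v = 'X^e * w /\ w.[0] != 0) ->
  exists m t m' t',
    [/\ qdim kap top (sat3 g^`() (dy g) 0) m,
        qdim kap top (sat3 g g^`() (dy g)) t,
        qdim kap top (sat3 (tau * g)^`() (dy (tau * g)) 0) m',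
        qdim kap top (sat3 (tau * g) (tau * g)^`() (dy (tau * g))) t' &
        (m' + 1 = m + 2 * mup 0 (ev0 g))%N /\ (t' = t + mup 0 (ev0 g) + e)%N].
Proof.
move=> ag eg nsq H1 H2.
have g0 : g != 0 by apply: contraNneq eg => ->; rewrite rmorph0.
have pm := no_square_prim g0 ag nsq.
have pm' : prim (sat3 (tau * g)^`() (dy (tau * g)) 0).
  apply: no_square_prim; first by rewrite mulf_neq0 ?tau0.
    by rewrite rmorphM /= -![horner_eval _ _]/(at0 _) at0_tau mul0r.
  by move=> p pp p0 /(rdiv_sq_tauM pp p0 eg); apply: nsq.
have pp : prim (sat3 g^`() (dy (tau * g)) 0).
  apply: prim_le pm' => f; apply: sat3_sub => //; rewrite deriv_tauM.
  by apply: (sat3_comb (u := tau) (v := 0) (w := 0)); ring.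
have [m qm] := prim_qdim (sat3_ideal _ _ _) pm.
have [t qt] := prim_qdim (sat3_ideal _ _ _) (prim_tjurina pm).
have [k qk] := prim_qdim (sat3_ideal _ _ _) pp.
have ek := milnor_polar ag eg pm pp qm qk.
have qm' := milnor_line eg pm' qk.
have qt' := tjurina_line eg (prim_tjurina pm') (prim_tjurina pm) H1 H2 qt.
exists m, t, (mup 0 (ev0 g) + k)%N, (mup 0 (ev0 g) + (t + e))%N; split=> //.
have i0 : (0 < mup 0 (ev0 g))%N.
  by have [_ ->] := mup0_deriv eg (etrans (esym (at0E g)) ag).
by rewrite ek; move: i0; clear; lia.
Qed.

End LineAddition.

(** * From affine charts to local coordinates *)

Lemma mpoly_ring_ind n (R : comNzRingType) (P : {mpoly R[n]} -> Prop) :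
  (forall c, P c%:MP) -> (forall i, P 'X_i) ->
  (forall f g, P f -> P g -> P (f + g)) ->
  (forall f g, P f -> P g -> P (f * g)) -> forall f, P f.
Proof.
move=> hC hX hD hM f; have P1 : P 1 by rewrite -mpolyC1.
rewrite [f]mpolyE; apply: (big_ind P) => // [|m _]; first by rewrite -mpolyC0.
rewrite -mul_mpolyC; apply: (hM) => //; rewrite mpolyXE_id.
apply: (big_ind P) => [|a b|i _]; [exact: P1 | exact: hM |]; elim: (m i) => [|k IH]; first by rewrite expr0.
by rewrite exprS; apply: hM.
Qed.

Lemma mpoly_rmorph_eq n (R : comNzRingType) (S : nzRingType)
    (f g : {rmorphism {mpoly R[n]} -> S}) :
  (forall c, f c%:MP = g c%:MP) -> (forall i, f 'X_i = g 'X_i) -> f =1 g.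
Proof.
move=> hC hX; apply: (mpoly_ring_ind (P := fun p => f p = g p)) => // a b ea eb.
  by rewrite !rmorphD ea eb.
by rewrite !rmorphM ea eb.
Qed.

(** Common source of the chain rules for the line coordinates and for the charts: a derivation along
    a ring map is fixed by its values on the variables. *)
Lemma mpoly_derivation n (R : comNzRingType) (S : comNzRingType)
    (f : {rmorphism {mpoly R[n]} -> S}) (d : {mpoly R[n]} -> S) :
  (forall c, d c%:MP = 0) -> (forall a b, d (a + b) = d a + d b) ->
  (forall a b, d (a * b) = d a * f b + f a * d b) ->
  forall a, d a = \sum_i f a^`M(i) * d 'X_i.
Proof.
move=> dC dD dM.
apply: (mpoly_ring_ind (P := fun a => d a = \sum_i f a^`M(i) * d 'X_i)) => [c|i|a b|a b].
- by rewrite dC big1 // => i _; rewrite mderivC rmorph0 mul0r.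
- rewrite (bigD1 i) //= big1 ?addr0 => [|j nij]; rewrite mderivX mnmE ?eqxx.
    have -> : (U_(i) - U_(i) = 0 :> 'X_{1..n})%MM by apply/mnmP => j; rewrite !mnmE subnn.
    by rewrite scale1r mpolyX0 rmorph1 mul1r.
  by rewrite eq_sym (negbTE nij) scale0r rmorph0 mul0r.
- rewrite dD => -> ->; rewrite -big_split; apply: eq_bigr => i _.
  by rewrite mderivD rmorphD mulrDl.
rewrite dM => -> ->; rewrite mulr_suml mulr_sumr -big_split; apply: eq_bigr => i _ /=.
by rewrite mderivM rmorphD !rmorphM; ring.
Qed.

Lemma poly2_rmorph_eq (R : comNzRingType) (S : nzRingType)
    (f g : {rmorphism {poly {poly R}} -> S}) :
  (forall c, f c%:P%:P = g c%:P%:P) -> f 'X%:P = g 'X%:P -> f 'X = g 'X -> f =1 g.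
Proof.
move=> hC ht hX.
have hP q : f q%:P = g q%:P.
  elim/poly_ind: q => [|q c IH]; first by rewrite !rmorph0.
  by rewrite !polyCD !polyCM !rmorphD !rmorphM /= IH ht hC.
elim/poly_ind => [|a c IH]; first by rewrite !rmorph0.
by rewrite !rmorphD !rmorphM IH hX hP.
Qed.

(** * Affine coordinates adapted to a line *)

Section Chart.
Variable C : numClosedFieldType.
Notation P2 := {mpoly C[2]}.
Notation W := {poly {poly C}}.
Notation tau := (tau C).
Notation ev0 := (ev0 C).
Notation at0 := (at0 C).
Notation kap := (kap C).
Notation mC := (@mpolyC 2 C).

Lemma qdim_iso (R S : comNzRingType) (kR : {rmorphism C -> R}) (kS : {rmorphism C -> S})
    (f : {rmorphism R -> S}) (g : {rmorphism S -> R}) (J : R -> Prop) (J' : S -> Prop) n :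
  cancel g f -> (forall c, f (kR c) = kS c) -> (forall a, J a <-> J' (f a)) ->
  qdim kS (fun=> True) J' n -> qdim kR (fun=> True) J n.
Proof.
move=> gK fk hJ [b [_ fb sb]]; exists (fun i => g (b i)).
have e c : f (lcomb kR c (fun i => g (b i))) = lcomb kS c b.
  by rewrite rmorph_sum; apply: eq_bigr => i _; rewrite rmorphM fk gK.
split=> // [c /hJ|a _]; first by rewrite e => /fb.
by have [c hc] := sb (f a) I; exists c; apply/hJ; rewrite rmorphB e.
Qed.

Section LineCoordinates.
Variables (p lam be : 'I_2 -> C).
Let o0 : 'I_2 := ord0.
Let o1 : 'I_2 := ord_max.
Hypothesis lam_be : lam o0 * be o0 + lam o1 * be o1 = 1.

Definition dir (j : 'I_2) : C := if j == ord0 then - lam o1 else lam o0.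

(** The outer variable moves along the line, in direction [dir], and [tau] moves along [be]. Up to
    sign the determinant of this change is lam_0 be_0 + lam_1 be_1 = 1, so [phi] inverts it. *)
Definition psi : {rmorphism P2 -> W} :=
  mmap kap (fun j => kap (p j) + kap (dir j) * 'X + kap (be j) * tau).

Definition line_eq : P2 :=
  (lam o0)%:MP * ('X_o0 - (p o0)%:MP) + (lam o1)%:MP * ('X_o1 - (p o1)%:MP).

Definition line_coord : P2 :=
  (be o0)%:MP * ('X_o1 - (p o1)%:MP) - (be o1)%:MP * ('X_o0 - (p o0)%:MP).

Definition phi : {rmorphism W -> P2} :=
  horner_eval line_coord \o map_poly (horner_eval line_eq \o map_poly mC).

Lemma ord2P (P : 'I_2 -> Prop) : P o0 -> P o1 -> forall j, P j.
Proof.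
move=> h0 h1 [[|[|//]] h]; first by have -> : Ordinal h = o0 by apply: val_inj.
by have -> : Ordinal h = o1 by apply: val_inj.
Qed.

Lemma dir0 : dir o0 = - lam o1. Proof. by []. Qed.
Lemma dir1 : dir o1 = lam o0. Proof. by []. Qed.

Lemma phi_kap c : phi (kap c) = c%:MP.
Proof. by rewrite /phi /= map_polyC /= map_polyC /= !horner_evalE !hornerC. Qed.

Lemma phi_tau : phi tau = line_eq.
Proof. by rewrite /phi /= map_polyC /= map_polyX !horner_evalE hornerC hornerX. Qed.

Lemma phi_X : phi 'X = line_coord.
Proof. by rewrite /phi /= map_polyX horner_evalE hornerX. Qed.

Lemma psiC c : psi c%:MP = kap c. Proof. exact: mmapC. Qed.

Lemma psiX j : psi 'X_j = kap (p j) + kap (dir j) * 'X + kap (be j) * tau.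
Proof. by rewrite /psi /= mmapX mmap1U. Qed.

Lemma kap_rel : kap (lam o0) * kap (be o0) + kap (lam o1) * kap (be o1) = 1.
Proof. by rewrite -!rmorphM -rmorphD lam_be rmorph1. Qed.

Lemma psi_line_eq : psi line_eq = tau.
Proof.
rewrite /line_eq rmorphD !rmorphM !rmorphB !psiX !psiC dir0 dir1 rmorphN.
rewrite -[RHS]mul1r -kap_rel; ring.
Qed.

Lemma psi_line_coord : psi line_coord = 'X.
Proof.
rewrite /line_coord rmorphB !rmorphM !rmorphB !psiX !psiC dir0 dir1 rmorphN.
rewrite -[RHS]mul1r -kap_rel; ring.
Qed.

Lemma phiK : cancel phi psi.
Proof.
apply: (poly2_rmorph_eq (f := psi \o phi) (g := idfun)) => [c||].
- by rewrite -[LHS]/(psi (phi (kap c))) phi_kap psiC.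
- by rewrite -[LHS]/(psi (phi tau)) phi_tau psi_line_eq.
by rewrite -[LHS]/(psi (phi 'X)) phi_X psi_line_coord.
Qed.

Lemma mC_rel : (lam o0)%:MP * (be o0)%:MP + (lam o1)%:MP * (be o1)%:MP = 1 :> P2.
Proof. by rewrite -!mpolyCM -mpolyCD lam_be mpolyC1. Qed.

Lemma psiK : cancel psi phi.
Proof.
apply: (mpoly_rmorph_eq (f := phi \o psi) (g := idfun)) => [c|j].
  by rewrite -[LHS]/(phi (psi _)) psiC phi_kap.
rewrite -[LHS]/(phi (psi _)) psiX !rmorphD !rmorphM -![GRing.RMorphism.sort _ _]/(phi _).
rewrite !phi_kap phi_tau phi_X; elim/ord2P: j.
  rewrite dir0 mpolyCN -[RHS]/('X_o0) -[RHS](subrK (p o0)%:MP) -[X in _ = X + _]mul1r -mC_rel.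
  by rewrite /line_eq /line_coord; ring.
rewrite dir1 -[RHS]/('X_o1) -[RHS](subrK (p o1)%:MP) -[X in _ = X + _]mul1r -mC_rel.
by rewrite /line_eq /line_coord; ring.
Qed.

Lemma at0_psi a : at0 (psi a) = a.@[p].
Proof.
move: a; apply: (mpoly_rmorph_eq (f := at0 \o psi) (g := meval p)) => [c|j].
  by rewrite -[LHS]/(at0 (psi _)) psiC at0_kap /= mevalC.
rewrite -[LHS]/(at0 (psi _)) psiX !rmorphD !rmorphM -![GRing.RMorphism.sort _ _]/(at0 _).
by rewrite !at0_kap at0_X at0_tau !mulr0 !addr0 /= mevalXU.
Qed.

Lemma deriv_psi a : (psi a)^`() =
  psi a^`M(o0) * kap (dir o0) + psi a^`M(o1) * kap (dir o1).
Proof.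
rewrite (mpoly_derivation (f := psi) (d := fun a => (psi a)^`())) => [|c|f g|f g].
- rewrite big_ord_recl big_ord1; congr (psi _ * _ + psi a^`M(_) * _).
  + by rewrite psiX !derivD !derivM !derivC derivX !mul0r mulr1 mulr0 !addr0 !add0r.
  + by apply: val_inj.
  + have -> : lift ord0 ord0 = o1 :> 'I_2 by apply: val_inj.
    by rewrite psiX !derivD !derivM !derivC derivX !mul0r mulr1 mulr0 !addr0 !add0r.
- by rewrite psiC derivC.
- by rewrite rmorphD derivD.
- by rewrite rmorphM derivM.
Qed.

Lemma dy_kap c : dy (kap c) = 0.
Proof. by apply/polyP => i; rewrite coef_dy coefC; case: eqP => _; rewrite ?derivC ?deriv0 coef0. Qed.

Lemma dyD (a b : W) : dy (a + b) = dy a + dy b.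
Proof. by apply/polyP => i; rewrite coefD !coef_dy coefD derivD. Qed.

Lemma dy_X : dy ('X : W) = 0.
Proof. by apply/polyP => i; rewrite coef_dy coefX coef0 -polyC_natr derivC. Qed.

Lemma dy_psi a : dy (psi a) =
  psi a^`M(o0) * kap (be o0) + psi a^`M(o1) * kap (be o1).
Proof.
have dX j : dy (psi 'X_j) = kap (be j).
  have -> : psi 'X_j = kap (p j) + kap (dir j) * 'X + tau * kap (be j) by rewrite psiX [kap (be j) * _]mulrC.
  by rewrite !dyD dy_tauM dyM !dy_kap dy_X; ring.
rewrite (mpoly_derivation (f := psi) (d := fun a => dy (psi a))) => [|c|f g|f g].
- rewrite big_ord_recl big_ord1 !dX.
  by have -> : lift ord0 ord0 = o1 :> 'I_2 by apply: val_inj.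
- by rewrite psiC dy_kap.
- by rewrite rmorphD dyD.
- by rewrite rmorphM dyM.
Qed.

Lemma psiM a b : psi (a * b) = psi a * psi b. Proof. exact: rmorphM. Qed.
Lemma psiD a b : psi (a + b) = psi a + psi b. Proof. exact: rmorphD. Qed.
Lemma psiB a b : psi (a - b) = psi a - psi b. Proof. exact: rmorphB. Qed.

Lemma psi_partial0 a :
  psi a^`M(o0) = kap (dir o1) * dy (psi a) - kap (be o1) * (psi a)^`().
Proof.
rewrite deriv_psi dy_psi dir0 dir1 rmorphN.
rewrite -[LHS]mul1r -kap_rel; ring.
Qed.

Lemma psi_partial1 a :
  psi a^`M(o1) = kap (be o0) * (psi a)^`() - kap (dir o0) * dy (psi a).
Proof.
rewrite deriv_psi dy_psi dir0 dir1 rmorphN.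
rewrite -[LHS]mul1r -kap_rel; ring.
Qed.

Lemma sat3_psi a b c f :
  (exists t, t.@[p] != 0 /\ exists u v w, t * f = u * a + v * b + w * c) <->
  sat3 (psi a) (psi b) (psi c) (psi f).
Proof.
split=> [[t [ht [u [v [w e]]]]]|[s [hs [u [v [w e]]]]]].
  exists (psi t); rewrite at0_psi; split=> //; exists (psi u), (psi v), (psi w).
  by rewrite -!rmorphM -!rmorphD -e.
exists (phi s); split; first by rewrite -at0_psi phiK.
exists (phi u), (phi v), (phi w); apply: (can_inj psiK).
by rewrite !(psiD, psiM) (phiK s) (phiK u) (phiK v) (phiK w) e.
Qed.

Lemma sat3_partials (g : P2) a f :
  sat3 a (psi g^`M(o0)) (psi g^`M(o1)) f <-> sat3 a (psi g)^`() (dy (psi g)) f.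
Proof.
split; apply: sat3_sub; try exact: sat3_gen1.
- by rewrite psi_partial0; apply: (sat3_comb (u := 0) (v := - kap (be o1)) (w := kap (dir o1))); ring.
- by rewrite psi_partial1; apply: (sat3_comb (u := 0) (v := kap (be o0)) (w := - kap (dir o0))); ring.
- by rewrite deriv_psi; apply: (sat3_comb (u := 0) (v := kap (dir o0)) (w := kap (dir o1))); ring.
- by rewrite dy_psi; apply: (sat3_comb (u := 0) (v := kap (be o0)) (w := kap (be o1))); ring.
Qed.

Lemma sat3_rot (a b c f : W) : sat3 a b c f <-> sat3 c a b f.
Proof.
by split=> -[s [hs [u [v [w e]]]]]; exists s; split=> //; [exists w, u, v | exists v, w, u];
  rewrite e; ring.
Qed.

Definition line_map : {rmorphism P2 -> {poly C}} :=
  mmap (@polyC C) (fun j => (p j)%:P + (dir j)%:P * 'X).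

Lemma ev0_psi a : ev0 (psi a) = line_map a.
Proof.
move: a; apply: (mpoly_rmorph_eq (f := ev0 \o psi) (g := line_map)) => [c|j].
  rewrite -[LHS]/(ev0 (psi _)) psiC /line_map /= mmapC /ev0 /= map_polyC /=.
  by rewrite horner_evalE hornerC.
rewrite -[LHS]/(ev0 (psi _)) psiX !rmorphD !rmorphM -![GRing.RMorphism.sort _ _]/(ev0 _).
rewrite ev0_tau mulr0 addr0 ev0X /line_map /= mmapX mmap1U.
by rewrite /ev0 /= !map_polyC /= !horner_evalE !hornerC.
Qed.

(** In the new coordinates the derivation has components [u] and [v]; applying it to the equation of
    the line, which becomes [tau], identifies [v] as the transverse one. *)
Lemma log_psi (g a0 a1 c : P2) : a0 * g^`M(o0) + a1 * g^`M(o1) = c * g ->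
  let v := (lam o0)%:MP * a0 + (lam o1)%:MP * a1 in
  let u := (be o0)%:MP * a1 - (be o1)%:MP * a0 in
  psi u * (psi g)^`() + psi v * dy (psi g) = psi c * psi g.
Proof.
move=> e v u; rewrite -rmorphM -e /u /v deriv_psi dy_psi dir0 dir1.
rewrite !(psiB, psiD, psiM) !psiC rmorphN.
rewrite -[RHS]mul1r -kap_rel; ring.
Qed.

Lemma log_phi (g : P2) (u v c : W) : u * (psi g)^`() + v * dy (psi g) = c * psi g ->
  exists a0 a1, a0 * g^`M(o0) + a1 * g^`M(o1) = phi c * g /\
    psi ((lam o0)%:MP * a0 + (lam o1)%:MP * a1) = v.
Proof.
move=> e; pose b j := kap (dir j) * u + kap (be j) * v.
exists (phi (b o0)), (phi (b o1)); split.
  apply: (can_inj psiK); rewrite !(psiD, psiM) (phiK (b o0)) (phiK (b o1)) (phiK c).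
  by rewrite -e deriv_psi dy_psi /b; ring.
rewrite !(psiD, psiM) (phiK (b o0)) (phiK (b o1)) !psiC /b.
rewrite dir0 dir1 rmorphN -[RHS]mul1r -kap_rel; ring.
Qed.

Definition loc2 (a b f : P2) :=
  exists t, t.@[p] != 0 /\ exists u v, t * f = u * a + v * b.

Definition loc3 (a b c f : P2) :=
  exists t, t.@[p] != 0 /\ exists u v w, t * f = u * a + v * b + w * c.

Lemma qdim_loc3 (g : P2) n :
  qdim kap (fun=> True) (sat3 (psi g) (psi g)^`() (dy (psi g))) n ->
  qdim mC (fun=> True) (loc3 g g^`M(o0) g^`M(o1)) n.
Proof.
apply: (qdim_iso phiK psiC) => f; apply: iff_trans (sat3_psi _ _ _ _) _.
exact: sat3_partials.
Qed.

Lemma qdim_loc2 (g : P2) n :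
  qdim kap (fun=> True) (sat3 (psi g)^`() (dy (psi g)) 0) n ->
  qdim mC (fun=> True) (loc2 g^`M(o0) g^`M(o1)) n.
Proof.
apply: (qdim_iso phiK psiC) => f.
apply: iff_trans _ (iff_sym (sat3_rot _ _ _ _)).
apply: iff_trans _ (sat3_partials g 0 (psi f)).
have := sat3_psi 0 g^`M(o0) g^`M(o1) f; rewrite rmorph0; apply: iff_trans.
split=> [[t [ht [u [v e]]]]|[t [ht [u [v [w e]]]]]]; exists t; split=> //.
  by exists 0, u, v; rewrite e; ring.
by exists v, w; rewrite e; ring.
Qed.

Lemma chart_line_addition (g : P2) e :
  g.@[p] = 0 -> line_map g != 0 ->
  (forall a h, a.@[p] = 0 -> g <> a * a * h) ->
  (forall a0 a1 c, a0 * g^`M(o0) + a1 * g^`M(o1) = c * g ->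
     rdiv 'X^e (line_map ((lam o0)%:MP * a0 + (lam o1)%:MP * a1))) ->
  (exists a0 a1 c, a0 * g^`M(o0) + a1 * g^`M(o1) = c * g /\ exists w : {poly C},
     line_map ((lam o0)%:MP * a0 + (lam o1)%:MP * a1) = 'X^e * w /\ w.[0] != 0) ->
  let g' := line_eq * g in
  exists m t m' t',
    [/\ qdim mC (fun=> True) (loc2 g^`M(o0) g^`M(o1)) m,
        qdim mC (fun=> True) (loc3 g g^`M(o0) g^`M(o1)) t,
        qdim mC (fun=> True) (loc2 g'^`M(o0) g'^`M(o1)) m',
        qdim mC (fun=> True) (loc3 g' g'^`M(o0) g'^`M(o1)) t' &
        (m' + 1 = m + 2 * mup 0 (line_map g))%N /\
        (t' = t + mup 0 (line_map g) + e)%N].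
Proof.
move=> gp gL nsq H1 H2 g'.
have [|||||m [t [m' [t' [q1 q2 q3 q4 q5]]]]] :=
    @local_line_addition C (psi g) e; rewrite ?ev0_psi ?at0_psi //.
- move=> a pa a0 [h eh]; apply: (nsq (phi a) (phi h)).
    by rewrite -at0_psi phiK.
  by apply: (can_inj psiK); rewrite !psiM (phiK a) (phiK h) eh mulrC.
- move=> u v c /log_phi [a0 [a1 [ea ev]]]; rewrite -ev ev0_psi; exact: H1 ea.
- have [a0 [a1 [c [ea [w [ew w0]]]]]] := H2.
  eexists; eexists; exists (psi c); split; first exact: log_psi ea.
  by exists w; rewrite ev0_psi.
exists m, t, m', t'; rewrite ev0_psi in q5; split=> //.
- exact: qdim_loc2.
- exact: qdim_loc3.
- by apply: qdim_loc2; rewrite psiM psi_line_eq.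
- by apply: qdim_loc3; rewrite psiM psi_line_eq.
Qed.

End LineCoordinates.

End Chart.

(** * Comparison with the local dimension defined by fractions *)

Section Plane.
Notation C := (Rdefinitions.R[i]).
Notation W := {poly {poly C}}.
Notation tau := (tau C).
Notation ev0 := (ev0 C).
Notation at0 := (at0 C).
Notation kap := (kap C).
Notation mC := (@mpolyC 2 C).
Implicit Types (gs : seq P2) (p : 'I_2 -> C).

Lemma in_loc_ideal_ideal gs p : ideal (in_loc_ideal gs p).
Proof.
split.
- exists 1; split; first by rewrite meval1 oner_neq0.
  exists (nseq (size gs) 0); rewrite size_nseq mulr0; split=> //.
  by rewrite big1 // => i _; rewrite nth_nseq ltn_ord mul0r.
- move=> a b [t [ht [cs [sz e]]]] [t' [ht' [cs' [sz' e']]]].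
  exists (t * t'); split; first by rewrite mevalM mulf_neq0.
  exists (mkseq (fun i => t' * cs`_i + t * cs'`_i) (size gs)); rewrite size_mkseq.
  split=> //; have -> : t * t' * (a + b) = t' * (t * a) + t * (t' * b) by ring.
  rewrite e e' !mulr_sumr -big_split; apply: eq_bigr => i _ /=.
  by rewrite nth_mkseq //; ring.
- move=> a b [t [ht [cs [sz e]]]]; exists t; split=> //.
  exists (mkseq (fun i => a * cs`_i) (size gs)); rewrite size_mkseq.
  split=> //; rewrite mulrCA e mulr_sumr; apply: eq_bigr => i _.
  by rewrite nth_mkseq // mulrA.
Qed.

(** Clearing denominators turns independent fractions into independent polynomials, so [free_mod_le]
    bounds their number; conversely polynomials are fractions with denominator 1. The number chosen
    by [epsilon] is thereby forced. *)
Lemma local_dimE gs p n :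
  qdim mC (fun=> True) (in_loc_ideal gs p) n -> local_dim gs p = n.
Proof.
move=> qn; have hn : has_local_dim gs p n.
  split.
    have [b [_ fb _]] := qn; exists b, (fun=> 1); split; first by move=> i; rewrite meval1 oner_neq0.
    move=> c hc i; apply: (fb c); move: hc; rewrite /lcomb.
    by under eq_bigr do rewrite big1 // mulr1.
  move=> k a s [_ h]; apply: (free_mod_le (in_loc_ideal_ideal gs p) qn (b := fun i => a i * \prod_(j < k | j != i) s j)) => //.
have [hl1 hl2] : has_local_dim gs p (local_dim gs p).
  by apply: epsilon_spec; exists n.
have [hn1 hn2] := hn; apply/eqP; rewrite eqn_leq.
have [a [s /hn2 ->]] := hl1; have [a' [s' /hl2 ->]] := hn1.
by [].
Qed.

Lemma in_loc_ideal2 (a b f : P2) p : in_loc_ideal [:: a; b] p f <->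
  exists t, t.@[p] != 0 /\ exists u v, t * f = u * a + v * b.
Proof.
split=> [[t [ht [cs [sz e]]]]|[t [ht [u [v e]]]]]; exists t; split=> //.
  by exists cs`_0, cs`_1; rewrite e !big_ord_recl big_ord0 /= addr0.
by exists [:: u; v]; rewrite !big_ord_recl big_ord0 /= addr0.
Qed.

Lemma in_loc_ideal3 (a b c f : P2) p : in_loc_ideal [:: a; b; c] p f <->
  exists t, t.@[p] != 0 /\ exists u v w, t * f = u * a + v * b + w * c.
Proof.
split=> [[t [ht [cs [sz e]]]]|[t [ht [u [v [w e]]]]]]; exists t; split=> //.
  by exists cs`_0, cs`_1, cs`_2; rewrite e !big_ord_recl big_ord0 /= addr0 addrA.
by exists [:: u; v; w]; rewrite !big_ord_recl big_ord0 /= addr0 addrA.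
Qed.

End Plane.

(** * Homogeneous polynomials in three variables *)

Section Homogeneous.
Variable C : numClosedFieldType.
Notation P2 := {mpoly C[2]}.
Notation P3 := {mpoly C[3]}.

Lemma dhomog_monomial_ind n (P : nat -> {mpoly C[n]} -> Prop) :
  P 0%N 1 -> (forall k i (F : {mpoly C[n]}), P k F -> P k.+1 ('X_i * F)) ->
  (forall k, P k 0) -> (forall k c F G, P k F -> P k G -> P k (c *: F + G)) ->
  forall k F, F \is k.-homog -> P k F.
Proof.
move=> h1 hX h0 hD k F /dhomogP hF.
have hm k' : forall m : 'X_{1..n}, mdeg m = k' -> P k' 'X_[m].
  elim: k' => [|k' IH] m.
    by move/eqP; rewrite mdeg_eq0 => /eqP ->; rewrite mpolyX0.
  move=> em; have [i mi] : exists i, m i != 0%N.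
    apply: NNPP => H; have : m = 0%MM.
      by apply/mnmP => i; rewrite mnm0E; apply/eqP/negPn/negP => mi; apply: H; exists i.
    by move=> m0; move: em; rewrite m0 mdeg0.
  have e : m = (U_(i) + (m - U_(i)))%MM.
    rewrite addmC submK //; apply/mnm_lepP => j; rewrite mnm1E.
    by case: eqP => // <-; rewrite lt0n.
  rewrite e mpolyXD; apply: hX; apply: IH.
  by move: em; rewrite {1}e mdegD mdeg1 => -[].
rewrite [F]mpolyE big_seq; apply: (big_rec (P k)) => // m G mF PG.
by apply: hD => //; apply: hm; apply: hF.
Qed.

(* Restriction to the line through [Q] with direction [V]. *)
Definition lin n (Q V : 'I_n -> C) : {rmorphism {mpoly C[n]} -> {poly C}} :=
  mmap (@polyC C) (fun i => (Q i)%:P + (V i)%:P * 'X).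

Lemma linX n (Q V : 'I_n -> C) i : lin Q V 'X_i = (Q i)%:P + (V i)%:P * 'X.
Proof. by rewrite /lin /= mmapX mmap1U. Qed.

Lemma linC n (Q V : 'I_n -> C) c : lin Q V c%:MP = c%:P.
Proof. exact: mmapC. Qed.

Lemma linM n (Q V : 'I_n -> C) F G : lin Q V (F * G) = lin Q V F * lin Q V G.
Proof. exact: rmorphM. Qed.

Lemma linD n (Q V : 'I_n -> C) F G : lin Q V (F + G) = lin Q V F + lin Q V G.
Proof. exact: rmorphD. Qed.

Lemma linZ n (Q V : 'I_n -> C) c F : lin Q V (c *: F) = c *: lin Q V F.
Proof. by rewrite -mul_mpolyC linM linC mul_polyC. Qed.

(* The homogenization of degree [k] of [q], evaluated at [(s, w)]. *)
Definition hlift (R : comNzRingType) (kp : {rmorphism C -> R}) (s w : R) k (q : {poly C}) :=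
  \sum_(j < k.+1) kp q`_j * w ^+ j * s ^+ (k - j).

Lemma hlift_linear R kp s w k c (p q : {poly C}) :
  @hlift R kp s w k (c *: p + q) = kp c * hlift kp s w k p + hlift kp s w k q.
Proof.
rewrite /hlift mulr_sumr -big_split; apply: eq_bigr => j _ /=.
by rewrite coefD coefZ rmorphD rmorphM; ring.
Qed.

Lemma hlift_linear_factor R kp s w k (x y : C) (p : {poly C}) : (size p <= k.+1)%N ->
  @hlift R kp s w k.+1 ((x%:P + y%:P * 'X) * p) =
  (kp x * s + kp y * w) * hlift kp s w k p.
Proof.
move=> sp; have -> : (x%:P + y%:P * 'X) * p = x *: p + y *: (p * 'X).
  by rewrite -!mul_polyC; ring.
rewrite hlift_linear mulrDl; congr (_ + _).
  rewrite /hlift big_ord_recr /= nth_default // rmorph0 !mul0r addr0.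
  rewrite -[kp x * s * _]mulrA; congr (_ * _); rewrite mulr_sumr.
  by apply: eq_bigr => j _; rewrite subSn ?leq_ord // exprS; ring.
rewrite /hlift big_ord_recl /= coefZ coefMX mulr0 rmorph0 !mul0r add0r mulr_sumr.
by apply: eq_bigr => j _; rewrite /bump /= add1n coefZ coefMX /= rmorphM subSS exprS; ring.
Qed.

(** The target ring varies in the applications: scalars give the value at the point at infinity,
    polynomials a change of parameter on the line, and forms in three variables the lift from the
    line to the plane. *)
Lemma dhomog_lin n (Q V : 'I_n -> C) k (F : {mpoly C[n]}) : F \is k.-homog ->
  (size (lin Q V F) <= k.+1)%N /\
  forall (R : comNzRingType) (kp : {rmorphism C -> R}) (s w : R),
    mmap kp (fun i => kp (Q i) * s + kp (V i) * w) F = hlift kp s w k (lin Q V F).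
Proof.
move: k F; apply: dhomog_monomial_ind => [|k i F [sz IH]|k|k c F G [sF hF] [sG hG]].
- split=> [|R kp s w]; first by rewrite rmorph1 size_poly1.
  by rewrite !rmorph1 /hlift big_ord1 coef1 rmorph1 !expr0 !mulr1.
- rewrite linM linX; split=> [|R kp s w].
    apply: leq_trans (size_polyMleq _ _) _.
    have : (size ((Q i)%:P + (V i)%:P * 'X)%R <= 2)%N.
      apply: leq_trans (size_polyD _ _) _; rewrite geq_max size_polyC (leq_trans (leq_b1 _)) //=.
      by rewrite mul_polyC (leq_trans (size_scale_leq _ _)) // size_polyX.
    by move: sz; move: (size _) (size _) => x y; clear; lia.
  by rewrite rmorphM /= mmapX mmap1U IH hlift_linear_factor.
- split=> [|R kp s w]; first by rewrite rmorph0 size_poly0.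
  by rewrite !rmorph0 /hlift big1 // => j _; rewrite coef0 rmorph0 !mul0r.
rewrite linD linZ; split=> [|R kp s w].
  apply: leq_trans (size_polyD _ _) _; rewrite geq_max sG andbT.
  exact: leq_trans (size_scale_leq _ _) sF.
by rewrite rmorphD /= mmapZ hF hG hlift_linear.
Qed.

Lemma euler n k (F : {mpoly C[n]}) : F \is k.-homog ->
  \sum_i 'X_i * F^`M(i) = k%:R *: F.
Proof.
move: k F; apply: dhomog_monomial_ind => [|k i F IH|k|k c F G hF hG].
- by rewrite scale0r big1 // => i _; rewrite -mpolyC1 mderivC mulr0.
- rewrite (eq_bigr (fun j => 'X_i * ('X_j * F^`M(j)) + (if i == j then 'X_i * F else 0))).
    rewrite big_split /= -mulr_sumr IH -big_mkcond (big_pred1 i) => [|j]; last by rewrite eq_sym.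
    by rewrite -scalerAr -[X in _ + X]scale1r -scalerDl natr1.
  move=> j _; rewrite mderivM mderivX mnmE; case: eqP => [<-|_]; last first.
    by rewrite scale0r mul0r add0r addr0 mulrCA.
  have -> : (U_(i) - U_(i) = 0 :> 'X_{1..n})%MM by apply/mnmP => j'; rewrite !mnmE subnn.
  by rewrite scale1r mpolyX0 mul1r mulrDr addrC mulrCA.
- by rewrite scaler0 big1 // => i _; rewrite mderiv0 mulr0.
rewrite scalerDr [_ *: (c *: F)]scalerA mulrC -scalerA -hF -hG scaler_sumr -big_split.
by apply: eq_bigr => i _ /=; rewrite mderivD mderivZ mulrDr scalerAr.
Qed.

End Homogeneous.

(** * Affine charts of the projective plane *)

Section Dehomogenization.
Variable C : numClosedFieldType.
Notation P2 := {mpoly C[2]}.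
Notation P3 := {mpoly C[3]}.
Notation mC := (@mpolyC 2 C).
Variable k : 'I_3.
Implicit Types (F G : P3) (a b : P2).

Definition dehk : {rmorphism P3 -> P2} :=
  mmap mC (fun i => if unlift k i is Some j then 'X_j else 1).

Definition rehom0 : {rmorphism P2 -> P3} :=
  mmap (@mpolyC 3 C) (fun j => 'X_(lift k j)).

(** Homogenization to a prescribed degree. It loses nothing when [msize a <= N.+1], [msize] being
    the degree plus one. *)
Definition rehom N a : P3 :=
  \sum_(i < N.+1) 'X_k ^+ (N - i) * rehom0 (pihomog mdeg i a).

Lemma dehkC c : dehk c%:MP = c%:MP. Proof. exact: mmapC. Qed.

Lemma dehkX i : dehk 'X_i = if unlift k i is Some j then 'X_j else 1.
Proof. by rewrite /dehk /= mmapX mmap1U. Qed.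

Lemma dehkM F G : dehk (F * G) = dehk F * dehk G. Proof. exact: rmorphM. Qed.
Lemma dehkD F G : dehk (F + G) = dehk F + dehk G. Proof. exact: rmorphD. Qed.

Lemma dehkX_lift j : dehk 'X_(lift k j) = 'X_j.
Proof. by rewrite dehkX liftK. Qed.

Lemma dehkX_k : dehk 'X_k = 1.
Proof. by rewrite dehkX unlift_none. Qed.

Lemma rehom0X j : rehom0 'X_j = 'X_(lift k j).
Proof. by rewrite /rehom0 /= mmapX mmap1U. Qed.

Lemma rehom0M a b : rehom0 (a * b) = rehom0 a * rehom0 b.
Proof. exact: rmorphM. Qed.

Lemma rehom0K : cancel rehom0 dehk.
Proof.
apply: (mpoly_rmorph_eq (f := dehk \o rehom0) (g := idfun)) => [c|j].
  by rewrite -[LHS]/(dehk (rehom0 _)) [rehom0 _]mmapC dehkC.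
by rewrite -[LHS]/(dehk (rehom0 _)) rehom0X dehkX_lift.
Qed.

Lemma rehomK N a : (msize a <= N.+1)%N -> dehk (rehom N a) = a.
Proof.
move=> h; rewrite [RHS](pihomog_partitionE h) rmorph_sum; apply: eq_bigr => i _.
by rewrite dehkM rmorphXn -[dehk 'X_k]/(dehk _) dehkX_k expr1n mul1r rehom0K.
Qed.

Lemma rehom0_homog i a : a \is i.-homog -> rehom0 a \is i.-homog.
Proof.
move: i a; apply: dhomog_monomial_ind => [|i j a IH|i|i c a b ha hb].
- by rewrite rmorph1 dhomog1.
- rewrite rmorphM -[rehom0 'X_j]/(rehom0 _) rehom0X -[i.+1]add1n; apply: dhomogM => //.
  by rewrite dhomogX; apply/eqP; apply: mdeg1.
- by rewrite rmorph0 dhomog0.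
rewrite rmorphD -mul_mpolyC rmorphM -[rehom0 c%:MP]/(rehom0 _) [rehom0 c%:MP]mmapC mul_mpolyC.
by apply: dhomogD => //; apply: dhomogZ.
Qed.

Lemma dhomogXU n (i : 'I_n) j : ('X_i ^+ j : {mpoly C[n]}) \is j.-homog.
Proof.
have : ('X_i : {mpoly C[n]}) \is 1.-homog by rewrite dhomogX; apply/eqP/mdeg1.
by move/(dhomogMn j); rewrite mul1n.
Qed.

Lemma rehom_homog N a : rehom N a \is N.-homog.
Proof.
apply: rpred_sum => i _; have := dhomogM (dhomogXU k (N - i)) (rehom0_homog (pihomogP mdeg i a)).
by rewrite subnK ?leq_ord.
Qed.

Lemma rehom_linear N c a b : rehom N (c *: a + b) = c *: rehom N a + rehom N b.
Proof.
rewrite /rehom scaler_sumr -big_split; apply: eq_bigr => i _ /=.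
rewrite linearP rmorphD /= mulrDr; congr (_ + _).
by rewrite -mul_mpolyC rmorphM /= [mmap _ _ c%:MP]mmapC mul_mpolyC scalerAr.
Qed.

Lemma pihomog_ge d a : (msize a <= d)%N -> pihomog mdeg d a = 0.
Proof.
move=> h; rewrite pihomogE big_seq_cond big_pred0 // => m.
by apply/negP => /andP[/msize_mdeg_lt lt /eqP e]; move: lt; rewrite e ltnNge h.
Qed.

Lemma pihomog_mulX d j a :
  pihomog mdeg d.+1 ('X_j * a) = 'X_j * pihomog mdeg d a.
Proof.
rewrite [a]mpolyE mulr_sumr !raddf_sum mulr_sumr; apply: eq_bigr => m _ /=.
rewrite -scalerAr !linearZ /= -mpolyXD !pihomogX.
rewrite -[X in if X then _ else _]/(mdeg (U_(j) + m)%MM == d.+1) mdegD mdeg1 add1n eqSS.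
by case: eqP => _; rewrite ?scaler0 ?mulr0 // -scalerAr mpolyXD.
Qed.

Lemma pihomog0_mulX j a : pihomog mdeg 0 ('X_j * a) = 0.
Proof.
rewrite [a]mpolyE mulr_sumr raddf_sum big1 // => m _ /=.
rewrite -scalerAr linearZ /= -mpolyXD pihomogX.
by rewrite -[X in if X then _ else _]/(mdeg (U_(j) + m)%MM == 0%N) mdegD mdeg1 scaler0.
Qed.

Lemma dehk_homog N F : F \is N.-homog ->
  (msize (dehk F) <= N.+1)%N /\ rehom N (dehk F) = F.
Proof.
move: N F; apply: dhomog_monomial_ind => [|N i F [sz IH]|N|N c F G [sF hF] [sG hG]].
- rewrite rmorph1 msize1; split=> //; rewrite /rehom big_ord1 expr0 mul1r.
  by rewrite pihomog_dE ?rmorph1 ?dhomog1.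
- rewrite dehkM; case: (unliftP k i) => [j ->|->]; last first.
    rewrite dehkX_k mul1r; split; first exact: leqW.
    rewrite /rehom big_ord_recr /= pihomog_ge // rmorph0 mulr0 addr0.
    rewrite -[in RHS]IH /rehom [RHS]mulr_sumr; apply: eq_bigr => i' _ /=.
    by rewrite subSn ?leq_ord // exprS mulrA.
  rewrite dehkX_lift; split.
    have [->|nz] := eqVneq (dehk F) 0; first by rewrite mulr0 msize0.
    have X0 : 'X_j != 0 :> P2 by rewrite -msize_poly_eq0 msizeX.
    by rewrite (msizeM X0 nz) msizeX mdeg1 add2n.
  rewrite /rehom big_ord_recl pihomog0_mulX rmorph0 mulr0 add0r.
  rewrite -[in RHS]IH /rehom [RHS]mulr_sumr; apply: eq_bigr => i' _ /=.
  rewrite /bump /= add1n subSS pihomog_mulX rehom0M.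
  by rewrite rehom0X mulrCA.
- rewrite rmorph0 msize0; split=> //; rewrite /rehom big1 // => i _.
  by rewrite raddf0 rmorph0 mulr0.
have -> : dehk (c *: F + G) = c *: dehk F + dehk G.
  by rewrite dehkD -mul_mpolyC dehkM dehkC mul_mpolyC.
rewrite rehom_linear hF hG; split=> //; apply: leq_trans (msizeD_le _ _) _.
by rewrite geq_max sG andbT; apply: leq_trans (mmeasureZ_le _ _ _) sF.
Qed.

Lemma dehk_inj N F G : F \is N.-homog -> G \is N.-homog -> dehk F = dehk G -> F = G.
Proof. by move=> /dehk_homog[_ hF] /dehk_homog[_ hG] e; rewrite -hF -hG e. Qed.

Lemma dehk_deriv j F : (dehk F)^`M(j) = dehk F^`M(lift k j).
Proof.
rewrite (mpoly_derivation (f := dehk) (d := fun F => (dehk F)^`M(j))) => [|c|a b|a b].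
- rewrite (bigD1 (lift k j)) //= big1 ?addr0 => [|i nij].
    rewrite -[mmap _ _ 'X_(lift k j)]/(dehk _) dehkX_lift mderivX mnmE eqxx.
    have -> : (U_(j) - U_(j) = 0 :> 'X_{1..2})%MM by apply/mnmP => j'; rewrite !mnmE subnn.
    by rewrite scale1r mpolyX0 mulr1.
  rewrite -[mmap _ _ 'X_i]/(dehk _) dehkX; case: unliftP nij => [j' ->|_ _]; last first.
    by rewrite -mpolyC1 mderivC mulr0.
  rewrite (inj_eq lift_inj) => nj; rewrite mderivX mnmE (negbTE nj).
  by rewrite scale0r mulr0.
- by rewrite dehkC mderivC.
- by rewrite dehkD mderivD.
- by rewrite dehkM mderivM.
Qed.

Lemma euler_dehk d F : F \is d.-homog ->
  \sum_j 'X_j * (dehk F)^`M(j) + dehk F^`M(k) = d%:R *: dehk F.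
Proof.
move=> hF; have := congr1 dehk (euler hF); rewrite rmorph_sum (bigD1_ord k) //=.
rewrite -![mmap _ _ _]/(dehk _) dehkM dehkX_k mul1r.
rewrite -[d%:R *: F]mul_mpolyC dehkM dehkC mul_mpolyC => <-; rewrite addrC; congr (_ + _).
by apply: eq_bigr => j _; rewrite -[mmap _ _ _]/(dehk _) dehkM dehkX_lift dehk_deriv.
Qed.

(** A square factor in the chart lifts to a square factor of the form: homogenizing the cofactor to
    degree [d - i - i] restores the power of ['X_k] lost in the chart. *)
Lemma dehk_square d F a b : F \is d.-homog -> F != 0 -> dehk F = a * a * b ->
  (forall G H : P3, F = G * G * H -> (msize G <= 1)%N) -> exists c, a = c%:MP.
Proof.
move=> hF F0 e sq; have [sz _] := dehk_homog hF.
have nz : dehk F != 0.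
  apply: contraNneq F0 => h; apply/eqP/(dehk_inj hF); first exact: dhomog0.
  by rewrite h rmorph0.
move: nz; rewrite e !mulf_eq0 !negb_or => /andP[/andP[a0 _] b0].
have sa : (0 < msize a)%N by rewrite lt0n msize_poly_eq0.
have sb : (0 < msize b)%N by rewrite lt0n msize_poly_eq0.
pose i := (msize a).-1; pose j := (d - i - i)%N.
have hs : (i + i + (msize b).-1 <= d)%N.
  move: sz; rewrite e !msizeM ?mulf_neq0 // /i.
  by move: sa sb; move: (msize a) (msize b) => x y; clear; lia.
have ea : dehk (rehom i a) = a by apply: rehomK; rewrite prednK.
have eb : dehk (rehom j b) = b.
  apply: rehomK; rewrite /j; move: hs sb; move: (msize b) => y; clear.
  by move: i => i; lia.
have eF : F = rehom i a * rehom i a * rehom j b.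
  apply: (dehk_inj hF); last by rewrite !dehkM ea eb.
  have -> : d = (i + i + j)%N by rewrite /j; move: hs; clear; move: i => i; lia.
  by apply: dhomogM; [apply: dhomogM|]; apply: rehom_homog.
exists (rehom i a)@_0; rewrite -dehkC -[LHS]ea; congr (dehk _).
exact: msize1_polyC (sq _ _ eF).
Qed.

End Dehomogenization.

(** * The local contribution of one intersection point *)

Section PointOnLine.
Variable C : numClosedFieldType.
Notation P2 := {mpoly C[2]}.
Notation P3 := {mpoly C[3]}.
Notation mC := (@mpolyC 2 C).
Notation dehk := (@dehk C).

Definition lform (L : 'I_3 -> C) : P3 := \sum_i (L i)%:MP * 'X_i.

(** The order of a binary form at a point does not depend on the parameter: [s] is nonzero at [t],
    and [w] vanishes there to order one. *)
Lemma hlift_mup (s w : {poly C}) k (P : {poly C}) t : (size P <= k.+1)%N ->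
  s.[t] != 0 -> w.[t] = 0 -> w^`().[t] != 0 -> P != 0 ->
  hlift (@polyC C) s w k P != 0 /\ mup t (hlift (@polyC C) s w k P) = mup 0 P.
Proof.
move=> sP s0 w0 w'0 P0; have [u u0 eP] := mup0_split P0.
have [i ei] : exists i, i = mup 0 P by exists (mup 0 P).
rewrite -{}ei in eP *.
have u_neq0 : u != 0 by apply: contraNneq u0 => ->; rewrite horner0.
have ik : (i <= k)%N.
  move: sP; rewrite eP size_mul ?expf_neq0 ?polyX_eq0 // size_polyXn addSn /=.
  by move: u_neq0; rewrite -size_poly_gt0; move: (size u) => x; clear; lia.
have [c ec] : exists c, w = c * ('X - t%:P) by apply/factor_theorem; rewrite rootE w0.
have ct : c.[t] != 0.
  move: w'0; rewrite ec derivM derivXsubC mulr1 hornerD hornerM hornerXsubC subrr.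
  by rewrite mulr0 add0r.
pose U := \sum_(j < (k - i).+1) (u`_j)%:P * w ^+ j * s ^+ (k - i - j).
have eH : hlift (@polyC C) s w k P = ('X - t%:P) ^+ i * (c ^+ i * U).
  rewrite mulrA -exprMn [_ * c]mulrC -ec /hlift.
  rewrite -(big_mkord xpredT (fun j => (P`_j)%:P * w ^+ j * s ^+ (k - j))).
  have ik1 : (i <= k.+1)%N by apply: leqW.
  rewrite (big_cat_nat (leq0n i) ik1) /= big_nat_cond big1 ?add0r; last first.
    by move=> j /andP[/andP[_ lt] _]; rewrite eP coefXnM lt !mul0r.
  rewrite (big_addn 0 k.+1 i) big_mkord subSn // /U mulr_sumr.
  apply: eq_bigr => j _; rewrite eP coefXnM ltnNge leq_addl /= addnK exprD.
  by rewrite addnC subnDA; ring.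
have Ut : (c ^+ i * U).[t] != 0.
  rewrite hornerM horner_exp mulf_neq0 ?expf_neq0 // /U big_ord_recl /= hornerD horner_sum.
  rewrite big1 ?addr0 => [|j _]; last first.
    by rewrite !hornerM horner_exp w0 /bump /= add1n exprS mul0r mulr0 mul0r.
  rewrite subn0 expr0 mulr1 hornerM hornerC horner_exp mulf_neq0 ?expf_neq0 //.
  by rewrite -horner_coef0.
have U0 : c ^+ i * U != 0 by apply: contraNneq Ut => ->; rewrite horner0.
rewrite eH; split; first by rewrite mulf_neq0 ?expf_neq0 ?polyXsubC_eq0.
by rewrite mupMl ?rootE // mup_XsubCX eqxx.
Qed.

Lemma dhomog_mderiv n d (F : {mpoly C[n]}) i :
  F \is d.-homog -> F^`M(i) \is (d.-1).-homog.
Proof.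
move=> /dhomogP hF; apply/dhomogP => m; rewrite mcoeff_msupp mcoeff_mderiv => nz.
have : (m + U_(i))%MM \in msupp F.
  by rewrite mcoeff_msupp; apply: contraNneq nz => ->; rewrite mul0rn.
by move/hF => /= <-; rewrite mdegD mdeg1 addn1.
Qed.

Lemma rdiv_mup0 e (P : {poly C}) : P = 0 \/ (e <= mup 0 P)%N -> rdiv 'X^e P.
Proof.
have [->|P0] := eqVneq P 0; first by move=> _; apply: rdiv0.
case=> [h|h]; first by rewrite h eqxx in P0.
have [u _ ->] := mup0_split P0.
by exists ('X^(mup 0 P - e) * u); rewrite mulrAC -exprD subnK.
Qed.

Section Point.
Variables (L A B : 'I_3 -> C) (t : C) (k : 'I_3).
Hypotheses (LA : \sum_i L i * A i = 0) (LB : \sum_i L i * B i = 0).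
Hypothesis L0 : exists i, L i != 0.
Hypothesis indep : forall x y, (forall i, x * A i + y * B i = 0) -> x = 0 /\ y = 0.
Hypothesis ck : A k + t * B k != 0.

(** The point with parameter [t] on the line and its coordinates in the chart [k]; [Q] and [V] trace
    the same line inside that chart, with parameter 0 at the point. *)
Let q i := A i + t * B i.
Let p (j : 'I_2) := q (lift k j) / q k.
Let lam (j : 'I_2) := L (lift k j).
Let Q i := if unlift k i is Some j then p j else 1.
Let V i := if unlift k i is Some j then dir lam j else 0.

Lemma Lq : \sum_i L i * q i = 0.
Proof.
rewrite (eq_bigr (fun i => L i * A i + t * (L i * B i))) => [|i _]; last by rewrite /q; ring.
by rewrite big_split /= -mulr_sumr LA LB mulr0 addr0.
Qed.

Lemma lam_neq0 : (lam ord0 != 0) || (lam ord_max != 0).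
Proof.
rewrite -negb_and; apply/negP => /andP[/eqP l0 /eqP l1].
have hl j : lam j = 0 by elim/ord2P: j.
have Lk : L k = 0.
  apply/eqP; move/eqP: Lq; rewrite (bigD1_ord k) //= big1 ?addr0 => [|j _]; last first.
    by rewrite -[L _]/(lam j) hl mul0r.
  by rewrite mulf_eq0 (negbTE ck) orbF.
by have [i /eqP] := L0; case: (unliftP k i) => [j ->|->] //; rewrite -[L _]/(lam j) hl.
Qed.

Lemma exists_be : exists be : 'I_2 -> C, lam ord0 * be ord0 + lam ord_max * be ord_max = 1.
Proof.
case/orP: lam_neq0 => nz.
  exists (fun j => if j == ord0 then (lam ord0)^-1 else 0).
  by rewrite eqxx mulfV // mulr0 addr0.
exists (fun j => if j == ord0 then 0 else (lam ord_max)^-1).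
by rewrite eqxx mulr0 add0r mulfV.
Qed.

Lemma QE i : q i = q k * Q i.
Proof.
rewrite /Q; case: (unliftP k i) => [j ->|->]; last by rewrite mulr1.
by rewrite /p mulrC divfK.
Qed.

Lemma dehk_lform : dehk k (lform L) = line_eq p lam.
Proof.
rewrite /lform rmorph_sum (bigD1_ord k) //= big_ord_recl big_ord1.
rewrite -![mmap _ _ _]/(dehk k _) !dehkM !dehkC dehkX_k !dehkX_lift mulr1 /line_eq.
have -> : lift ord0 ord0 = ord_max :> 'I_2 by apply: val_inj.
have -> : L k = - (lam ord0 * p ord0 + lam ord_max * p ord_max).
  apply: (mulIf ck); rewrite -[A k + _]/(q k); apply/eqP; rewrite mulNr -addr_eq0; apply/eqP.
  rewrite -[RHS]Lq (bigD1_ord k) //= big_ord_recl big_ord1.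
  have -> : lift ord0 ord0 = ord_max :> 'I_2 by apply: val_inj.
  have pk j : p j * q k = q (lift k j) by rewrite /p divfK.
  by rewrite mulrDl -![lam _ * p _ * _]mulrA !pk.
rewrite mpolyCN mpolyCD !mpolyCM /lam; ring.
Qed.

Lemma line_dehk F : line_map p lam (dehk k F) = lin Q V F.
Proof.
move: F; apply: (mpoly_rmorph_eq (f := line_map p lam \o dehk k) (g := lin Q V)) => [c|i].
  by rewrite -[LHS]/(line_map p lam (dehk k _)) dehkC linC /line_map /= mmapC.
rewrite -[LHS]/(line_map p lam (dehk k _)) dehkX linX /Q /V.
case: unliftP => [j _|_]; last by rewrite rmorph1 mul0r addr0.
by rewrite /line_map /= mmapX mmap1U.
Qed.

(** The left side is annihilated by [L] and has coordinate 0 at [k], hence is a multiple of the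
    chart direction; independence of [A] and [B] excludes the factor 0. *)
Lemma direction : exists2 z, z != 0 & forall i, B i - B k * Q i = z * V i.
Proof.
have Qk : Q k = 1 by rewrite /Q unlift_none.
have Vk : V k = 0 by rewrite /V unlift_none.
pose b j := B (lift k j) - B k * Q (lift k j).
have LQ : \sum_i L i * Q i = 0.
  apply: (mulfI ck); rewrite mulr0 -[RHS]Lq mulr_sumr; apply: eq_bigr => i _.
  by rewrite -[A k + _]/(q k) [in RHS]QE mulrCA.
have rel : lam ord0 * b ord0 + lam ord_max * b ord_max = 0.
  have : \sum_i L i * (B i - B k * Q i) = 0.
    rewrite (eq_bigr (fun i => L i * B i - B k * (L i * Q i))) => [|i _]; last by ring.
    by rewrite sumrB -mulr_sumr LB LQ mulr0 subr0.
  rewrite (bigD1_ord k) //= Qk mulr1 subrr mulr0 add0r big_ord_recl big_ord1.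
  by have -> : lift ord0 ord0 = ord_max :> 'I_2 by apply: val_inj.
have [z hz] : exists z, forall j, b j = z * dir lam j.
  have d0 : dir lam ord0 = - lam ord_max by [].
  have d1 : dir lam ord_max = lam ord0 by [].
  case/orP: lam_neq0 => nz.
    exists (b ord_max / lam ord0); apply: ord2P; last by rewrite d1 divfK.
    rewrite d0; apply: (mulfI nz); move/eqP: rel; rewrite addr_eq0 => /eqP ->.
    by rewrite mulrA mulrCA divff // mulr1; ring.
  exists (- b ord0 / lam ord_max); apply: ord2P; first by rewrite d0 mulrN divfK // opprK.
  rewrite d1; apply: (mulfI nz); move/eqP: rel; rewrite addrC addr_eq0 => /eqP ->.
  by rewrite mulrA mulrCA divff // mulr1; ring.
have hzV i : B i - B k * Q i = z * V i.
  case: (unliftP k i) => [j ->|->]; last by rewrite Qk Vk mulr0 mulr1 subrr.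
  by rewrite -/(b j) hz /V liftK.
exists z => //; apply/eqP => z0.
have [] := @indep (- (B k / q k)) (1 - t * (B k / q k)) _.
  move=> i; have := hzV i; rewrite z0 mul0r => /eqP; rewrite subr_eq0 => /eqP eB.
  have : q k * B i = B k * q i by rewrite [q i]QE eB; ring.
  move=> e; apply: (mulfI ck); rewrite -[A k + _]/(q k) mulr0.
  transitivity (q k * B i - B k * q i); last by rewrite e subrr.
  by rewrite /q; field.
move/eqP; rewrite oppr_eq0 mulf_eq0 invr_eq0 (negbTE ck) orbF => /eqP ->.
by rewrite mul0r mulr0 subr0 => /eqP; rewrite oner_eq0.
Qed.

(** The parameters of the frame and of the chart are related by the fractional linear map w / s,
    which sends [t] to 0. *)
Lemma mobius N (F : P3) : F \is N.-homog -> lin A B F != 0 \/ lin Q V F != 0 ->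
  [/\ lin A B F != 0, lin Q V F != 0 & mup t (lin A B F) = mup 0 (lin Q V F)].
Proof.
move=> hF; have [z z0 hz] := direction.
pose s : {poly C} := (A k)%:P + (B k)%:P * 'X; pose w : {poly C} := z%:P * ('X - t%:P).
have eH : lin A B F = hlift (@polyC C) s w N (lin Q V F).
  have [_ <-] := dhomog_lin Q V hF; move: F {hF}.
  apply: (mpoly_rmorph_eq (f := lin A B) (g := mmap (@polyC C) (fun i => (Q i)%:P * s + (V i)%:P * w))) => [c|i].
    by rewrite linC /= mmapC.
  rewrite linX /= mmapX mmap1U.
  have eA : A i = q k * Q i - t * B i by rewrite -QE /q addrK.
  have eB : B i = B k * Q i + z * V i by rewrite -hz addrC subrK.
  rewrite eA eB /s /w /q !(polyCD, polyCB, polyCM, polyCN); ring.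
have sz := proj1 (dhomog_lin Q V hF).
have [P0|P0] := eqVneq (lin Q V F) 0.
  case=> //; rewrite eH P0 /hlift big1 ?eqxx // => j _.
  by rewrite coef0 !mul0r.
have [||| h1 h2] := hlift_mup sz _ _ _ P0 (s := s) (w := w) (t := t).
- by rewrite /s hornerD hornerM !hornerC hornerX [B k * t]mulrC.
- by rewrite /w hornerM hornerXsubC subrr mulr0.
- by rewrite /w derivM derivC mul0r add0r derivXsubC mulr1 hornerC.
by move=> _; rewrite eH.
Qed.

Section Derivations.
Variables (f : P3) (d : nat) (v : 'I_2 -> 'I_3 -> P3) (dg : 'I_2 -> nat).
Hypotheses (d0 : (0 < d)%N) (hf : f \is d.-homog).
Hypothesis f_red : forall G H : P3, f = G * G * H -> (msize G <= 1)%N.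
Hypothesis vD : forall m, \sum_i v m i * f^`M(i) = 0.
Hypothesis v_homog : forall m i, v m i \is (dg m).-homog.
Hypothesis v_gen : forall w : 'I_3 -> P3, \sum_i w i * f^`M(i) = 0 ->
  exists G : 'I_2 -> P3, forall i, w i = \sum_m G m * v m i.

(* The derivation [v m] applied to the equation of the line. *)
Definition vl (m : 'I_2) : P3 := \sum_i (L i)%:MP * v m i.
Let gam : {poly C} := gcdp (lin A B (vl ord0)) (lin A B (vl ord_max)).

Hypotheses (gam0 : gam != 0) (fAB : lin A B f != 0) (ft : (lin A B f).[t] = 0).
Let e := mup t gam.

Lemma vl_homog m : vl m \is (dg m).-homog.
Proof. by apply: rpred_sum => i _; rewrite mul_mpolyC; apply: dhomogZ. Qed.

Lemma gam_dvd m : gam %| lin A B (vl m).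
Proof. by elim/ord2P: m; [apply: dvdp_gcdl | apply: dvdp_gcdr]. Qed.

Lemma vl_order m : rdiv 'X^e (lin Q V (vl m)).
Proof.
apply: rdiv_mup0; have [->|P0] := eqVneq (lin Q V (vl m)) 0; first by left.
have [H0 _ <-] := mobius (vl_homog m) (or_intror P0); right.
by rewrite mup_geq //; apply: dvdp_trans (gam_dvd m); rewrite -mup_geq.
Qed.

Lemma vl_exact : exists m, exists2 w : {poly C}, w.[0] != 0 & lin Q V (vl m) = 'X^e * w.
Proof.
have [m [H0 hm]] : exists m, lin A B (vl m) != 0 /\ mup t (lin A B (vl m)) = e.
  apply: NNPP => nex.
  have dv m : ('X - t%:P) ^+ e.+1 %| lin A B (vl m).
    have [->|H0] := eqVneq (lin A B (vl m)) 0; first exact: dvdp0.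
    rewrite -mup_geq // ltn_neqAle; apply/andP; split.
      by apply/eqP => em; apply: nex; exists m.
    by rewrite mup_geq //; apply: dvdp_trans (gam_dvd m); rewrite -mup_geq.
  have : ('X - t%:P) ^+ e.+1 %| gam by rewrite dvdp_gcd !dv.
  by rewrite -mup_geq // ltnn.
have [_ P0 hP] := mobius (vl_homog m) (or_introl H0).
have [w w0 ew] := mup0_split P0.
by exists m, w => //; rewrite {1}ew -hP hm.
Qed.

(** Logarithmic derivations in the chart come from global ones: removing a multiple of the Euler
    field gives a field killing [f], which after rehomogenization is a combination of the [v m]. The
    value on the equation of the line changes only by a multiple of that equation, so its order
    there is at least that of [gam], with equality for some [v m]. *)
Theorem point_contribution : let g := dehk k f in let g' := dehk k (f * lform L) in
  exists m m' n n',
    [/\ qdim mC (fun=> True) (loc2 p g^`M(ord0) g^`M(ord_max)) m,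
        qdim mC (fun=> True) (loc3 p g g^`M(ord0) g^`M(ord_max)) n,
        qdim mC (fun=> True) (loc2 p g'^`M(ord0) g'^`M(ord_max)) m',
        qdim mC (fun=> True) (loc3 p g' g'^`M(ord0) g'^`M(ord_max)) n' &
        (m' + 1 = m + 2 * mup t (lin A B f))%N /\
        (n' = n + mup t (lin A B f) + e)%N].
Proof.
move=> g; rewrite dehkM dehk_lform -/g mulrC.
have [be hbe] := exists_be.
have [_ fQV ->] := mobius hf (or_introl fAB).
have eg : line_map p lam g = lin Q V f := line_dehk f.
have f0 : f != 0 by apply: contraNneq fAB => ->; rewrite rmorph0.
have gp : g.@[p] = 0.
  rewrite -(at0_psi p lam be) at0E ev0_psi eg.
  have [_ _ hm] := mobius hf (or_introl fAB).
  have : (0 < mup t (lin A B f))%N.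
    by rewrite mup_geq // expr1 dvdp_XsubCl rootE ft.
  rewrite hm; have [u _ {2}->] := mup0_split fQV.
  by case: (mup _ _) => // n _; rewrite hornerM exprS hornerM hornerX !mul0r.
have dC0 : d%:R != 0 :> C by rewrite pnatr_eq0 -lt0n.
have eul : \sum_j 'X_j * g^`M(j) + dehk k f^`M(k) = d%:R *: g := euler_dehk k hf.
have sum3 (R : nmodType) (F : 'I_3 -> R) : \sum_i F i = F k + (F (lift k ord0) + F (lift k ord_max)).
  rewrite (bigD1_ord k) //= big_ord_recl big_ord1.
  by have -> : lift ord0 ord0 = ord_max :> 'I_2 by apply: val_inj.
have sum2 (R : nmodType) (F : 'I_2 -> R) : \sum_i F i = F ord0 + F ord_max.
  rewrite big_ord_recl big_ord1.
  by have -> : lift ord0 ord0 = ord_max :> 'I_2 by apply: val_inj.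
have lin_l : line_map p lam (line_eq p lam) = 0.
  rewrite -(ev0_psi p lam be) (psi_line_eq p hbe); exact: ev0_tau.
have gj j : g^`M(j) = dehk k f^`M(lift k j) := dehk_deriv k j f.
have gQV : line_map p lam g != 0 by rewrite eg.
have nsq a h : a.@[p] = 0 -> g <> a * a * h.
  move=> pa ea; have [c ec] := dehk_square hf f0 ea f_red.
  move: pa gQV; rewrite ea ec mevalC => ->.
  by rewrite mpolyC0 !mul0r rmorph0 eqxx.
have LvlE (r : 'I_3 -> P2) : \sum_i (L i)%:MP * r i =
    (L k)%:MP * r k + ((lam ord0)%:MP * r (lift k ord0) + (lam ord_max)%:MP * r (lift k ord_max)).
  by rewrite sum3.
have line_eqE : (L k)%:MP + ((lam ord0)%:MP * 'X_ord0 + (lam ord_max)%:MP * 'X_ord_max) = line_eq p lam.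
  rewrite -dehk_lform /lform rmorph_sum sum3 -![GRing.RMorphism.sort _ _]/(dehk k _).
  by rewrite !dehkM !dehkC dehkX_k !dehkX_lift mulr1.
have dehk_vl m : dehk k (vl m) = \sum_i (L i)%:MP * dehk k (v m i).
  by rewrite /vl rmorph_sum; apply: eq_bigr => i _; rewrite -[LHS]/(dehk k _) dehkM dehkC.
have H1 a0 a1 c : a0 * g^`M(ord0) + a1 * g^`M(ord_max) = c * g ->
    rdiv 'X^e (line_map p lam ((lam ord0)%:MP * a0 + (lam ord_max)%:MP * a1)).
  move=> eac; pose cd : P2 := (d%:R^-1)%:MP * c.
  pose a (j : 'I_2) := if j == ord0 then a0 else a1.
  (* This subtracts c / d times the Euler field; the coordinate ['X_k] is 1 in the chart, whence the
     last component. *)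
  pose r i : P2 := if unlift k i is Some j then a j - cd * 'X_j else - cd.
  have rk : r k = - cd by rewrite /r unlift_none.
  have r0 : r (lift k ord0) = a0 - cd * 'X_ord0 by rewrite /r liftK.
  have r1 : r (lift k ord_max) = a1 - cd * 'X_ord_max by rewrite /r liftK.
  have rel : \sum_i r i * dehk k f^`M(i) = 0.
    rewrite sum3 rk r0 r1 -(gj ord0) -(gj ord_max); move: eul; rewrite sum2 => eul.
    have cdg : c * g = cd * (d%:R *: g).
      rewrite /cd -[d%:R *: g]mul_mpolyC mulrCA !mulrA -mpolyCM mulfV //.
      by rewrite mpolyC1 mul1r.
    have -> : dehk k f^`M(k) = d%:R *: g - ('X_ord0 * g^`M(ord0) + 'X_ord_max * g^`M(ord_max)).
      by rewrite -eul addrAC subrr add0r.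
    transitivity (a0 * g^`M(ord0) + a1 * g^`M(ord_max) - cd * (d%:R *: g)); first by ring.
    by rewrite eac cdg subrr.
  (* A common degree for the three components makes the lifted relation homogeneous, so it can be
     checked in the chart. *)
  pose N := (\max_i msize (r i))%N.
  have rN i : dehk k (rehom k N (r i)) = r i.
    by apply: rehomK; apply: leqW; apply: (leq_bigmax (F := fun i => msize (r i))).
  have [G hG] : exists G : 'I_2 -> P3, forall i, rehom k N (r i) = \sum_m G m * v m i.
    apply: v_gen; apply: (@dehk_inj _ k (N + d.-1)).
    - by apply: rpred_sum => i _; apply: dhomogM; [apply: rehom_homog | apply: dhomog_mderiv].
    - exact: dhomog0.
    rewrite rmorph0 rmorph_sum -[RHS]rel; apply: eq_bigr => i _.
    rewrite -[LHS]/(dehk k _) dehkM; congr (_ * _); exact: rN.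
  have key : (lam ord0)%:MP * a0 + (lam ord_max)%:MP * a1 =
      \sum_m dehk k (G m) * dehk k (vl m) + cd * line_eq p lam.
    have -> : \sum_m dehk k (G m) * dehk k (vl m) = \sum_i (L i)%:MP * r i.
      under eq_bigr do rewrite dehk_vl mulr_sumr.
      rewrite exchange_big; apply: eq_bigr => i _; rewrite -rN hG rmorph_sum mulr_sumr.
      apply: eq_bigr => m _ /=; rewrite -[mmap _ _ (G m * v m i)]/(dehk k (G m * v m i)) dehkM.
      exact: mulrCA.
    by rewrite LvlE rk r0 r1 -line_eqE; ring.
  rewrite key rmorphD rmorphM -![GRing.RMorphism.sort _ _]/(line_map p lam _) lin_l mulr0 addr0.
  rewrite rmorph_sum sum2 -![GRing.RMorphism.sort _ _]/(line_map p lam _).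
  by rewrite !rmorphM; apply: rdivD; apply: rdiv_mulr; rewrite -[X in rdiv _ X]/(line_map p lam _) line_dehk; apply: vl_order.
have H2 : exists a0 a1 c, a0 * g^`M(ord0) + a1 * g^`M(ord_max) = c * g /\
    exists w : {poly C},
      line_map p lam ((lam ord0)%:MP * a0 + (lam ord_max)%:MP * a1) = 'X^e * w /\ w.[0] != 0.
  have [m [w w0 ew]] := vl_exact.
  (* In the other direction the component at [k] is cleared by a multiple of the Euler field, which
     acts on [g] by Euler's relation. *)
  pose a j := dehk k (v m (lift k j)) - 'X_j * dehk k (v m k).
  exists (a ord0), (a ord_max), (- d%:R%:MP * dehk k (v m k)); split.
    have := congr1 (dehk k) (vD m); rewrite rmorph0 rmorph_sum sum3.
    rewrite -![GRing.RMorphism.sort _ _]/(dehk k _) !dehkM -(gj ord0) -(gj ord_max) => rel.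
    have -> : - d%:R%:MP * dehk k (v m k) * g = - dehk k (v m k) * (d%:R *: g).
      by rewrite -[d%:R *: g]mul_mpolyC; ring.
    rewrite -eul sum2 /a; apply/eqP; rewrite -subr_eq0; apply/eqP; rewrite -[RHS]rel; ring.
  exists w; split=> //; rewrite -ew -line_dehk dehk_vl LvlE.
  have -> : (lam ord0)%:MP * a ord0 + (lam ord_max)%:MP * a ord_max =
      (L k)%:MP * dehk k (v m k) + ((lam ord0)%:MP * dehk k (v m (lift k ord0)) +
      (lam ord_max)%:MP * dehk k (v m (lift k ord_max))) - dehk k (v m k) * line_eq p lam.
    by rewrite -line_eqE /a; ring.
  by rewrite rmorphB rmorphM -![GRing.RMorphism.sort _ _]/(line_map p lam _) lin_l mulr0 subr0.
have [m [n [m' [n' [q1 q2 q3 q4 q5]]]]] := chart_line_addition hbe gp gQV nsq H1 H2.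
by exists m, m', n, n'; rewrite eg in q5; split.
Qed.

End Derivations.
End Point.
End PointOnLine.

(** * Saito's criterion *)

Section Saito.
Variable C : numClosedFieldType.
Notation P3 := {mpoly C[3]}.
Notation W := {poly {poly C}}.
Notation W3 := {poly {poly {poly C}}}.

Definition i0 : 'I_3 := ord0.
Definition i1 : 'I_3 := lift ord0 ord0.
Definition i2 : 'I_3 := lift ord0 (lift ord0 ord0).

Lemma sum3E (R : nmodType) (F : 'I_3 -> R) : \sum_i F i = F i0 + F i1 + F i2.
Proof. by rewrite !big_ord_recl big_ord0 addr0 addrA. Qed.

Lemma ord3P (P : 'I_3 -> Prop) : P i0 -> P i1 -> P i2 -> forall i, P i.
Proof.
move=> h0 h1 h2 [[|[|[|//]]] h].
- by have -> : Ordinal h = i0 by apply: val_inj.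
- by have -> : Ordinal h = i1 by apply: val_inj.
- by have -> : Ordinal h = i2 by apply: val_inj.
Qed.

Definition to_poly3 : {rmorphism P3 -> W3} :=
  mmap ((@polyC W \o @polyC {poly C}) \o @polyC C)
    (fun i => if i == i0 then 'X%:P%:P else if i == i1 then 'X%:P else 'X).

Definition of_poly3 : {rmorphism W3 -> P3} :=
  horner_eval 'X_i2 \o map_poly (horner_eval 'X_i1 \o
    map_poly (horner_eval 'X_i0 \o map_poly (@mpolyC 3 C))).

Lemma to_poly3X i : to_poly3 'X_i =
  if i == i0 then 'X%:P%:P else if i == i1 then 'X%:P else 'X.
Proof. by rewrite /to_poly3 /= mmapX mmap1U. Qed.

Lemma of_poly3C c : of_poly3 c%:P%:P%:P = c%:MP.
Proof. by rewrite /of_poly3 /= map_polyC /= map_polyC /= map_polyC /= !horner_evalE !hornerC. Qed.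

Lemma of_poly3X0 : of_poly3 'X%:P%:P = 'X_i0.
Proof. by rewrite /of_poly3 /= map_polyC /= map_polyC /= map_polyX !horner_evalE !hornerC hornerX. Qed.

Lemma of_poly3X1 : of_poly3 'X%:P = 'X_i1.
Proof. by rewrite /of_poly3 /= map_polyC /= map_polyX !horner_evalE !hornerC hornerX. Qed.

Lemma of_poly3X2 : of_poly3 'X = 'X_i2.
Proof. by rewrite /of_poly3 /= map_polyX !horner_evalE hornerX. Qed.

Lemma to_poly3K : cancel to_poly3 of_poly3.
Proof.
apply: (mpoly_rmorph_eq (f := of_poly3 \o to_poly3) (g := idfun)) => [c|].
  by rewrite -[LHS]/(of_poly3 (to_poly3 _)) [to_poly3 _]mmapC of_poly3C.
apply: ord3P; rewrite -[LHS]/(of_poly3 (to_poly3 _)) to_poly3X /=.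
- exact: of_poly3X0.
- exact: of_poly3X1.
- exact: of_poly3X2.
Qed.

Lemma of_poly3K : cancel of_poly3 to_poly3.
Proof.
elim/poly_ind => [|a c IH]; first by rewrite !rmorph0.
suff hc : to_poly3 (of_poly3 c%:P) = c%:P.
  by rewrite rmorphD rmorphM of_poly3X2 rmorphD rmorphM IH hc to_poly3X.
move: c {a IH}; apply: (poly2_rmorph_eq (f := (to_poly3 \o of_poly3) \o @polyC W) (g := @polyC W)) => [c||].
- by rewrite -[LHS]/(to_poly3 (of_poly3 _)) of_poly3C [LHS]mmapC.
- by rewrite -[LHS]/(to_poly3 (of_poly3 _)) of_poly3X0 to_poly3X.
- by rewrite -[LHS]/(to_poly3 (of_poly3 _)) of_poly3X1 to_poly3X.
Qed.

Lemma ufd_P3 : ufd P3.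
Proof. by apply: (ufd_iso to_poly3K of_poly3K); apply/ufd_poly/ufdW. Qed.

Lemma mpoly_unit_const n (p : {mpoly C[n]}) : p \is a GRing.unit -> exists2 c, c != 0 & p = c%:MP.
Proof.
move=> pu; apply/msize_poly1P.
have p0 : p != 0 by apply: contraTneq pu => ->; rewrite unitr0.
have q0 : p^-1 != 0 by rewrite invr_eq0.
have := msizeM p0 q0; rewrite divrr // msize1.
have : (0 < msize p)%N by rewrite lt0n msize_poly_eq0.
have : (0 < msize p^-1)%N by rewrite lt0n msize_poly_eq0.
by move: (msize p) (msize p^-1) => x y; clear; lia.
Qed.

Lemma mpoly_const_unit n (c : C) : c != 0 -> (c%:MP : {mpoly C[n]}) \is a GRing.unit.
Proof.
move=> c0; apply/unitrPr; exists (c^-1)%:MP.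
by rewrite -mpolyCM mulfV // mpolyC1.
Qed.

Lemma msize_mderiv n (p : {mpoly C[n]}) i : (msize p^`M(i) <= (msize p).-1)%N.
Proof.
rewrite msizeE big_seq; apply: (big_ind (fun x => x <= (msize p).-1)%N) => //.
  by move=> x y hx hy; rewrite geq_max hx.
move=> m; rewrite mcoeff_msupp mcoeff_mderiv => nz.
have : (m + U_(i))%MM \in msupp p.
  by rewrite mcoeff_msupp; apply: contraNneq nz => ->; rewrite mul0rn.
by move/msize_mdeg_lt; rewrite mdegD mdeg1 addn1; case: (msize p).
Qed.

Lemma mderiv_const n (p : {mpoly C[n]}) : (forall i, p^`M(i) = 0) -> p = (p@_0)%:MP.
Proof.
move=> h; apply/mpolyP => m; rewrite mcoeffC.
have [->|m0] := eqVneq m 0%MM; first by rewrite mulr1.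
rewrite mulr0; have [i mi] : exists i, m i != 0%N.
  apply: NNPP => H; move/eqP: m0; apply; apply/mnmP => i; rewrite mnm0E.
  by apply/eqP/negPn/negP => mi; apply: H; exists i.
have := congr1 (fun q => q@_(m - U_(i))) (h i); rewrite mcoeff_mderiv mcoeff0 submK.
  by move/eqP; rewrite mulrn_eq0 /= => /eqP.
by apply/mnm_lepP => j; rewrite mnm1E; case: eqP => // <-; rewrite lt0n.
Qed.

Section Reduced.
Variables (f : P3) (d : nat).
Hypotheses (d0 : (0 < d)%N) (hf : f \is d.-homog) (f0 : f != 0).
Hypothesis f_red : forall G H : P3, f = G * G * H -> (msize G <= 1)%N.

(** By Euler's relation [p] divides [f], and only once since [f] is reduced. Differentiating f = h p
    shows that [p] divides its own partial derivatives; these have smaller degree, so they vanish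
    and [p] is constant. *)
Lemma gradient_no_common_prime p : prime_elt p -> (forall i, rdiv p f^`M(i)) -> False.
Proof.
move=> pp hp; have p0 : p != 0 by case: (pp).
have nc : ~ (exists c, p = c%:MP).
  move=> [c ec]; case: (pp) => _ /negP[]; rewrite ec; apply: mpoly_const_unit.
  by apply: contraNneq p0 => c0; rewrite ec c0 mpolyC0.
have pf : rdiv p f.
  have -> : f = (d%:R^-1)%:MP * \sum_i 'X_i * f^`M(i).
    by rewrite (euler hf) mul_mpolyC scalerA mulVf ?scale1r // pnatr_eq0 -lt0n.
  apply: rdiv_mulr; rewrite sum3E.
  by apply: rdivD; [apply: rdivD|]; apply: rdiv_mulr; apply: hp.
have [h eh] := pf.
have [[h' eh']|nph] := classic (rdiv p h).
  apply: (nc); exists p@_0; apply: msize1_polyC; apply: (@f_red p h').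
  by rewrite eh eh'; ring.
apply: (nc); exists p@_0; apply: mderiv_const => i.
have : rdiv p (h * p^`M(i)).
  have -> : h * p^`M(i) = f^`M(i) - h^`M(i) * p by rewrite eh mderivM; ring.
  by apply: rdivB; [apply: hp | apply: rdiv_mulr; apply: rdiv_refl].
move=> /(prime_mulP pp nph) [c ec]; apply/eqP/negPn/negP => pi0.
have c0 : c != 0 by apply: contraNneq pi0 => c0; rewrite ec c0 mul0r.
have := msize_mderiv p i; rewrite ec msizeM //.
have : (0 < msize p)%N by rewrite lt0n msize_poly_eq0.
have : (0 < msize c)%N by rewrite lt0n msize_poly_eq0.
have : (msize p != 1)%N.
  by apply/negP => /msize_poly1P [c' _ ec']; apply: (nc); exists c'.
by move: (msize p) (msize c) => x y; clear; lia.
Qed.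

Lemma gradient_neq0 : exists i, f^`M(i) != 0.
Proof.
apply: NNPP => H; have h i : f^`M(i) = 0 by apply/eqP/negPn/negP => h; apply: H; exists i.
have := euler hf; rewrite big1 => [|i _]; last by rewrite h mulr0.
by move/esym/eqP; rewrite scaler_eq0 pnatr_eq0 (negbTE f0) orbF gtn_eqF.
Qed.

(** The gradient is primitive, so the primes of [c] can be cancelled against [k] one by one. *)
Lemma gradient_multiple (w : 'I_3 -> P3) (c k : P3) : c != 0 ->
  (forall i, c * w i = k * f^`M(i)) -> rdiv c k.
Proof.
move=> /ufd_P3 [u [s [uu hs ->]]] h.
elim: s k hs h => [|p s IH] k hs h.
  by exists (k * u^-1); rewrite big_nil mulr1 divrK.
have pp : prime_elt p by apply: hs; rewrite mem_head.
have [k' ek] : rdiv p k.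
  apply: NNPP => npk; apply: (gradient_no_common_prime pp) => i.
  apply: (prime_mulP pp npk); rewrite -h big_cons.
  by apply/rdiv_mull/rdiv_mulr/rdiv_mull/rdiv_refl.
have [|i|c' ec'] := IH k' _.
- by move=> q qs; apply: hs; rewrite inE qs orbT.
- have p0 : p != 0 by case: pp.
  apply: (mulfI p0); have := h i; rewrite ek big_cons => e.
  by transitivity (k' * p * f^`M(i)); [rewrite -e | ]; ring.
by exists c'; rewrite ek ec' big_cons; ring.
Qed.

Definition cross (u w : 'I_3 -> P3) (i : 'I_3) : P3 :=
  if i == i0 then u i1 * w i2 - u i2 * w i1
  else if i == i1 then u i2 * w i0 - u i0 * w i2 else u i0 * w i1 - u i1 * w i0.

Variable v : 'I_2 -> 'I_3 -> P3.
Hypothesis vD : forall m, \sum_i v m i * f^`M(i) = 0.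
Hypothesis v_gen : forall w : 'I_3 -> P3, \sum_i w i * f^`M(i) = 0 ->
  exists G : 'I_2 -> P3, forall i, w i = \sum_m G m * v m i.

Lemma cross_span (u w : 'I_3 -> P3) :
  \sum_i u i * f^`M(i) = 0 -> \sum_i w i * f^`M(i) = 0 ->
  exists D, forall i, cross u w i = D * cross (v ord0) (v ord_max) i.
Proof.
move=> /v_gen [G hG] /v_gen [H hH].
have sum2 (F : 'I_2 -> P3) : \sum_i F i = F ord0 + F ord_max.
  rewrite big_ord_recl big_ord1.
  by have -> : lift ord0 ord0 = ord_max :> 'I_2 by apply: val_inj.
exists (G ord0 * H ord_max - G ord_max * H ord0).
by apply: ord3P; rewrite /cross /= !hG !hH !sum2; ring.
Qed.

(** The Koszul derivations have cross products f_j times the gradient, which are multiples D_j of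
    the cross product [w] of the generators. So [w] is parallel to the primitive gradient, say k
    times it, and then f_i = D_i k for every i; a prime of k would divide all partial
    derivatives. *)
Theorem saito : exists2 c, c != 0 &
  forall i, cross (v ord0) (v ord_max) i = c%:MP * f^`M(i).
Proof.
pose w := cross (v ord0) (v ord_max).
have [fx efx] : exists fx : 'I_3 -> P3, forall i, fx i = f^`M(i) by exists (fun i => f^`M(i)).
have koszul j : exists D, forall i, fx j * fx i = D * w i.
  pose kz (a b : 'I_3) i := if i == a then fx b else if i == b then - fx a else 0.
  have kzD a b : a != b -> \sum_i kz a b i * f^`M(i) = 0.
    move=> ab; rewrite (bigD1 a) //= (bigD1 b) ?(eq_sym b) //= big1 ?addr0.
      by rewrite /kz !eqxx eq_sym (negbTE ab) -!efx; ring.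
    by move=> i /andP[/negbTE ia /negbTE ib]; rewrite /kz ia ib mul0r.
  elim/ord3P: j.
  - have [D hD] := cross_span (kzD i0 i1 isT) (kzD i0 i2 isT).
    by exists D => i; apply: etrans (hD i); elim/ord3P: i {hD}; rewrite /cross /kz /=; ring.
  - have [D hD] := cross_span (kzD i0 i1 isT) (kzD i1 i2 isT).
    by exists D => i; apply: etrans (hD i); elim/ord3P: i {hD}; rewrite /cross /kz /=; ring.
  - have [D hD] := cross_span (kzD i0 i2 isT) (kzD i1 i2 isT).
    by exists D => i; apply: etrans (hD i); elim/ord3P: i {hD}; rewrite /cross /kz /=; ring.
have [j fj0] := gradient_neq0.
have wf i : f^`M(j) * w i = w j * f^`M(i).
  have [D hD] := koszul j; have D0 : D != 0.
    by apply: contraNneq fj0 => D0; have := hD j; rewrite D0 mul0r -!efx => /eqP; rewrite mulf_eq0 orbb.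
  apply: (mulfI D0); transitivity (f^`M(j) * (D * w i)); first by ring.
  transitivity (D * w j * f^`M(i)); last by rewrite mulrA.
  by rewrite -(hD i) -(hD j) -!efx; ring.
have [k ek] := gradient_multiple fj0 wf.
have wk i : w i = k * f^`M(i).
  by apply: (mulfI fj0); rewrite wf ek mulrA [_ * k]mulrC.
have k_unit : k \is a GRing.unit.
  apply/negPn/negP => nu; have k0 : k != 0.
    apply/eqP => k0; have [D hD] := koszul j; have := hD j.
    by rewrite wk k0 mul0r mulr0 efx => /eqP; rewrite mulf_eq0 orbb (negbTE fj0).
  have [p pp [k' ek']] := ufd_exists_prime ufd_P3 k0 nu.
  apply: (gradient_no_common_prime pp) => i.
  have [D hD] := koszul i; exists (D * k').
  by apply: (mulIf fj0); move: (hD j); rewrite wk !efx ek' => ->; ring.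
have [c c0 ec] := mpoly_unit_const k_unit.
by exists c => // i; rewrite -ec; apply: wk.
Qed.

End Reduced.
End Saito.

(** * Restriction to a line *)

Section Homogeneous.
Variables (C : numClosedFieldType) (n : nat).
Notation P := {mpoly C[n]}.
Notation hc k := (pihomog mdeg k).

Lemma pihomog_sum (p : P) N : (msize p <= N)%N -> p = \sum_(k < N) hc k p.
Proof. exact: pihomog_partitionE. Qed.

Lemma pihomogM (p q : P) e k : q \is e.-homog ->
  hc k (p * q) = if (e <= k)%N then hc (k - e) p * q else 0.
Proof.
move=> hq; rewrite [p in LHS](pihomog_sum (leqnn _)) mulr_suml raddf_sum /=.
have comp (i : nat) : hc k (hc i p * q) = if (k == i + e)%N then hc i p * q else 0.
  have h := dhomogM (pihomogP mdeg i p) hq.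
  by case: eqP => [->|/eqP ne]; [apply: pihomog_dE | apply: pihomog_ne0 h; rewrite eq_sym].
under eq_bigr do rewrite comp.
case: leqP => [ek|ke]; last first.
  by rewrite big1 // => i _; case: eqP => // ek; move: ke; rewrite ek ltnNge leq_addl.
have [lt|ge] := ltnP (k - e) (msize p).
  rewrite (bigD1 (Ordinal lt)) //= subnK // eqxx big1 ?addr0 // => i ne.
  by case: eqP => // ei; move/eqP: ne; case; apply: val_inj; rewrite /= ei addnK.
rewrite big1 => [|i _]; last first.
  by case: eqP => // ei; move: (leq_trans (ltn_ord i) ge); rewrite ei addnK ltnn.
rewrite [hc _ p](_ : _ = 0) ?mul0r // pihomogE big_seq_cond big1 // => m /andP[ms /eqP mk].
by move: (leq_trans (msize_mdeg_lt ms) ge); rewrite mk ltnn.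
Qed.

(** The second clause covers [k < e], where the truncated difference is 0 and the first clause alone
    would allow a nonzero constant. *)
Lemma homog_factor (q c : P) e k : q != 0 -> q \is e.-homog -> q * c \is k.-homog ->
  c \is (k - e).-homog /\ ((k < e)%N -> c = 0).
Proof.
move=> q0 hq hqc.
have z j : (k != j + e)%N -> hc j c = 0.
  move=> ne; apply: (mulIf q0); rewrite mul0r.
  have := pihomogM c (j + e) hq; rewrite leq_addl addnK => <-.
  by rewrite mulrC; apply: pihomog_ne0 hqc; rewrite ?mulrC.
split=> [|ke]; rewrite (pihomog_sum (leqnn (msize c))).
  apply: rpred_sum => i _; have [ek|ne] := eqVneq k (i + e)%N.
    by rewrite ek addnK; apply: pihomogP.
  by rewrite z // dhomog0.
rewrite big1 // => i _; apply: z; apply: contraTneq ke => ->.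
by rewrite -leqNgt leq_addl.
Qed.

Lemma dhomog0_const (p : P) : p \is 0.-homog -> p = (p@_0)%:MP.
Proof.
move=> /dhomogP hp; apply/mpolyP => m; rewrite mcoeffC.
have [->|m0] := eqVneq m 0%MM; first by rewrite mulr1.
rewrite mulr0; apply/eqP; rewrite mcoeff_eq0; apply/negP => /hp /= /eqP.
by rewrite mdeg_eq0 (negbTE m0).
Qed.

Lemma unit_homog (p : P) k : p \is k.-homog -> p \is a GRing.unit -> k = 0%N.
Proof.
move=> hp /mpoly_unit_const [c c0 e]; apply: (dhomog_uniq _ hp).
  by rewrite e mpolyC_eq0.
by rewrite e -mul_mpolyC mulr1 || (rewrite e -[c%:MP]mulr1 mul_mpolyC; apply: dhomogZ; apply: dhomog1).
Qed.

End Homogeneous.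

(** * Coordinates on a line in the plane *)

Section Frame.
Variable C : numClosedFieldType.
Notation P3 := {mpoly C[3]}.

Lemma lform_homog (L : 'I_3 -> C) : lform L \is 1.-homog.
Proof.
apply: rpred_sum => i _; rewrite mul_mpolyC; apply: dhomogZ.
by rewrite dhomogX /= mdeg1.
Qed.

Lemma lform_coef (L : 'I_3 -> C) i : (lform L)^`M(i) = (L i)%:MP.
Proof.
rewrite /lform raddf_sum (bigD1 i) //= big1 ?addr0 => [|j ne].
  rewrite mderivM mderivC mul0r add0r mderivX mnmE eqxx.
  have -> : (U_(i) - U_(i) = 0 :> 'X_{1..3})%MM by apply/mnmP => j; rewrite !mnmE subnn.
  by rewrite scale1r mpolyX0 mulr1.
by rewrite mderivM mderivC mul0r add0r mderivX mnmE (negbTE ne) scale0r mulr0.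
Qed.

Lemma lform_of (l : P3) : l \is 1.-homog -> l = lform (fun i => (l^`M(i))@_0).
Proof.
move=> hl; rewrite -[LHS]scale1r -(euler hl) /lform; apply: eq_bigr => i _.
by rewrite mulrC {1}[l^`M(i)](dhomog0_const (dhomog_mderiv i hl)).
Qed.

Lemma lform_neq0 (L : 'I_3 -> C) : (exists i, L i != 0) -> lform L != 0.
Proof.
move=> [i Li]; apply: contraNneq Li => l0.
by have := lform_coef L i; rewrite l0 mderiv0 => /esym/eqP; rewrite mpolyC_eq0.
Qed.

(* [A] and [B] span the line [lform L = 0]; [S] and [T] are linear forms whose
   restrictions to the line are the coordinates with respect to [A] and [B]. *)
Record frame (L A B N : 'I_3 -> C) (S T : P3) : Prop := Frame {
  frameA : \sum_i L i * A i = 0;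
  frameB : \sum_i L i * B i = 0;
  frameX : forall i, 'X_i = (A i)%:MP * S + (B i)%:MP * T + (N i)%:MP * lform L;
  frameS : lin A B S = 1;
  frameT : lin A B T = 'X;
  frame_homS : S \is 1.-homog;
  frame_homT : T \is 1.-homog }.

Section Line.
Variables (L A B N : 'I_3 -> C) (S T : P3).
Hypothesis fr : frame L A B N S T.
Hypothesis L0 : exists i, L i != 0.
Notation l := (lform L).

(** Reduction modulo [l] to polynomials in [S] and [T]. Its kernel is the ideal of [l], so [l] is
    prime. *)
Definition rho : {rmorphism P3 -> P3} :=
  mmap (@mpolyC 3 C) (fun i => (A i)%:MP * S + (B i)%:MP * T).

Lemma rhoX i : rho 'X_i = (A i)%:MP * S + (B i)%:MP * T.
Proof. by rewrite /rho /= mmapX mmap1U. Qed.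

Lemma rho_l : rho l = 0.
Proof.
rewrite /lform raddf_sum (eq_bigr (fun i => (L i * A i)%:MP * S + (L i * B i)%:MP * T)).
  by rewrite big_split -!mulr_suml -!raddf_sum (frameA fr) (frameB fr) /= mpolyC0 !mul0r addr0.
move=> i _; rewrite -[LHS]/(rho _) rmorphM [rho (L i)%:MP]mmapC.
by rewrite -[X in _ * X]/(rho _) rhoX !mpolyCM; ring.
Qed.

Lemma rho_mod a : rdiv l (a - rho a).
Proof.
move: a; apply: (mpoly_ring_ind (P := fun a => rdiv l (a - rho a))) => [c|i|a b ha hb|a b ha hb].
- by rewrite [rho _]mmapC subrr; apply: rdiv0.
- exists (N i)%:MP; rewrite rhoX [in LHS](frameX fr i); ring.
- have -> : a + b - rho (a + b) = (a - rho a) + (b - rho b) by rewrite rmorphD; ring.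
  exact: rdivD.
have -> : a * b - rho (a * b) = (a - rho a) * b + rho a * (b - rho b) by rewrite rmorphM; ring.
by apply: rdivD; [apply: rdiv_mull | apply: rdiv_mulr].
Qed.

Lemma rho_eq0 a : rho a = 0 <-> rdiv l a.
Proof.
split=> [h|[c ->]]; last by rewrite rmorphM rho_l mulr0.
by have := rho_mod a; rewrite h subr0.
Qed.

Lemma lform_primeP a b : ~ rdiv l a -> rdiv l (a * b) -> rdiv l b.
Proof.
rewrite -!rho_eq0 rmorphM => na /eqP; rewrite mulf_eq0 => /orP[] /eqP //.
Qed.

Definition line_lift (k : nat) (p : {poly C}) : P3 := hlift (@mpolyC 3 C) S T k p.

Lemma line_lift_homog k p : line_lift k p \is k.-homog.
Proof.
apply: rpred_sum => j _; rewrite -mulrA mul_mpolyC; apply: dhomogZ.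
have jk : (j <= k)%N by rewrite -ltnS.
rewrite -[X in X.-homog](subnKC jk).
have := dhomogMn j (frame_homT fr); have := dhomogMn (k - j) (frame_homS fr).
by rewrite !mul1n => h1 h2; apply: dhomogM.
Qed.

Lemma lin_line_lift k (p : {poly C}) : (size p <= k.+1)%N -> lin A B (line_lift k p) = p.
Proof.
move=> sp; rewrite /line_lift /hlift raddf_sum.
rewrite (eq_bigr (fun j : 'I_k.+1 => p`_j *: 'X^j)) => [|j _].
  rewrite -(poly_def k.+1 (fun j : nat => p`_j)); apply/polyP => i; rewrite coef_poly.
  by case: ltnP => // ik; rewrite nth_default // (leq_trans sp).
rewrite -[LHS]/(lin A B _) !linM !rmorphXn -![GRing.RMorphism.sort _ _]/(lin A B _).
by rewrite (frameS fr) (frameT fr) expr1n mulr1 linC mul_polyC.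
Qed.

Lemma rho_lift k a : a \is k.-homog -> rho a = line_lift k (lin A B a).
Proof. by move=> ha; have [_ h] := dhomog_lin A B ha; apply: h. Qed.

Lemma lin_rho a : lin A B (rho a) = lin A B a.
Proof.
move: a; apply: (mpoly_rmorph_eq (f := lin A B \o rho) (g := lin A B)) => [c|i].
  by rewrite -[LHS]/(lin A B (rho _)) [rho _]mmapC.
rewrite -[LHS]/(lin A B (rho _)) rhoX linD !linM !linC (frameS fr) (frameT fr) linX.
by rewrite mulr1.
Qed.

Lemma rdiv_lin_eq0 k a : a \is k.-homog -> (lin A B a = 0 <-> rdiv l a).
Proof.
move=> ha; rewrite -rho_eq0; split=> [h|h]; last by rewrite -lin_rho h rmorph0.
by rewrite (rho_lift ha) h /line_lift /hlift big1 // => j _; rewrite coef0 rmorph0 !mul0r.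
Qed.

Lemma lin_size k a : a \is k.-homog -> (size (lin A B a) <= k.+1)%N.
Proof. by move=> ha; have [] := dhomog_lin A B ha. Qed.

(** [B] is the point at infinity of the parameter on the line; a nonzero value there means that no
    degree is lost by restriction. *)
Lemma lin_top k a : a \is k.-homog -> (lin A B a)`_k = a.@[B].
Proof.
move=> ha; have [_ h] := dhomog_lin A B ha.
have := h C idfun 0 1; rewrite /hlift (bigD1 ord_max) //= big1 => [|j jk]; last first.
  have : (0 < k - j)%N by rewrite subn_gt0 ltn_neqAle -ltnS ltn_ord andbT; apply: contraNneq jk => e; apply/eqP/val_inj.
  by case: (k - j)%N => // x _; rewrite exprS mul0r mulr0.
rewrite subnn expr1n !mulr1 addr0 => <-.
move: a {ha h}; apply: (mpoly_rmorph_eq (f := mmap _ _) (g := meval B)) => [c|i].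
  by rewrite [LHS]mmapC [RHS]mevalC.
by rewrite [LHS]mmapX mmap1U [RHS]mevalXU mulr0 add0r mulr1.
Qed.

Lemma lin_horner a t : (lin A B a).[t] = a.@[fun i => A i + t * B i].
Proof.
move: a; apply: (mpoly_rmorph_eq (f := horner_eval t \o lin A B) (g := meval _)) => [c|i].
  by rewrite -[LHS]/((lin A B _).[t]) linC hornerC [RHS]mevalC.
by rewrite -[LHS]/((lin A B _).[t]) linX [RHS]mevalXU !hornerE mulrC.
Qed.

Lemma frame_indep x y : (forall i, x * A i + y * B i = 0) -> x = 0 /\ y = 0.
Proof.
move=> h; have e F : F \is 1.-homog ->
    hlift idfun x y 1 (lin A B F) = hlift idfun 0 0 1 (lin A B F).
  move=> hF; have [_ e] := dhomog_lin A B hF; rewrite -!(e C).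
  move: F {hF e}; apply: (mpoly_rmorph_eq (f := mmap _ _) (g := mmap _ _)) => [c|i].
    by rewrite [LHS]mmapC [RHS]mmapC.
  rewrite [LHS]mmapX [RHS]mmapX !mmap1U !mulr0 addr0 -[RHS](h i) /=.
  by rewrite [_ * x]mulrC [_ * y]mulrC.
have := e _ (frame_homS fr); have := e _ (frame_homT fr).
rewrite (frameS fr) (frameT fr) /hlift !big_ord_recr !big_ord0 /= !coefX !coef1 /=.
by rewrite !(mul0r, mul1r, mulr0, mulr1, add0r, addr0, expr0, expr1) => -> ->.
Qed.

End Line.

Section ExistsFrame.
Variables (L : 'I_3 -> C) (k : 'I_3).
Hypothesis Lk : L k != 0.
Let j0 : 'I_3 := lift k ord0.
Let j1 : 'I_3 := lift k ord_max.

Lemma sum_lift3 (R : nmodType) (F : 'I_3 -> R) : \sum_i F i = F k + (F j0 + F j1).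
Proof.
rewrite (bigD1_ord k) //=; congr (_ + _); rewrite big_ord_recl big_ord1.
by congr (_ + F (lift k _)); apply: val_inj.
Qed.

Definition line_pt (a b : C) (i : 'I_3) : C :=
  if unlift k i is Some j then (if j == ord0 then a else b)
  else - (L j0 * a + L j1 * b) / L k.

Lemma line_pt_k a b : line_pt a b k = - (L j0 * a + L j1 * b) / L k.
Proof. by rewrite /line_pt unlift_none. Qed.

Lemma line_pt_0 a b : line_pt a b j0 = a.
Proof. by rewrite /line_pt /j0 liftK. Qed.

Lemma line_pt_1 a b : line_pt a b j1 = b.
Proof. by rewrite /line_pt /j1 liftK. Qed.

Lemma lin_line_pt a b a' b' x y : 
  lin (line_pt a b) (line_pt a' b') (x%:MP * 'X_j0 + y%:MP * 'X_j1) =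
  (x * a + y * b)%:P + (x * a' + y * b')%:P * 'X.
Proof.
rewrite linD !linM !linC !linX !line_pt_0 !line_pt_1 !polyCD !polyCM; ring.
Qed.

Lemma frame_line_pt a b a' b' : a * b' - a' * b = 1 ->
  frame L (line_pt a b) (line_pt a' b') (fun i => if i == k then (L k)^-1 else 0)
    (b'%:MP * 'X_j0 + (- a')%:MP * 'X_j1) ((- b)%:MP * 'X_j0 + a%:MP * 'X_j1).
Proof.
move=> det; have Lpt x y : \sum_i L i * line_pt x y i = 0.
  by rewrite sum_lift3 line_pt_k line_pt_0 line_pt_1 mulrC divfK // addNr.
have hom x y : x%:MP * 'X_j0 + y%:MP * 'X_j1 \is [in C[3], 1.-homog].
  by apply: dhomogD; rewrite mul_mpolyC; apply: dhomogZ; rewrite dhomogX /= mdeg1.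
have det' : (a%:MP * b'%:MP - a'%:MP * b%:MP : P3) = 1.
  by rewrite -!mpolyCM -mpolyCB det mpolyC1.
split=> //.
- move=> i; case: (unliftP k i) => [j ->|->].
    rewrite eq_sym (negbTE (neq_lift _ _)) mul0r addr0 !mpolyCN.
    elim/ord2P: j; rewrite -?/j0 -?/j1 ?line_pt_0 ?line_pt_1.
      by rewrite -[LHS]mul1r -det'; ring.
    by rewrite -[LHS]mul1r -det'; ring.
  rewrite eqxx !line_pt_k /lform sum_lift3.
  have Lk1 : ((L k)^-1%:MP * (L k)%:MP = 1 :> P3) by rewrite -mpolyCM mulVf // mpolyC1.
  rewrite -[LHS]mul1r -{1}Lk1 !mpolyCM !mpolyCN !mpolyCD !mpolyCM.
  transitivity ((L k)^-1%:MP * ((L k)%:MP * 'X_k) +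
    ((L k)^-1%:MP * ((L j0)%:MP * 'X_j0 + (L j1)%:MP * 'X_j1)) * (1 - (a%:MP * b'%:MP - a'%:MP * b%:MP)) : P3).
    by rewrite det' subrr mulr0 addr0 mulrA.
  ring.
- have e1 : b' * a + - a' * b = 1 by rewrite -det; ring.
  have e0 : b' * a' + - a' * b' = 0 by ring.
  by rewrite lin_line_pt e1 e0 mul0r addr0.
- have e1 : - b * a' + a * b' = 1 by rewrite -det; ring.
  have e0 : - b * a + a * b = 0 by ring.
  by rewrite lin_line_pt e1 e0 mul1r add0r.
Qed.

End ExistsFrame.

(** [B] is taken off the curve so that every intersection point has a finite parameter; a suitable
    point exists because [f] restricted to the line is a nonzero polynomial. *)
Lemma exists_frame L (f : P3) d : (exists i, L i != 0) -> f \is d.-homog ->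
  ~ rdiv (lform L) f -> exists A B N S T, frame L A B N S T /\ f.@[B] != 0.
Proof.
move=> [k Lk] hf nf.
have fr0 := frame_line_pt Lk (_ : 1 * 1 - 0 * 0 = 1).
have {}fr0 := fr0 (ltac:(by rewrite mulr1 mul0r subr0)).
have : lin (line_pt L k 1 0) (line_pt L k 0 1) f != 0.
  by apply/eqP => /(rdiv_lin_eq0 fr0 hf).
move=> /closed_nonrootP [t]; rewrite rootE lin_horner => ft.
exists (line_pt L k 0 (-1)), (line_pt L k 1 t); do 3 eexists; split.
  by apply: (frame_line_pt Lk (a := 0) (b := -1) (a' := 1) (b' := t)); rewrite mul0r mulrN1 opprK add0r.
apply: contraNneq ft => e; rewrite -[X in _ == X]e; apply/eqP; move: f {hf nf e}.
apply: (mpoly_rmorph_eq (f := meval _) (g := meval _)) => [c|i].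
  by rewrite [LHS]mevalC [RHS]mevalC.
rewrite [LHS]mevalXU [RHS]mevalXU /line_pt; case: unlift => [j|].
  by case: ifP => _; rewrite ?mulr0 ?mulr1 ?addr0 ?add0r.
by rewrite !(mulr0, mulr1, add0r, addr0); field.
Qed.

End Frame.

(** * Minimal generators and their degrees *)

Section Generators.
Variable C : numClosedFieldType.
Notation P3 := {mpoly C[3]}.
Notation hc k := (pihomog mdeg k).

Definition span_of m (v : 'I_m -> 'I_3 -> P3) (P : pred 'I_m) (w : 'I_3 -> P3) :=
  exists g : 'I_m -> P3, forall j, w j = \sum_(i < m | P i) g i * v i j.

(** The notion [min_hom_gens] over an arbitrary field, convertible to it over the complex
    numbers. *)
Definition hgens (F : P3) m (v : 'I_m -> 'I_3 -> P3) (dg : 'I_m -> nat) :=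
  [/\ forall i, \sum_(j < 3) v i j * F^`M(j) = 0,
      forall i, (exists j, v i j != 0) /\ (forall j, v i j \is (dg i).-homog),
      forall w : 'I_3 -> P3, \sum_(j < 3) w j * F^`M(j) = 0 -> span_of v predT w
    & forall i, ~ span_of v (fun i' => i' != i) (v i)].

Let ev : {rmorphism P3 -> C} := meval (fun=> 0).

Lemma homog_ev_const (p : P3) k : p \is k.-homog -> ev p != 0 -> p = (ev p)%:MP.
Proof.
move=> hp p0; suff k0 : k = 0%N.
  by move: hp; rewrite k0 => /dhomog0_const ->; rewrite /ev /= mevalC.
apply/eqP; rewrite -(pnatr_eq0 C); apply/negPn/negP => k0.
have := congr1 ev (euler hp); rewrite raddf_sum big1 => [|i _].
  by move/esym/eqP; rewrite -mul_mpolyC rmorphM [ev _%:MP]mevalC mulf_eq0 (negbTE k0) (negbTE p0).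
by rewrite -[LHS]/(ev _) rmorphM [ev 'X_i]mevalXU mul0r.
Qed.

Lemma homog_coefs m (v : 'I_m -> 'I_3 -> P3) dg (w : 'I_3 -> P3) k :
  (forall i j, v i j \is (dg i).-homog) -> (forall j, w j \is k.-homog) ->
  span_of v predT w -> exists g : 'I_m -> P3,
    (forall i, g i \is (k - dg i).-homog /\ ((k < dg i)%N -> g i = 0)) /\
    forall j, w j = \sum_i g i * v i j.
Proof.
move=> hv hw [g hg]; exists (fun i => if (dg i <= k)%N then hc (k - dg i)%N (g i) else 0); split.
  move=> i; case: leqP => h; split=> //; first exact: pihomogP.
  exact: dhomog0.
move=> j; rewrite -(pihomog_dE (hw j)) hg raddf_sum; apply: eq_bigr => i _ /=.
by rewrite (pihomogM _ _ (hv i j)); case: ifP => // _; rewrite mul0r.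
Qed.

Lemma minimal_no_unit_relation m (v : 'I_m -> 'I_3 -> P3) i (r : 'I_m -> P3) c :
  ~ span_of v (fun i' => i' != i) (v i) -> (forall j, \sum_k r k * v k j = 0) ->
  c != 0 -> r i = c%:MP -> False.
Proof.
move=> nsp hr c0 ri; apply: nsp; exists (fun k => - (c^-1)%:MP * r k) => j.
have := hr j; rewrite (bigD1 i) //= ri => /eqP; rewrite addr_eq0 => /eqP e.
under eq_bigr do rewrite -mulrA; rewrite -mulr_sumr mulNr -mulrN -e mulrA -mpolyCM.
by rewrite mulVf // mpolyC1 mul1r.
Qed.

(** Graded Nakayama: the product of the transition matrices differs from the identity by relations
    with homogeneous coefficients, and a nonzero constant coefficient would make a generator
    redundant. *)
Lemma transition_inverse m m' (v : 'I_m -> 'I_3 -> P3) dg (v' : 'I_m' -> 'I_3 -> P3) dg'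
    (g : 'I_m' -> 'I_m -> P3) (h : 'I_m -> 'I_m' -> P3) :
  (forall i, ~ span_of v (fun i' => i' != i) (v i)) ->
  (forall j i, g j i \is (dg' j - dg i).-homog /\ ((dg' j < dg i)%N -> g j i = 0)) ->
  (forall j x, v' j x = \sum_i g j i * v i x) ->
  (forall i j, h i j \is (dg i - dg' j).-homog /\ ((dg i < dg' j)%N -> h i j = 0)) ->
  (forall i x, v i x = \sum_j h i j * v' j x) ->
  (\matrix_(i < m, j < m') ev (h i j)) *m (\matrix_(j < m', i < m) ev (g j i)) = 1%:M.
Proof.
move=> vmin gh hg hh hv; apply/matrixP => i k; rewrite !mxE.
pose r (k' : 'I_m) : P3 := \sum_j h i j * g j k' - (i == k')%:R.
have rel x : \sum_k' r k' * v k' x = 0.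
  under eq_bigr do rewrite mulrBl mulr_suml; rewrite sumrB exchange_big /=.
  rewrite (bigD1 i) //= eqxx mul1r [X in _ - (_ + X)]big1 => [|k' /negbTE nk]; last first.
    by rewrite eq_sym nk mul0r.
  rewrite addr0 (hv i x); apply/eqP; rewrite subr_eq0; apply/eqP.
  by apply: eq_bigr => j _; rewrite hg mulr_sumr; apply: eq_bigr => k' _; rewrite mulrA.
have rh : r k \is (dg i - dg k).-homog.
  rewrite /r; apply: rpredB; last first.
    by case: eqP => [<-|_]; rewrite ?subnn ?dhomog1 ?dhomog0.
  apply: rpred_sum => j _; have [h1 h2] := hh i j; have [g1 g2] := gh j k.
  have [lt|le1] := ltnP (dg i) (dg' j); first by rewrite h2 // mul0r dhomog0.
  have [lt|le2] := ltnP (dg' j) (dg k); first by rewrite g2 // mulr0 dhomog0.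
  have -> : (dg i - dg k = (dg i - dg' j) + (dg' j - dg k))%N by move: le1 le2; clear; lia.
  exact: dhomogM.
have evr : ev (r k) = \sum_j ev (h i j) * ev (g j k) - (i == k)%:R.
  by rewrite /r rmorphB rmorph_sum rmorph_nat; congr (_ - _); apply: eq_bigr => j _; rewrite rmorphM.
under eq_bigr do rewrite !mxE.
apply/eqP; rewrite -subr_eq0 -evr; apply/negPn/negP => r0.
exact: minimal_no_unit_relation (vmin k) rel r0 (homog_ev_const rh r0).
Qed.

Lemma det_neq0_perm n (M : 'M[C]_n) : \det M != 0 -> exists s : 'S_n, forall i, M i (s i) != 0.
Proof.
move=> d0; apply: NNPP => ns; move/eqP: d0; apply; rewrite /determinant big1 // => s _.
apply/eqP; rewrite mulf_eq0; apply/orP; right; apply/negPn/negP => /prodf_neq0 h.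
by apply: ns; exists s => i; apply: h.
Qed.

(** The matrices of constant terms are inverse to each other, so the families have equal size. A
    nonzero determinant has a nonzero term, that is a matching of the generators through nonzero
    constants, and these force equal degrees. *)
Theorem hgens_degrees F m (v : 'I_m -> 'I_3 -> P3) dg m' (v' : 'I_m' -> 'I_3 -> P3) dg' :
  hgens F v dg -> hgens F v' dg' ->
  perm_eq [seq dg i | i <- enum 'I_m] [seq dg' i | i <- enum 'I_m'].
Proof.
move=> [D hom gen vmin] [D' hom' gen' vmin'].
have hv i j : v i j \is (dg i).-homog by have [] := hom i.
have hv' i j : v' i j \is (dg' i).-homog by have [] := hom' i.
have /choice [g hg] := fun j => homog_coefs hv (hv' j) (gen _ (D' j)).
have /choice [h hh] := fun i => homog_coefs hv' (hv i) (gen' _ (D i)).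
have g1 j i : g j i \is (dg' j - dg i).-homog /\ ((dg' j < dg i)%N -> g j i = 0).
  by case: (hg j) => a _; apply: a.
have h1 i j : h i j \is (dg i - dg' j).-homog /\ ((dg i < dg' j)%N -> h i j = 0).
  by case: (hh i) => a _; apply: a.
have g2 j x : v' j x = \sum_i g j i * v i x by case: (hg j).
have h2 i x : v i x = \sum_j h i j * v' j x by case: (hh i).
have e1 := transition_inverse vmin g1 g2 h1 h2.
have e2 := transition_inverse vmin' h1 h2 g1 g2.
have mm : m = m' by apply/eqP; rewrite eqn_leq (mulmx1_min e1) (mulmx1_min e2).
subst m'; have : \det (\matrix_(j < m, i < m) ev (g j i)) != 0.
  by apply/eqP => d0; move: (congr1 determinant e1); rewrite det_mulmx d0 mulr0 det1 => /esym/eqP; rewrite oner_eq0.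
move=> /det_neq0_perm [s hs].
have ds j : dg' j = dg (s j).
  have := hs j; rewrite mxE => nz; have [gh gz] := g1 j (s j).
  have le : (dg (s j) <= dg' j)%N.
    by rewrite leqNgt; apply: contra nz => /gz ->; rewrite rmorph0.
  have gj0 : g j (s j) != 0 by apply: contraNneq nz => ->; rewrite rmorph0.
  have gc := homog_ev_const gh nz.
  have := dhomog_uniq gj0 gh; rewrite gc => /(_ 0%N) h0.
  have : (dg' j - dg (s j) = 0)%N.
    by apply: h0; rewrite -[_%:MP]mulr1 mul_mpolyC; apply: dhomogZ; apply: dhomog1.
  by move: le; clear; lia.
rewrite (eq_map ds) (map_comp dg s) perm_sym; apply: perm_map.
apply: uniq_perm; [|exact: enum_uniq|].
  by rewrite (map_inj_uniq (@perm_inj _ s)) enum_uniq.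
by move=> i; rewrite -(permKV s i) (mem_map (@perm_inj _ s)) !mem_enum.
Qed.

Definition has_gens F (ds : seq nat) :=
  exists v : 'I_(size ds) -> 'I_3 -> P3, hgens F v (fun i => nth 0%N ds i).

Lemma span_nonzero m (v : 'I_m -> 'I_3 -> P3) i :
  ~ span_of v (fun i' => i' != i) (v i) -> exists j, v i j != 0.
Proof.
move=> ns; apply: NNPP => nex; apply: ns; exists (fun=> 0) => j.
rewrite big1 => [|k _]; last by rewrite mul0r.
by apply/eqP/negPn/negP => h; apply: nex; exists j.
Qed.

Lemma has_gens2 F (u0 u1 : 'I_3 -> P3) n0 n1 :
  \sum_j u0 j * F^`M(j) = 0 -> \sum_j u1 j * F^`M(j) = 0 ->
  (forall j, u0 j \is n0.-homog) -> (forall j, u1 j \is n1.-homog) ->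
  (forall w : 'I_3 -> P3, \sum_j w j * F^`M(j) = 0 ->
     exists a b, forall j, w j = a * u0 j + b * u1 j) ->
  (forall a, ~ forall j, u0 j = a * u1 j) -> (forall a, ~ forall j, u1 j = a * u0 j) ->
  has_gens F [:: n0; n1].
Proof.
move=> D0 D1 h0 h1 gen m0 m1.
pose v (i : 'I_2) := if i == ord0 then u0 else u1.
have vmin i : ~ span_of v (fun i' => i' != i) (v i).
  move=> [g hg]; move: hg; elim/ord2P: i => hg.
    apply: (m0 (g ord_max)) => j; rewrite -[LHS]/(v ord0 j) hg big_mkcond big_ord_recl big_ord1 /=.
    by rewrite add0r; congr (g _ * _); apply: val_inj.
  apply: (m1 (g ord0)) => j; rewrite -[LHS]/(v ord_max j) hg big_mkcond big_ord_recl big_ord1 /=.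
  by rewrite addr0.
exists v; split=> //.
- by apply: ord2P.
- by move=> i; split; [apply: span_nonzero (vmin i) | elim/ord2P: i].
- move=> w /gen [a [b hw]]; exists (fun i => if i == ord0 then a else b) => j.
  by rewrite big_ord_recl big_ord1 /= hw.
Qed.

Lemma has_gens3 F (u0 u1 u2 : 'I_3 -> P3) n0 n1 n2 :
  \sum_j u0 j * F^`M(j) = 0 -> \sum_j u1 j * F^`M(j) = 0 -> \sum_j u2 j * F^`M(j) = 0 ->
  (forall j, u0 j \is n0.-homog) -> (forall j, u1 j \is n1.-homog) ->
  (forall j, u2 j \is n2.-homog) ->
  (forall w : 'I_3 -> P3, \sum_j w j * F^`M(j) = 0 ->
     exists a b c, forall j, w j = a * u0 j + b * u1 j + c * u2 j) ->
  (forall b c, ~ forall j, u0 j = b * u1 j + c * u2 j) ->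
  (forall a c, ~ forall j, u1 j = a * u0 j + c * u2 j) ->
  (forall a b, ~ forall j, u2 j = a * u0 j + b * u1 j) ->
  has_gens F [:: n0; n1; n2].
Proof.
move=> D0 D1 D2 h0 h1 h2 gen m0 m1 m2.
pose v (i : 'I_3) := if i == i0 then u0 else if i == i1 then u1 else u2.
have sumP (P : pred 'I_3) (G : 'I_3 -> P3) : \sum_(i | P i) G i =
    (if P i0 then G i0 else 0) + (if P i1 then G i1 else 0) + (if P i2 then G i2 else 0).
  by rewrite big_mkcond sum3E.
have vmin i : ~ span_of v (fun i' => i' != i) (v i).
  move=> [g hg]; move: hg; elim/ord3P: i => hg.
  - apply: (m0 (g i1) (g i2)) => j; rewrite -[LHS]/(v i0 j) hg sumP /=.
    by rewrite add0r.
  - apply: (m1 (g i0) (g i2)) => j; rewrite -[LHS]/(v i1 j) hg sumP /=.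
    by rewrite addr0.
  - apply: (m2 (g i0) (g i1)) => j; rewrite -[LHS]/(v i2 j) hg sumP /=.
    by rewrite addr0.
exists v; split=> //.
- by apply: ord3P.
- by move=> i; split; [apply: span_nonzero (vmin i) | elim/ord3P: i].
- move=> w /gen [a [b [c hw]]].
  exists (fun i => if i == i0 then a else if i == i1 then b else c) => j.
  by rewrite sumP /= hw.
Qed.

End Generators.

(** * Derivations killing the curve with the line added *)

Section Addition.
Variable C : numClosedFieldType.
Notation P3 := {mpoly C[3]}.
Notation hc k := (pihomog mdeg k).

Variables (f : P3) (d : nat) (v : 'I_2 -> 'I_3 -> P3) (dg : 'I_2 -> nat).
Hypotheses (d0 : (0 < d)%N) (hf : f \is d.-homog) (f0 : f != 0).
Hypothesis f_red : forall G H : P3, f = G * G * H -> (msize G <= 1)%N.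
Hypothesis vD : forall m, \sum_i v m i * f^`M(i) = 0.
Hypothesis v_homog : forall m i, v m i \is (dg m).-homog.
Hypothesis v_gen : forall w : 'I_3 -> P3, \sum_i w i * f^`M(i) = 0 ->
  exists G : 'I_2 -> P3, forall i, w i = \sum_m G m * v m i.

Variables (L A B N : 'I_3 -> C) (S T : P3).
Hypothesis fr : frame L A B N S T.
Hypothesis L0 : exists i, L i != 0.
Hypothesis lf : ~ rdiv (lform L) f.
Hypothesis fB : f.@[B] != 0.

Notation l := (lform L).
Notation vl := (vl L v).
Notation rho0 := (v ord0).
Notation rho1 := (v ord_max).
Notation o0 := (ord0 : 'I_2).
Notation o1 := (ord_max : 'I_2).
Notation F := (f * l).

Lemma sum2E (R : nmodType) (G : 'I_2 -> R) : \sum_i G i = G o0 + G o1.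
Proof. by rewrite big_ord_recl big_ord1; congr (_ + G _); apply: val_inj. Qed.

Let l0 : l != 0 := lform_neq0 L0.

Lemma vlE m : vl m = \sum_i v m i * (L i)%:MP.
Proof. by apply: eq_bigr => i _; rewrite mulrC. Qed.

Lemma degree_sum : (dg o0 + dg o1).+1 = d.
Proof.
have [c c0 hc] := saito d0 hf f0 f_red v_gen.
have [j fj] := gradient_neq0 d0 hf f0.
have h : cross rho0 rho1 j \is (dg o0 + dg o1).-homog.
  by rewrite /cross; do 2?case: ifP => _; apply: rpredB; apply: dhomogM; apply: v_homog.
rewrite hc mul_mpolyC in h.
have nz : c *: f^`M(j) != 0 by rewrite -mul_mpolyC mulf_neq0 // mpolyC_eq0.
have := dhomog_uniq nz h (dhomogZ c (dhomog_mderiv j hf)) => ->.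
by case: (d) d0.
Qed.

(* Two vectors orthogonal to [L] at a point of the line have cross product
   proportional to [L], so by Saito the gradient of [f] is too, and Euler gives [f = 0]. *)
Lemma zero_on_line (q : 'I_3 -> C) : \sum_i L i * q i = 0 ->
  (forall m, (vl m).@[q] = 0) -> f.@[q] = 0.
Proof.
move=> Lq vq; have [c c0 hc] := saito d0 hf f0 f_red v_gen.
have [k Lk] := L0.
pose u i := (rho0 i).@[q]; pose w i := (rho1 i).@[q]; pose g i := (f^`M(i)).@[q].
have Lu : L i0 * u i0 + L i1 * u i1 + L i2 * u i2 = 0.
  by rewrite -(vq o0) vlE sum3E !mevalD !mevalM !mevalC /u; ring.
have Lw : L i0 * w i0 + L i1 * w i1 + L i2 * w i2 = 0.
  by rewrite -(vq o1) vlE sum3E !mevalD !mevalM !mevalC /w; ring.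
rewrite sum3E in Lq.
have g0 : c * g i0 = u i1 * w i2 - u i2 * w i1.
  by have := congr1 (meval q) (hc i0); rewrite /cross /= mevalB !mevalM mevalC.
have g1 : c * g i1 = u i2 * w i0 - u i0 * w i2.
  by have := congr1 (meval q) (hc i1); rewrite /cross /= mevalB !mevalM mevalC.
have g2 : c * g i2 = u i0 * w i1 - u i1 * w i0.
  by have := congr1 (meval q) (hc i2); rewrite /cross /= mevalB !mevalM mevalC.
have eul : q i0 * g i0 + q i1 * g i1 + q i2 * g i2 = d%:R * f.@[q].
  have := congr1 (meval q) (euler hf); rewrite sum3E !mevalD !mevalM !mevalXU => ->.
  by rewrite mevalZ.
suff : L k * (q i0 * (c * g i0) + q i1 * (c * g i1) + q i2 * (c * g i2)) = 0.
  have -> : L k * (q i0 * (c * g i0) + q i1 * (c * g i1) + q i2 * (c * g i2)) =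
    (L k * c * d%:R) * f.@[q] by rewrite -[RHS]mulrA -eul; ring.
  move/eqP; rewrite !mulf_eq0 (negbTE Lk) (negbTE c0) pnatr_eq0 -leqn0 leqNgt d0 /=.
  by move/eqP.
rewrite g0 g1 g2; move: k {Lk}; apply: ord3P.
- transitivity ((L i0 * q i0 + L i1 * q i1 + L i2 * q i2) * (u i1 * w i2 - u i2 * w i1)
    + (L i0 * u i0 + L i1 * u i1 + L i2 * u i2) * (w i1 * q i2 - w i2 * q i1)
    + (L i0 * w i0 + L i1 * w i1 + L i2 * w i2) * (q i1 * u i2 - q i2 * u i1)); first by ring.
  by rewrite Lq Lu Lw; ring.
- transitivity ((L i0 * q i0 + L i1 * q i1 + L i2 * q i2) * (u i2 * w i0 - u i0 * w i2)
    + (L i0 * u i0 + L i1 * u i1 + L i2 * u i2) * (w i2 * q i0 - w i0 * q i2)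
    + (L i0 * w i0 + L i1 * w i1 + L i2 * w i2) * (q i2 * u i0 - q i0 * u i2)); first by ring.
  by rewrite Lq Lu Lw; ring.
- transitivity ((L i0 * q i0 + L i1 * q i1 + L i2 * q i2) * (u i0 * w i1 - u i1 * w i0)
    + (L i0 * u i0 + L i1 * u i1 + L i2 * u i2) * (w i0 * q i1 - w i1 * q i0)
    + (L i0 * w i0 + L i1 * w i1 + L i2 * w i2) * (q i0 * u i1 - q i1 * u i0)); first by ring.
  by rewrite Lq Lu Lw; ring.
Qed.

Definition mk (a b c : P3) (i : 'I_3) : P3 :=
  a * rho0 i + b * rho1 i - ((d.+1)%:R^-1)%:MP * c * 'X_i.

Lemma dot_mk a b c (w : 'I_3 -> P3) : \sum_i mk a b c i * w i =
  a * (\sum_i rho0 i * w i) + b * (\sum_i rho1 i * w i) -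
  ((d.+1)%:R^-1)%:MP * c * \sum_i 'X_i * w i.
Proof. by rewrite !sum3E /mk; ring. Qed.

Lemma dot_deriv (w : 'I_3 -> P3) :
  \sum_i w i * F^`M(i) = l * (\sum_i w i * f^`M(i)) + f * \sum_i w i * (L i)%:MP.
Proof.
rewrite [X in _ = X + _]mulr_sumr [X in _ = _ + X]mulr_sumr -big_split; apply: eq_bigr => i _.
by rewrite mderivM lform_coef /=; ring.
Qed.

Lemma dot_X_L : \sum_i 'X_i * (L i)%:MP = l.
Proof. by apply: eq_bigr => i _; rewrite mulrC. Qed.

Lemma dS_neq0 : (d.+1)%:R%:MP * ((d.+1)%:R^-1)%:MP = 1 :> P3.
Proof. by rewrite -mpolyCM mulfV ?mpolyC1 // pnatr_eq0. Qed.

Lemma mk_D0 a b c : a * vl o0 + b * vl o1 = c * l -> \sum_i mk a b c i * F^`M(i) = 0.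
Proof.
move=> e; rewrite dot_deriv !dot_mk !vD (euler hf) dot_X_L -!vlE e -mul_mpolyC.
have kD : (d%:R%:MP + 1) * ((d.+1)%:R^-1)%:MP = 1 :> P3.
  by rewrite -mpolyC1 -mpolyCD natr1 mpolyC1 dS_neq0.
move: kD; set k := ((d.+1)%:R^-1)%:MP => kD.
by transitivity (c * l * f * (1 - (d%:R%:MP + 1) * k)); [ring | rewrite kD; ring].
Qed.

(** As [l] is prime and does not divide [f], a derivation killing [f * l] sends [l] to a multiple of
    [l]; a multiple of the Euler field then corrects it to one killing [f]. *)
Lemma D0_mk (w : 'I_3 -> P3) : \sum_i w i * F^`M(i) = 0 ->
  exists a b c, a * vl o0 + b * vl o1 = c * l /\ forall i, w i = mk a b c i.
Proof.
rewrite dot_deriv => e.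
have [h eh] : rdiv l (\sum_i w i * (L i)%:MP).
  apply: (lform_primeP fr lf); exists (- \sum_i w i * f^`M(i)).
  by move/eqP: e; rewrite addrC addr_eq0 => /eqP ->; ring.
have e2 : \sum_i w i * f^`M(i) + f * h = 0.
  by apply: (mulfI l0); rewrite mulr0 -[RHS]e eh; ring.
have dC : d%:R%:MP * (d%:R^-1)%:MP = 1 :> P3.
  by rewrite -mpolyCM mulfV ?mpolyC1 // pnatr_eq0 -lt0n.
have [|G hG] := v_gen (w := fun i => w i + (d%:R^-1)%:MP * h * 'X_i).
  rewrite (eq_bigr (fun i => w i * f^`M(i) + (d%:R^-1)%:MP * h * ('X_i * f^`M(i)))).
    rewrite big_split -mulr_sumr (euler hf) -mul_mpolyC /= -[RHS]e2.
    by transitivity (\sum_i w i * f^`M(i) + d%:R%:MP * (d%:R^-1)%:MP * (f * h)); [ring | rewrite dC mul1r].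
  by move=> i _; ring.
(* The added field is h / d times the Euler field E, and E l = l; so [l] is now sent to (1 + 1 / d)
   h l. *)
exists (G o0), (G o1), ((1 + (d%:R^-1)%:MP) * h); split.
  rewrite !vlE; transitivity (\sum_i (w i + (d%:R^-1)%:MP * h * 'X_i) * (L i)%:MP).
    rewrite !mulr_sumr -big_split; apply: eq_bigr => i _.
    by rewrite hG sum2E /=; ring.
  rewrite (eq_bigr (fun i => w i * (L i)%:MP + (d%:R^-1)%:MP * h * ('X_i * (L i)%:MP))).
    by rewrite big_split -mulr_sumr eh dot_X_L /=; ring.
  by move=> i _; ring.
move=> i; rewrite /mk; have := hG i; rewrite sum2E => <-.
have -> : ((d.+1)%:R^-1)%:MP * ((1 + (d%:R^-1)%:MP) * h) = (d%:R^-1)%:MP * h.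
  rewrite mulrA; congr (_ * _); rewrite -mpolyC1 -mpolyCD -mpolyCM; congr (_%:MP).
  rewrite -natr1; field; rewrite natr1 !pnatr_eq0 /=; by case: (d) d0.
by rewrite addrK.
Qed.

(** Pairing with the gradient kills both generators and isolates [c]; cross products with one
    generator then isolate the coefficient of the other. *)
Lemma mk_eq0 a b c : (forall i, mk a b c i = 0) -> [/\ a = 0, b = 0 & c = 0].
Proof.
move=> h; have [k k0 hc] := saito d0 hf f0 f_red v_gen.
have kC : k%:MP != 0 :> P3 by rewrite mpolyC_eq0.
have dC : ((d.+1)%:R^-1)%:MP != 0 :> P3 by rewrite mpolyC_eq0 invr_eq0 pnatr_eq0.
have crossE (u : 'I_3 -> P3) : \sum_i u i * (k%:MP * f^`M(i)) = \sum_i u i * cross rho0 rho1 i.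
  by apply: eq_bigr => i _; rewrite hc.
have c_eq0 : c = 0.
  have := dot_mk a b c (fun i => k%:MP * f^`M(i)).
  rewrite big1 => [|i _]; last by rewrite h mul0r.
  rewrite !crossE; have -> : \sum_i rho0 i * cross rho0 rho1 i = 0.
    by rewrite sum3E /cross /=; ring.
  have -> : \sum_i rho1 i * cross rho0 rho1 i = 0 by rewrite sum3E /cross /=; ring.
  rewrite -crossE (eq_bigr (fun i => k%:MP * ('X_i * f^`M(i)))) => [|i _]; last by ring.
  rewrite -mulr_sumr (euler hf) !mulr0 add0r sub0r => /esym/eqP.
  rewrite oppr_eq0 !mulf_eq0 (negbTE dC) (negbTE kC) scaler_eq0 (negbTE f0) pnatr_eq0.
  by rewrite -leqn0 leqNgt d0 !orbF => /eqP.
have h2 i : a * rho0 i + b * rho1 i = 0.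
  by have := h i; rewrite /mk c_eq0 mulr0 mul0r subr0.
have [j fj] := gradient_neq0 d0 hf f0.
have cj : cross rho0 rho1 j != 0 by rewrite hc mulf_neq0.
have ab z : z = a \/ z = b -> z * cross rho0 rho1 j = 0.
  case=> ->; move: j {fj cj}; apply: ord3P; rewrite /cross /=.
  - transitivity ((a * rho0 i1 + b * rho1 i1) * rho1 i2 - (a * rho0 i2 + b * rho1 i2) * rho1 i1); first by ring.
    by rewrite !h2 !mul0r subr0.
  - transitivity ((a * rho0 i2 + b * rho1 i2) * rho1 i0 - (a * rho0 i0 + b * rho1 i0) * rho1 i2); first by ring.
    by rewrite !h2 !mul0r subr0.
  - transitivity ((a * rho0 i0 + b * rho1 i0) * rho1 i1 - (a * rho0 i1 + b * rho1 i1) * rho1 i0); first by ring.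
    by rewrite !h2 !mul0r subr0.
  - transitivity ((a * rho0 i2 + b * rho1 i2) * rho0 i1 - (a * rho0 i1 + b * rho1 i1) * rho0 i2); first by ring.
    by rewrite !h2 !mul0r subr0.
  - transitivity ((a * rho0 i0 + b * rho1 i0) * rho0 i2 - (a * rho0 i2 + b * rho1 i2) * rho0 i0); first by ring.
    by rewrite !h2 !mul0r subr0.
  - transitivity ((a * rho0 i1 + b * rho1 i1) * rho0 i0 - (a * rho0 i0 + b * rho1 i0) * rho0 i1); first by ring.
    by rewrite !h2 !mul0r subr0.
by split=> //; apply: (mulIf cj); rewrite mul0r ab; auto.
Qed.

Lemma vl_hom m : vl m \is (dg m).-homog.
Proof. exact: vl_homog v_homog m. Qed.

Let H m : {poly C} := lin A B (vl m).
Let gam : {poly C} := gcdp (H o0) (H o1).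
Let e := (size gam).-1.
Let K m : {poly C} := H m %/ gam.

(** If both restrictions lost degree, both [vl m] would vanish at [B], and then so would [f]. *)
Lemma exists_full : exists m, (H m)`_(dg m) != 0.
Proof.
apply: NNPP => nex; move/eqP: fB; apply; apply: zero_on_line; first exact: frameB fr.
move=> m; rewrite -(lin_top A _ (vl_hom m)) //; apply/eqP/negPn/negP => h.
by apply: nex; exists m.
Qed.

Lemma gam_neq0 : gam != 0.
Proof.
have [m hm] := exists_full; rewrite gcdp_eq0 negb_and; move: hm; elim/ord2P: m => hm.
  by apply/orP; left; apply: contraNneq hm => ->; rewrite coef0.
by apply/orP; right; apply: contraNneq hm => ->; rewrite coef0.
Qed.

Lemma size_gam : size gam = e.+1.
Proof. by rewrite /e prednK // size_poly_gt0 gam_neq0. Qed.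

Lemma root_gam t : root gam t -> root (lin A B f) t.
Proof.
rewrite root_gcd => /andP[r0 r1]; rewrite rootE lin_horner; apply/eqP; apply: zero_on_line.
  rewrite (eq_bigr (fun i => L i * A i + t * (L i * B i))) => [|i _]; last by ring.
  by rewrite big_split -mulr_sumr (frameA fr) (frameB fr) /= mulr0 addr0.
by apply: ord2P; rewrite -lin_horner; apply/eqP.
Qed.

Lemma HK m : H m = K m * gam.
Proof. by rewrite divpK //; elim/ord2P: m; [apply: dvdp_gcdl | apply: dvdp_gcdr]. Qed.

Lemma size_H m : (size (H m) <= (dg m).+1)%N.
Proof. exact: lin_size (vl_hom m). Qed.

Lemma size_K m : H m != 0 -> (size (K m) + e = size (H m))%N.
Proof.
move=> h; have k0 : K m != 0 by apply: contraNneq h => k0; rewrite HK k0 mul0r.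
by rewrite HK size_mul ?gam_neq0 // size_gam addnS.
Qed.

Lemma K_deg m : K m = 0 \/ (e <= dg m /\ size (K m) <= (dg m - e).+1)%N.
Proof.
have [h|h] := eqVneq (H m) 0; first by left; rewrite /K h div0p.
have k0 : K m != 0 by apply: contraNneq h => k0; rewrite HK k0 mul0r.
right; have := size_K h; have := size_H m; rewrite -size_poly_gt0 in k0.
by move: k0; move: (size (K m)) (size (H m)) => x y; clear; lia.
Qed.

Lemma K_full m : (H m)`_(dg m) != 0 -> (e <= dg m)%N /\ size (K m) = (dg m - e).+1.
Proof.
move=> h; have h0 : H m != 0 by apply: contraNneq h => ->; rewrite coef0.
have : (dg m < size (H m))%N by rewrite ltnNge; apply: contra h => /leq_sizeP ->.
have k0 : K m != 0 by apply: contraNneq h0 => k0; rewrite HK k0 mul0r.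
have := size_K h0; have := size_H m; rewrite -size_poly_gt0 in k0.
by move: k0; move: (size (K m)) (size (H m)) => x y; clear; lia.
Qed.

Lemma K_coprime : exists u, u.1 * K o0 + u.2 * K o1 = 1 :> {poly C}.
Proof.
apply/Bezout_eq1_coprimepP; apply: coprimep_div_gcd.
by rewrite -negb_and -gcdp_eq0 gam_neq0.
Qed.

Notation lft k q := (line_lift S T k q).

(** Full degree means that [K m] has no zero at infinity; otherwise [q] could be of too high a
    degree to lift to a form of degree [n - (dg m - e)]. *)
Lemma lift_quotient m x n q : x \is n.-homog -> (H m)`_(dg m) != 0 ->
  lin A B x = q * K m -> exists a, rdiv l (x - a * lft (dg m - e) (K m)).
Proof.
move=> hx /K_full [em sK] ex.
have [q0|q0] := eqVneq q 0.
  by exists 0; rewrite mul0r subr0; apply/(rdiv_lin_eq0 fr hx); rewrite ex q0 mul0r.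
have K0 : K m != 0 by rewrite -size_poly_gt0 sK.
have := lin_size A B hx; rewrite ex size_mul // sK addnS /= => sq.
have sq0 : (0 < size q)%N by rewrite size_poly_gt0.
exists (lft (n - (dg m - e)) q); rewrite -(rdiv_lin_eq0 fr (k := n)).
  rewrite linD -mulN1r !linM (lin_line_lift fr) ?(lin_line_lift fr) ?sK ?ex //.
    by rewrite rmorphN1 mulN1r subrr.
  by move: sq sq0; move: (size q) (dg m - e)%N => a b; clear; lia.
apply: rpredB => //.
have en : (n = (n - (dg m - e)) + (dg m - e))%N.
  by move: sq sq0; move: (size q) (dg m - e)%N => a b; clear; lia.
have := dhomogM (line_lift_homog fr (n - (dg m - e)) q) (line_lift_homog fr (dg m - e) (K m)).
by rewrite -en.
Qed.

Lemma component_relation (a b c u w : P3) eu ew n : u \is eu.-homog -> w \is ew.-homog ->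
  a * u + b * w = c * l -> exists b' c', hc n a * u + b' * w = c' * l.
Proof.
move=> hu hw /(congr1 (hc (n + eu))).
rewrite raddfD /= !(pihomogM _ _ hu, pihomogM _ _ hw, pihomogM _ _ (lform_homog L)).
rewrite leq_addl addnK => e1.
exists (if (ew <= n + eu)%N then hc (n + eu - ew) b else 0).
exists (if (0 < n + eu)%N then hc (n + eu - 1) c else 0).
by move: e1; do 2 case: ifP => _; rewrite ?mul0r.
Qed.

Lemma lin_l : lin A B l = 0.
Proof. by apply/(rdiv_lin_eq0 fr (lform_homog L)); apply: rdiv_refl. Qed.

Lemma K_relation a b c : a * vl o0 + b * vl o1 = c * l ->
  exists q, lin A B a = q * K o1 /\ lin A B b = - q * K o0.
Proof.
move=> /(congr1 (lin A B)); rewrite linD !linM lin_l mulr0 -!/(H _) !HK => e1.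
have {e1} : lin A B a * K o0 + lin A B b * K o1 = 0.
  by apply: (mulIf gam_neq0); rewrite mul0r -e1; ring.
move: (lin A B a) (lin A B b) => x y e1.
have [[u w] /= e2] := K_coprime; exists (x * w - y * u); split.
  transitivity (x * (u * K o0 + w * K o1) - u * (x * K o0 + y * K o1)); last by ring.
  by rewrite e1 e2; ring.
transitivity (y * (u * K o0 + w * K o1) - w * (x * K o0 + y * K o1)); last by ring.
by rewrite e1 e2; ring.
Qed.

Definition p0 := lft (dg o1 - e) (K o1).
Definition p1 := - lft (dg o0 - e) (K o0).

Lemma lin_p0 : lin A B p0 = K o1.
Proof.
rewrite /p0; have [->|[_ s]] := K_deg o1; last by rewrite (lin_line_lift fr).
by rewrite (lin_line_lift fr) ?size_poly0.
Qed.

Lemma lin_p1 : lin A B p1 = - K o0.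
Proof.
rewrite /p1 -mulN1r linM rmorphN1 mulN1r; congr (- _).
have [->|[_ s]] := K_deg o0; last by rewrite (lin_line_lift fr).
by rewrite (lin_line_lift fr) ?size_poly0.
Qed.

Lemma line_lift0 k : lft k 0 = 0 :> P3.
Proof. by rewrite /line_lift /hlift big1 // => j _; rewrite coef0 rmorph0 !mul0r. Qed.

Let D := (dg o0 + dg o1 - e)%N.

Lemma p0_homog (w : P3) : w \is (dg o0).-homog -> p0 * w \is D.-homog.
Proof.
move=> hw; rewrite /p0; have [->|[le _]] := K_deg o1; first by rewrite line_lift0 mul0r dhomog0.
have -> : D = ((dg o1 - e) + dg o0)%N by rewrite /D; move: le; clear; lia.
by apply: dhomogM => //; apply: line_lift_homog fr _ _.
Qed.

Lemma p1_homog (w : P3) : w \is (dg o1).-homog -> p1 * w \is D.-homog.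
Proof.
move=> hw; rewrite /p1 mulNr rpredN.
have [->|[le _]] := K_deg o0; first by rewrite line_lift0 mul0r dhomog0.
have -> : D = ((dg o0 - e) + dg o1)%N by rewrite /D; move: le; clear; lia.
by apply: dhomogM => //; apply: line_lift_homog fr _ _.
Qed.

Lemma exists_c2 : exists2 c2, p0 * vl o0 + p1 * vl o1 = c2 * l &
  forall i, c2 * 'X_i \is D.-homog.
Proof.
have h : p0 * vl o0 + p1 * vl o1 \is D.-homog.
  by apply: rpredD; [apply: p0_homog | apply: p1_homog]; apply: vl_hom.
have [c ec] : rdiv l (p0 * vl o0 + p1 * vl o1).
  apply/(rdiv_lin_eq0 fr h); rewrite linD !linM lin_p0 lin_p1 -!/(H _) !HK; ring.
exists c => // i; rewrite ec mulrC in h.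
have [hc cz] := homog_factor l0 (lform_homog L) h.
have [D0|D0] := posnP D; first by rewrite cz ?D0 // mul0r dhomog0.
rewrite -(subnK D0) addn1 -[X in X.-homog]addn1; apply: dhomogM => //.
by rewrite dhomogX /= mdeg1.
Qed.

(** For [m] of full degree, the coefficient of the other form restricts to a multiple of [K m], and
    this quotient is lifted component by component. The remaining coefficient follows because [vl m]
    is not divisible by the prime [l]. *)
Lemma syzygy_span a b c : a * vl o0 + b * vl o1 = c * l ->
  exists al, rdiv l (a - al * p0) /\ rdiv l (b - al * p1).
Proof.
move=> e1; have [c2 e2 _] := exists_c2.
have sum_comp (x y : P3) :
   (forall n, exists al, rdiv l (hc n x - al * y)) -> exists al, rdiv l (x - al * y) => [h|].
  have [al hal] := choice _ h; exists (\sum_(n < msize x) al n).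
  rewrite [x in x - _](pihomog_sum (leqnn _)) mulr_suml -sumrB.
  by apply: (big_ind (rdiv l)) => [|u w|i _]; [apply: rdiv0 | apply: rdivD | apply: hal].
have [m hm] := exists_full; have nl : ~ rdiv l (vl m).
  move/(rdiv_lin_eq0 fr (vl_hom m)); rewrite -/(H m) => z.
  by rewrite z coef0 eqxx in hm.
move: hm nl; elim/ord2P: m => hm nl.
  have [|al [z hal]] := sum_comp b p1.
    move=> n; have [a' [c']] := component_relation n (vl_hom o1) (vl_hom o0) (etrans (addrC _ _) e1).
    rewrite addrC => /K_relation [q [_ eq]].
    have [al hal] := lift_quotient (pihomogP mdeg n b) hm eq.
    by exists (- al); rewrite /p1 mulrNN.
  exists al; split; last by exists z.
  apply: (lform_primeP fr nl); exists (c - al * c2 - z * vl o1).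
  transitivity (c * l - al * (c2 * l) - z * l * vl o1); last by ring.
  by rewrite -e1 -e2 -hal; ring.
have [|al [z hal]] := sum_comp a p0.
  move=> n; have [b' [c']] := component_relation n (vl_hom o0) (vl_hom o1) e1.
  by move=> /K_relation [q [eq _]]; apply: lift_quotient (pihomogP mdeg n a) hm eq.
exists al; split; first by exists z.
apply: (lform_primeP fr nl); exists (c - al * c2 - z * vl o0).
transitivity (c * l - al * (c2 * l) - z * l * vl o0); last by ring.
by rewrite -e1 -e2 -hal; ring.
Qed.

Lemma mkB a b c a' b' c' i : mk a b c i - mk a' b' c' i = mk (a - a') (b - b') (c - c') i.
Proof. by rewrite /mk; ring. Qed.

Lemma mkZ x a b c i : x * mk a b c i = mk (x * a) (x * b) (x * c) i.
Proof. by rewrite /mk; ring. Qed.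

Lemma mkD a b c a' b' c' i : mk a b c i + mk a' b' c' i = mk (a + a') (b + b') (c + c') i.
Proof. by rewrite /mk; ring. Qed.

Lemma mk_inj a b c a' b' c' : (forall i, mk a b c i = mk a' b' c' i) ->
  a = a' /\ b = b'.
Proof.
move=> h; have [] := @mk_eq0 (a - a') (b - b') (c - c').
  by move=> i; rewrite -mkB h subrr.
by move=> /eqP; rewrite subr_eq0 => /eqP -> /eqP; rewrite subr_eq0 => /eqP ->.
Qed.

Definition th0 := mk l 0 (vl o0).
Definition th1 := mk 0 l (vl o1).

Lemma th0_D : \sum_i th0 i * F^`M(i) = 0.
Proof. by apply: mk_D0; rewrite mul0r addr0 mulrC. Qed.

Lemma th1_D : \sum_i th1 i * F^`M(i) = 0.
Proof. by apply: mk_D0; rewrite mul0r add0r mulrC. Qed.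

Lemma th0_homog i : th0 i \is (dg o0).+1.-homog.
Proof.
rewrite /th0 /mk mul0r addr0 -mulrA; apply: rpredB.
  by rewrite -[(dg o0).+1]add1n; apply: dhomogM => //; apply: lform_homog.
rewrite mul_mpolyC; apply: dhomogZ; rewrite -[(dg o0).+1]addn1; apply: dhomogM; first exact: vl_hom.
by rewrite dhomogX /= mdeg1.
Qed.

Lemma th1_homog i : th1 i \is (dg o1).+1.-homog.
Proof.
rewrite /th1 /mk mul0r add0r -mulrA; apply: rpredB.
  by rewrite -[(dg o1).+1]add1n; apply: dhomogM => //; apply: lform_homog.
rewrite mul_mpolyC; apply: dhomogZ; rewrite -[(dg o1).+1]addn1; apply: dhomogM; first exact: vl_hom.
by rewrite dhomogX /= mdeg1.
Qed.

Lemma exists_th2 : exists c2, let th2 := mk p0 p1 c2 in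
  [/\ p0 * vl o0 + p1 * vl o1 = c2 * l, \sum_i th2 i * F^`M(i) = 0,
   forall i, th2 i \is D.-homog &
   forall w : 'I_3 -> P3, \sum_i w i * F^`M(i) = 0 ->
     exists a b c, forall i, w i = a * th0 i + b * th1 i + c * th2 i].
Proof.
have [c2 e2 h2] := exists_c2; exists c2; split=> //; first exact: mk_D0.
  move=> i; rewrite /mk -mulrA; apply: rpredB.
    by apply: rpredD; [apply: p0_homog | apply: p1_homog].
  by rewrite mul_mpolyC; apply: dhomogZ.
move=> w /D0_mk [a [b [c [e1 hw]]]].
have [al [[x ex] [y ey]]] := syzygy_span e1.
have ea : a = x * l + al * p0 by rewrite -ex subrK.
have eb : b = y * l + al * p1 by rewrite -ey subrK.
have ec : c = x * vl o0 + y * vl o1 + al * c2.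
  apply: (mulIf l0); rewrite -e1 ea eb.
  transitivity ((x * vl o0 + y * vl o1) * l + al * (p0 * vl o0 + p1 * vl o1)); first by ring.
  by rewrite e2; ring.
exists x, y, al => i; rewrite hw ea eb ec /th0 /th1 /mk; ring.
Qed.

Lemma mk_comb a b c x a1 b1 c1 y a2 b2 c2 :
  (forall i, mk a b c i = x * mk a1 b1 c1 i + y * mk a2 b2 c2 i) ->
  a = x * a1 + y * a2 /\ b = x * b1 + y * b2.
Proof.
move=> h; apply: (@mk_inj _ _ c _ _ (x * c1 + y * c2)) => i.
by rewrite h !mkZ mkD.
Qed.

Lemma line_lift_const k (c : C) : lft k c%:P = c%:MP * S ^+ k.
Proof.
rewrite /line_lift /hlift big_ord_recl /= big1 ?addr0 => [|j _].
  by rewrite coefC expr0 mulr1 subn0.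
by rewrite coefC /= rmorph0 !mul0r.
Qed.

Lemma not_unit_multiple (p x : P3) n : (0 < n)%N -> p \is n.-homog ->
  lin A B p != 0 -> l <> x * p.
Proof.
move=> n0 hp p0' ex; have np : ~ rdiv l p.
  by move/(rdiv_lin_eq0 fr hp) => z; rewrite z eqxx in p0'.
have [y ey] : rdiv l x by apply: (lform_primeP fr np); exists 1; rewrite mul1r mulrC.
have u : p \is a GRing.unit.
  by apply/unitrPr; exists y; apply: (mulIf l0); rewrite mul1r [RHS]ex ey; ring.
by move: n0; rewrite (unit_homog hp u).
Qed.

Lemma multiple_lin_eq0 (x p : P3) : p = x * l -> lin A B p = 0.
Proof. by move=> ->; rewrite linM lin_l mulr0. Qed.

Theorem addition_generators : (dg o0 <= dg o1)%N ->
  [\/ e = dg o0 /\ has_gens F [:: dg o1; (dg o0).+1],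
      e = dg o1 /\ has_gens F [:: dg o0; (dg o1).+1] |
      (e < dg o0)%N /\ has_gens F [:: (dg o0).+1; (dg o1).+1; D]].
Proof.
move=> le01; have [c2 [e2 D2 h2 gen]] := exists_th2; set th2 := mk p0 p1 c2 in D2 h2 gen.
have unit_cancel (c : C) : c != 0 -> (c^-1)%:MP * c%:MP = 1 :> P3.
  by move=> c0; rewrite -mpolyCM mulVf // mpolyC1.
have full_of m m' : H m' = 0 -> m != m' -> e = dg m /\ exists2 k : C, k != 0 & K m = k%:P.
  move=> z mm; have f1 : (H m)`_(dg m) != 0.
    have [n hn] := exists_full; suff -> : m = n by [].
    have : n != m' by apply: contraNneq hn => ->; rewrite z coef0.
    by move: mm; elim/ord2P: (m); elim/ord2P: (m'); elim/ord2P: (n).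
  have [le sK] := K_full f1.
  have Hm0 : H m != 0 by apply: contraNneq f1 => ->; rewrite coef0.
  have sg : size gam = size (H m).
    move: mm z; rewrite /gam; elim/ord2P: (m); elim/ord2P: (m') => // _ ->.
      by rewrite gcdp0.
    by rewrite gcd0p.
  have ee : e = dg m.
    have := size_K Hm0; rewrite -sg size_gam sK; move: le; move: (e) => x; clear; lia.
  by split=> //; apply/size_poly1P; rewrite sK ee subnn.
(* If [vl o0] vanishes on the line, then the gcd is [H o1], of full degree; [p0] is constant, [p1]
   is zero and [th0] is redundant. *)
have [H00|H00] := eqVneq (H o0) 0.
  have [ee [k k0 ek]] := full_of o1 o0 H00 isT.
  have ep0 : p0 = k%:MP by rewrite /p0 ek ee subnn line_lift_const expr0 mulr1.
  have ep1 : p1 = 0 by rewrite /p1 /K H00 div0p line_lift0 oppr0.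
  have eD : D = dg o0 by rewrite /D ee addnK.
  rewrite eD in h2; constructor 2; split=> //; apply: (has_gens2 D2 th1_D h2 th1_homog).
  - move=> w /gen [a [b [c hw]]]; exists (a * l * (k^-1)%:MP + c), b => j; rewrite hw.
    suff -> : th0 j = l * (k^-1)%:MP * th2 j by ring.
    have -> : l * (k^-1)%:MP * th2 j = mk (l * ((k^-1)%:MP * k%:MP)) 0 ((k^-1)%:MP * (c2 * l)) j.
      by rewrite /th2 ep0 ep1 /mk; ring.
    have -> : (k^-1)%:MP * (c2 * l) = ((k^-1)%:MP * k%:MP) * vl o0.
      by rewrite -e2 ep0 ep1; ring.
    by rewrite unit_cancel // mul1r mulr1.
  - move=> a h; have [i|e0 _] := @mk_comb p0 p1 c2 a 0 l (vl o1) 0 0 0 0.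
      by rewrite mul0r addr0; apply: h.
    by move/eqP: e0; rewrite ep0 !mulr0 addr0 mpolyC_eq0 (negbTE k0).
  - move=> a h; have [i|_ e1] := @mk_comb 0 l (vl o1) a p0 p1 c2 0 0 0 0.
      by rewrite mul0r addr0; apply: h.
    by move/eqP: e1; rewrite ep1 !mulr0 addr0 (negbTE l0).
(* For [e < dg o0] neither entry of the lifted syzygy is constant, so all three generators are
   needed. *)
have [e_lt|e_ge] := ltnP e (dg o0).
  have H10 : H o1 != 0.
    by apply/eqP => z; have [ee _] := full_of o0 o1 z isT; rewrite ee ltnn in e_lt.
  have K00 : K o0 != 0 by apply: contraNneq H00 => k0; rewrite HK k0 mul0r.
  have K10 : K o1 != 0 by apply: contraNneq H10 => k0; rewrite HK k0 mul0r.
  have hp0 : p0 \is (dg o1 - e).-homog by apply: line_lift_homog fr _ _.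
  have hp1 : p1 \is (dg o0 - e).-homog by rewrite /p1 rpredN; apply: line_lift_homog fr _ _.
  constructor 3; split=> //; apply: (has_gens3 th0_D th1_D D2 th0_homog th1_homog h2 gen).
  - move=> b c /mk_comb [e0 _]; apply: (@not_unit_multiple p0 c (dg o1 - e)) => //.
    + by rewrite subn_gt0 (leq_trans e_lt).
    + by rewrite lin_p0.
    + by rewrite e0; ring.
  - move=> b c /mk_comb [_ e1]; apply: (@not_unit_multiple p1 c (dg o0 - e)) => //.
    + by rewrite subn_gt0.
    + by rewrite lin_p1 oppr_eq0.
    + by rewrite e1; ring.
  - move=> a b /mk_comb [e0 _]; move/eqP: K10; apply; rewrite -lin_p0.
    by apply: (@multiple_lin_eq0 a); rewrite e0; ring.
have [le sK] : (e <= dg o0)%N /\ (size (K o0) <= (dg o0 - e).+1)%N.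
  by have [k0|] := K_deg o0 => //; move: H00; rewrite HK k0 mul0r eqxx.
(* Here [p1] is a nonzero constant, so [th1] is a combination of [th0] and [th2]. *)
have ee : e = dg o0 by apply/eqP; rewrite eqn_leq le e_ge.
have [k k0 ek] : exists2 k : C, k != 0 & K o0 = k%:P.
  apply/size_poly1P; rewrite eqn_leq (leq_trans sK) ?ee ?subnn //= size_poly_gt0.
  by apply: contraNneq H00 => z; rewrite HK z mul0r.
have ep1 : p1 = - k%:MP by rewrite /p1 ek ee subnn line_lift_const expr0 mulr1.
have eD : D = dg o1 by rewrite /D ee addKn.
have kN : k%:MP != 0 :> P3 by rewrite mpolyC_eq0.
rewrite eD in h2; constructor 1; split=> //; apply: (has_gens2 D2 th0_D h2 th0_homog).
- move=> w /gen [a [b [c hw]]].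
  exists (c - b * l * (k^-1)%:MP), (a + b * (k^-1)%:MP * p0) => j; rewrite hw.
  suff -> : th1 j = - (l * (k^-1)%:MP) * th2 j + (k^-1)%:MP * p0 * th0 j by ring.
  have -> : - (l * (k^-1)%:MP) * th2 j + (k^-1)%:MP * p0 * th0 j =
      mk 0 (l * ((k^-1)%:MP * k%:MP)) ((k^-1)%:MP * (p0 * vl o0 - c2 * l)) j.
    by rewrite /th2 /th0 ep1 /mk; ring.
  have -> : (k^-1)%:MP * (p0 * vl o0 - c2 * l) = ((k^-1)%:MP * k%:MP) * vl o1.
    by rewrite -e2 ep1; ring.
  by rewrite unit_cancel // mulr1 mul1r.
- move=> a h; have [i|_ e1] := @mk_comb p0 p1 c2 a l 0 (vl o0) 0 0 0 0.
    by rewrite mul0r addr0; apply: h.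
  by move/eqP: e1; rewrite ep1 !mulr0 addr0 oppr_eq0 (negbTE kN).
- move=> a h; have [i|e0 e1] := @mk_comb l 0 (vl o0) a p0 p1 c2 0 0 0 0.
    by rewrite mul0r addr0; apply: h.
  have a0 : a = 0.
    apply: (mulIf kN); rewrite mul0r; apply: oppr_inj; rewrite oppr0 -mulrN -ep1.
    by rewrite [RHS]e1 mul0r addr0.
  by move/eqP: e0; rewrite a0 !mul0r addr0 (negbTE l0).
Qed.

End Addition.

(** * Summing over the intersection points *)

Section Multiplicities.
Variable C : numClosedFieldType.

Lemma sum_mup (p : {poly C}) (ts : seq C) : p != 0 -> uniq ts ->
  (forall t, root p t -> t \in ts) -> (\sum_(t <- ts) mup t p)%N = (size p).-1.
Proof.
move=> p0 uts hts; have [r er] := closed_field_poly_normal p.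
have lc0 : lead_coef p != 0 by rewrite lead_coef_eq0.
have mr t : mup t p = count_mem t r.
  rewrite er -mul_polyC mupMr ?mu_prod_XsubC //.
  by rewrite rootC.
have sub z : z \in r -> z \in ts.
  by move=> zr; apply: hts; rewrite er rootZ // root_prod_XsubC.
rewrite (eq_bigr _ (fun t _ => mr t)) er size_scale // size_prod_XsubC /=.
elim: r {er mr} sub => [|z r IH] sub; first by rewrite big1.
rewrite /= big_split /= IH => [|y yr]; last by apply: sub; rewrite inE yr orbT.
rewrite (bigD1_seq z) ?sub ?mem_head //= eqxx big1 => [|y /negbTE yz]; last by rewrite eq_sym yz.
by rewrite addn0 add1n.
Qed.

End Multiplicities.

Section LocExt.
Variable C : numClosedFieldType.
Notation mC := (@mpolyC 2 C).

Lemma meval_ext n (p p' : 'I_n -> C) : p =1 p' -> forall a : {mpoly C[n]}, a.@[p] = a.@[p'].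
Proof.
move=> pp; apply: (mpoly_rmorph_eq (f := meval p) (g := meval p')) => [c|i].
  by rewrite [LHS]mevalC [RHS]mevalC.
by rewrite [LHS]mevalXU [RHS]mevalXU pp.
Qed.

Lemma qdim_loc2_ext (p p' : 'I_2 -> C) a b n : p =1 p' ->
  qdim mC (fun=> True) (loc2 p a b) n -> qdim mC (fun=> True) (loc2 p' a b) n.
Proof.
by move=> pp; apply: qdim_ext => // g; split=> -[t [ht h]]; exists t; split=> //;
  move: ht; rewrite (meval_ext pp).
Qed.

Lemma qdim_loc3_ext (p p' : 'I_2 -> C) a b c n : p =1 p' ->
  qdim mC (fun=> True) (loc3 p a b c) n -> qdim mC (fun=> True) (loc3 p' a b c) n.
Proof.
by move=> pp; apply: qdim_ext => // g; split=> -[t [ht h]]; exists t; split=> //;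
  move: ht; rewrite (meval_ext pp).
Qed.

End LocExt.

(** * Intersection points as roots of the restricted form *)

Section LinePoints.
Variable C : numClosedFieldType.
Notation P3 := {mpoly C[3]}.
Notation dehk := (@dehk C).
Notation mC := (@mpolyC 2 C).

Variables (f : P3) (d : nat) (v : 'I_2 -> 'I_3 -> P3) (dg : 'I_2 -> nat).
Hypotheses (d0 : (0 < d)%N) (hf : f \is d.-homog) (f0 : f != 0).
Hypothesis f_red : forall G H : P3, f = G * G * H -> (msize G <= 1)%N.
Hypothesis vD : forall m, \sum_i v m i * f^`M(i) = 0.
Hypothesis v_homog : forall m i, v m i \is (dg m).-homog.
Hypothesis v_gen : forall w : 'I_3 -> P3, \sum_i w i * f^`M(i) = 0 ->
  exists G : 'I_2 -> P3, forall i, w i = \sum_m G m * v m i.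

Variables (L A B N : 'I_3 -> C) (S T : P3).
Hypothesis fr : frame L A B N S T.
Hypothesis L0 : exists i, L i != 0.
Hypothesis lf : ~ rdiv (lform L) f.
Hypothesis fB : f.@[B] != 0.

Notation phi := (lin A B f).
Notation gam := (gcdp (lin A B (vl L v ord0)) (lin A B (vl L v ord_max))).
Notation param u := (T.@[u] / S.@[u]).

Lemma phi_neq0 : phi != 0.
Proof. by apply/eqP => /(rdiv_lin_eq0 fr hf). Qed.

Lemma size_phi : size phi = d.+1.
Proof.
apply/eqP; rewrite eqn_leq (lin_size A B hf) /= ltnNge.
by apply: contra fB => /leq_sizeP h; rewrite -(lin_top A B hf) h.
Qed.

Lemma homog_scale k (F : P3) (x : C) u : F \is k.-homog ->
  F.@[fun i => x * u i] = x ^+ k * F.@[u].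
Proof.
move: k F; apply: dhomog_monomial_ind => [|k i F IH|k|k c F G hF hG].
- by rewrite !meval1 mul1r.
- by rewrite !mevalM !mevalXU IH exprS; ring.
- by rewrite !meval0 mulr0.
- by rewrite !mevalD !mevalZ hF hG; ring.
Qed.

Lemma lform_eval u : (lform L).@[u] = \sum_i L i * u i.
Proof.
rewrite /lform raddf_sum; apply: eq_bigr => i _.
by rewrite -[LHS]/(meval u _) mevalM mevalC mevalXU.
Qed.

Section OnePoint.
Variable u : 'I_3 -> C.
Hypotheses (Lu : \sum_i L i * u i = 0) (fu : f.@[u] = 0) (u0 : exists i, u i != 0).

Lemma decomp i : u i = S.@[u] * A i + T.@[u] * B i.
Proof.
have := congr1 (meval u) (frameX fr i).
by rewrite !mevalD !mevalM !mevalC mevalXU lform_eval Lu mulr0 addr0 => {1}->; ring.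
Qed.

(** A point of the line with [S = 0] is a multiple of [B], which is off the curve. *)
Lemma S_neq0 : S.@[u] != 0.
Proof.
apply/eqP => s0; have uB i : u i = T.@[u] * B i by rewrite {1}decomp s0 mul0r add0r.
have /eqP := fu; rewrite (meval_ext uB) (homog_scale _ _ hf) mulf_eq0 (negbTE fB) orbF.
rewrite expf_eq0 d0 /= => /eqP t0; have [i /eqP[]] := u0.
by rewrite uB t0 mul0r.
Qed.

Lemma decomp_param i : u i = S.@[u] * (A i + param u * B i).
Proof. by rewrite {1}decomp; field; apply: S_neq0. Qed.

Lemma root_param : root phi (param u).
Proof.
have /eqP := fu; rewrite (meval_ext decomp_param) (homog_scale _ _ hf) mulf_eq0.
by rewrite expf_eq0 (negbTE S_neq0) andbF /= rootE lin_horner.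
Qed.

Lemma point_local k : u k != 0 -> let p j := u (lift k j) / u k in
  let g := dehk k f in let g' := dehk k (f * lform L) in
  exists m m' n n',
    [/\ qdim mC (fun=> True) (loc2 p g^`M(ord0) g^`M(ord_max)) m,
        qdim mC (fun=> True) (loc3 p g g^`M(ord0) g^`M(ord_max)) n,
        qdim mC (fun=> True) (loc2 p g'^`M(ord0) g'^`M(ord_max)) m',
        qdim mC (fun=> True) (loc3 p g' g'^`M(ord0) g'^`M(ord_max)) n' &
        (m' + 1 = m + 2 * mup (param u) phi)%N /\
        (n' = n + mup (param u) phi + mup (param u) gam)%N].
Proof.
move=> uk p g g'.
have ck : A k + param u * B k != 0.
  by apply: contraNneq uk => e; rewrite decomp_param e mulr0.
have g0 : gam != 0 := gam_neq0 d0 hf f0 f_red v_homog v_gen fr L0 fB.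
have rt : phi.[param u] = 0 by apply/eqP; rewrite -rootE root_param.
have [m [m' [n [n' [h1 h2 h3 h4 h5]]]]] := point_contribution (frameA fr) (frameB fr) L0
  (frame_indep fr) ck d0 hf f_red vD v_homog v_gen g0 phi_neq0 rt.
have pp : (fun j => (A (lift k j) + param u * B (lift k j)) / (A k + param u * B k)) =1 p.
  move=> j; rewrite /p (decomp_param (lift k j)) (decomp_param k) -mulf_div divff ?S_neq0 //.
  by rewrite mul1r.
exists m, m', n, n'; split=> //.
- exact: qdim_loc2_ext pp h1.
- exact: qdim_loc3_ext pp h2.
- exact: qdim_loc2_ext pp h3.
- exact: qdim_loc3_ext pp h4.
Qed.

End OnePoint.

Lemma param_at t x : x != 0 -> param (fun i => x * (A i + t * B i)) = t.
Proof.
move=> x0; rewrite !(homog_scale _ _ (frame_homS fr), homog_scale _ _ (frame_homT fr)) !expr1.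
rewrite -mulf_div divff // mul1r -!lin_horner (frameS fr) (frameT fr).
by rewrite hornerX hornerC divr1.
Qed.

(** With [tnormal], a copy of [coords] and [normalized] over an arbitrary field, convertible to them
    over the complex numbers. *)
Definition tcoords (q : C * C * C) : 'I_3 -> C :=
  fun i => nth 0 [:: q.1.1; q.1.2; q.2] i.

Definition tnormal (q : C * C * C) : Prop :=
  q.1.1 = 1 \/ (q.1.1 = 0 /\ q.1.2 = 1) \/ (q.1.1 = 0 /\ q.1.2 = 0 /\ q.2 = 1).

Lemma tnormal_neq0 q : tnormal q -> exists i, tcoords q i != 0.
Proof.
case=> [e|[[_ e]|[_ [_ e]]]].
- by exists i0; rewrite /tcoords /= e oner_neq0.
- by exists i1; rewrite /tcoords /= e oner_neq0.
- by exists i2; rewrite /tcoords /= e oner_neq0.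
Qed.

Lemma tnormal_scale q q' z : tnormal q -> tnormal q' ->
  (forall i, tcoords q' i = z * tcoords q i) -> q = q'.
Proof.
move: q q' => [[a b] c] [[a' b'] c'] hq hq' h.
have := h i0; have := h i1; have := h i2; rewrite /tcoords /= => ec eb ea {h}.
suff z1 : z = 1 by rewrite ea eb ec z1 !mul1r.
move: hq hq' ea eb ec; rewrite /tnormal /=.
move=> [->|[[-> ->]|[-> [-> ->]]]] [->|[[-> ->]|[-> [-> ->]]]]; rewrite ?mulr0 ?mulr1.
all: move=> e1 e2 e3; try by [].
all: try by move/eqP: e1; rewrite oner_eq0.
all: try by move/eqP: e2; rewrite oner_eq0.
all: try by move: e2; rewrite -e1 mul0r => /eqP; rewrite oner_eq0.
all: try by move: e3; rewrite -e1 mul0r => /eqP; rewrite oner_eq0.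
all: by move: e3; rewrite -e2 mul0r => /eqP; rewrite oner_eq0.
Qed.

Lemma exists_normal (y : 'I_3 -> C) : (exists i, y i != 0) ->
  exists q x, [/\ tnormal q, x != 0 & forall i, tcoords q i = x * y i].
Proof.
move=> yi; have [h0|h0] := eqVneq (y i0) 0; last first.
  exists (1, y i1 / y i0, y i2 / y i0), (y i0)^-1; split; rewrite ?invr_eq0 //; first by left.
  by apply: ord3P; rewrite /tcoords /= ?mulVf // mulrC.
have [h1|h1] := eqVneq (y i1) 0; last first.
  exists (0, 1, y i2 / y i1), (y i1)^-1; split; rewrite ?invr_eq0 //; first by right; left.
  by apply: ord3P; rewrite /tcoords /= ?h0 ?mulr0 ?mulVf // mulrC.
have h2 : y i2 != 0.
  by case: yi => i; elim/ord3P: i; rewrite ?h0 ?h1 ?eqxx.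
exists (0, 0, 1), (y i2)^-1; split; rewrite ?invr_eq0 //; first by right; right.
by apply: ord3P; rewrite /tcoords /= ?h0 ?h1 ?mulr0 ?mulVf.
Qed.

(** The points correspond to the roots of [phi], which has full degree [d], and the roots of [gam]
    are among them. A point contributes 1 to the size and its multiplicities differ by that much
    from [eps], so both sums of multiplicities become degrees. *)
Theorem sum_over_points (s : seq (C * C * C)) (eps : C * C * C -> int) : uniq s ->
  (forall q, q \in s <-> tnormal q /\ f.@[tcoords q] = 0 /\ (lform L).@[tcoords q] = 0) ->
  (forall q, q \in s -> eps q =
     (mup (param (tcoords q)) phi)%:Z - 1 - (mup (param (tcoords q)) gam)%:Z) ->
  (size s)%:Z + \sum_(q <- s) eps q = d%:Z - (size gam).-1%:Z.
Proof.
move=> us hs heps.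
have on_line q : q \in s -> [/\ tnormal q, \sum_i L i * tcoords q i = 0,
    f.@[tcoords q] = 0 & exists i, tcoords q i != 0].
  by move=> /hs [nq [fq lq]]; split=> //; [rewrite -lform_eval | apply: tnormal_neq0].
pose ts := [seq param (tcoords q) | q <- s].
have uts : uniq ts.
  rewrite map_inj_in_uniq // => q q' /on_line [nq Lq fq q0] /on_line [nq' Lq' fq' q0'] e.
  have sq := S_neq0 Lq fq q0.
  apply: (@tnormal_scale _ _ (S.@[tcoords q'] / S.@[tcoords q])) => // i.
  rewrite (decomp_param Lq' fq' q0') (decomp_param Lq fq q0) e.
  by rewrite mulrA divfK.
have roots t : root phi t -> t \in ts.
  rewrite rootE lin_horner => /eqP ft.
  have yi : exists i, A i + t * B i != 0.
    apply: NNPP => nex; have [|/eqP] := frame_indep fr (x := 1) (y := t).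
      move=> i; rewrite mul1r; apply/eqP/negPn/negP => h; apply: nex; by exists i.
    by rewrite oner_eq0.
  have [q [x [nq x0 hq]]] := exists_normal yi.
  apply/mapP; exists q; last first.
    by rewrite !(meval_ext hq) param_at.
  apply/hs; split=> //; rewrite !(meval_ext hq) (homog_scale _ _ hf) ft mulr0; split=> //.
  rewrite lform_eval (eq_bigr (fun i => x * (L i * A i) + x * t * (L i * B i))) => [|i _]; last by ring.
  by rewrite big_split -!mulr_sumr (frameA fr) (frameB fr) /= !mulr0 addr0.
have g0 : gam != 0 := gam_neq0 d0 hf f0 f_red v_homog v_gen fr L0 fB.
have groots t : root gam t -> t \in ts.
  by move=> /(root_gam d0 hf f0 f_red v_gen fr L0) /roots.
have := sum_mup phi_neq0 uts roots; have := sum_mup g0 uts groots.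
rewrite size_phi !big_map /= => <- <-.
rewrite (eq_big_seq _ heps); elim: (s) => [|q r IH]; first by rewrite !big_nil.
rewrite !big_cons !PoszD /=; move: IH.
set a := \sum_(_ <- r) _; set b := (\sum_(_ <- r) _)%N; set c := (\sum_(_ <- r) _)%N.
by move: a b c (mup _ _) (mup _ _) => a b c m n; clear; lia.
Qed.

End LinePoints.

(** * The standard charts at a normalized point *)

Section Charts.
Variable C : numClosedFieldType.

Lemma mPo_dehk k (s : 3.-tuple {mpoly C[2]}) :
  (forall i, tnth s i = if unlift k i is Some j then 'X_j else 1) ->
  forall F, F \mPo s = dehk C k F.
Proof.
move=> h; apply: (mpoly_rmorph_eq (f := comp_mpoly s) (g := dehk C k)) => [c|i].
  by rewrite [LHS]comp_mpolyC dehkC.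
by rewrite [LHS]comp_mpolyXU dehkX -h -tnth_nth.
Qed.

Definition chart_index (q : C * C * C) : 'I_3 :=
  if q.2 != 0 then i2 else if q.1.2 != 0 then i1 else i0.

Lemma chart_index_neq0 q : tnormal q -> tcoords q (chart_index q) != 0.
Proof.
rewrite /chart_index /tcoords => nq; case: ifP => // /negbFE /eqP c0.
case: ifP => // /negbFE /eqP b0; case: nq => [->|[[_ b1]|[_ [_ c1]]]]; first exact: oner_neq0.
  by move/eqP: b0; rewrite b1 oner_eq0.
by move/eqP: c0; rewrite c1 oner_eq0.
Qed.

Definition chart_tuple (q : C * C * C) : 3.-tuple {mpoly C[2]} :=
  if q.2 != 0 then [tuple 'X_ord0; 'X_ord_max; 1]
  else if q.1.2 != 0 then [tuple 'X_ord0; 1; 'X_ord_max]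
  else [tuple 1; 'X_ord0; 'X_ord_max].

Definition chart_coords (q : C * C * C) : 'I_2 -> C :=
  let: (a, b, c) := q in
  if c != 0 then (fun i => nth 0 [:: a / c; b / c] i)
  else if b != 0 then (fun i => nth 0 [:: a / b; c / b] i)
  else (fun i => nth 0 [:: b / a; c / a] i).

Lemma chart_tupleE q F : F \mPo chart_tuple q = dehk C (chart_index q) F.
Proof.
apply: mPo_dehk => i; rewrite /chart_tuple /chart_index.
by case: ifP => _; [|case: ifP => _]; case: unliftP => [j ->|->] //; elim/ord2P: j.
Qed.

Lemma chart_coordsE q : let k := chart_index q in
  (fun j => tcoords q (lift k j) / tcoords q k) =1 chart_coords q.
Proof.
case: q => [[a b] c]; rewrite /chart_index /chart_coords /tcoords /=.
by case: ifP => _; [|case: ifP => _]; apply: ord2P.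
Qed.

End Charts.

Section EpsPair.
Notation C := (Rdefinitions.R[i]).
Variables (f : P3) (d : nat) (v : 'I_2 -> 'I_3 -> P3) (dg : 'I_2 -> nat).
Hypotheses (d0 : (0 < d)%N) (hf : f \is d.-homog) (f0 : f != 0).
Hypothesis f_red : forall G H : P3, f = G * G * H -> (msize G <= 1)%N.
Hypothesis vD : forall m, \sum_i v m i * f^`M(i) = 0.
Hypothesis v_homog : forall m i, v m i \is (dg m).-homog.
Hypothesis v_gen : forall w : 'I_3 -> P3, \sum_i w i * f^`M(i) = 0 ->
  exists G : 'I_2 -> P3, forall i, w i = \sum_m G m * v m i.

Variables (L A B N : 'I_3 -> C) (S T : P3).
Hypothesis fr : frame L A B N S T.
Hypothesis L0 : exists i, L i != 0.
Hypothesis lf : ~ rdiv (lform L) f.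
Hypothesis fB : f.@[B] != 0.

Notation phi := (lin A B f).
Notation gam := (gcdp (lin A B (vl L v ord0)) (lin A B (vl L v ord_max))).
Notation param u := (T.@[u] / S.@[u]).

Lemma milnorE F q n : let g := dehk C (chart_index q) F in
  qdim (@mpolyC 2 C) (fun=> True) (loc2 (chart_coords q) g^`M(ord0) g^`M(ord_max)) n ->
  milnor F q = n.
Proof.
move=> g h; rewrite /milnor; apply: local_dimE.
have -> : dehom F q = g by apply: chart_tupleE.
by apply: qdim_ext h => // a; apply: iff_sym; apply: in_loc_ideal2.
Qed.

Lemma tjurinaE F q n : let g := dehk C (chart_index q) F in
  qdim (@mpolyC 2 C) (fun=> True) (loc3 (chart_coords q) g g^`M(ord0) g^`M(ord_max)) n ->
  tjurina F q = n.
Proof.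
move=> g h; rewrite /tjurina; apply: local_dimE.
have -> : dehom F q = g by apply: chart_tupleE.
by apply: qdim_ext h => // a; apply: iff_sym; apply: in_loc_ideal3.
Qed.

Lemma eps_pairE q : tnormal q -> f.@[tcoords q] = 0 -> (lform L).@[tcoords q] = 0 ->
  eps_pair f (lform L) q =
  (mup (param (tcoords q)) phi)%:Z - 1 - (mup (param (tcoords q)) gam)%:Z.
Proof.
move=> nq fq lq; have Lq : \sum_i L i * tcoords q i = 0 by rewrite -lform_eval.
have [m [m' [n [n' [h1 h2 h3 h4 [e1 e2]]]]]] := point_local d0 hf f0 f_red vD v_homog v_gen
  fr L0 lf fB Lq fq (tnormal_neq0 nq) (chart_index_neq0 nq).
rewrite /eps_pair /epsX.
rewrite (milnorE (qdim_loc2_ext (chart_coordsE q) h1)) (milnorE (qdim_loc2_ext (chart_coordsE q) h3)).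
rewrite (tjurinaE (qdim_loc3_ext (chart_coordsE q) h2)) (tjurinaE (qdim_loc3_ext (chart_coordsE q) h4)).
move: e1 e2; move: (mup _ _) (mup _ _) => a b; clear; lia.
Qed.

End EpsPair.

(** * Exponents *)

Section Exponents.
Notation C := (Rdefinitions.R[i]).
Implicit Types (F : P3) (ds : seq nat).

Lemma exponents_uniq F ds ds' : exponents F ds -> exponents F ds' -> ds = ds'.
Proof.
move=> [m [v [dg [hv ->]]]] [m' [v' [dg' [hv' ->]]]].
apply/perm_sortP; [exact: leq_total | exact: leq_trans | exact: anti_leq |].
exact: hgens_degrees hv hv'.
Qed.

Lemma has_gens_exponents F ds : has_gens F ds -> exponents F (sort leq ds).
Proof.
move=> [v hv]; exists (size ds), v, (fun i => nth 0%N ds i); split=> //.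
by congr sort; rewrite -[LHS](mkseq_nth 0%N) /mkseq -val_enum_ord -map_comp.
Qed.

Lemma exponents_sorted F ds : has_gens F ds -> sorted leq ds -> exponents F ds.
Proof. by move=> /has_gens_exponents h srt; rewrite -(sorted_sort leq_trans srt). Qed.

(** Exponents are sorted but the generators need not be; a possible swap aligns them. *)
Lemma exponents2 F d1 d2 : exponents F [:: d1; d2] ->
  exists (v : 'I_2 -> 'I_3 -> P3) (dg : 'I_2 -> nat),
  [/\ forall m, \sum_i v m i * F^`M(i) = 0, forall m i, v m i \is (dg m).-homog,
      forall w : 'I_3 -> P3, \sum_i w i * F^`M(i) = 0 ->
        exists G : 'I_2 -> P3, forall i, w i = \sum_m G m * v m i,
      dg ord0 = d1 /\ dg ord_max = d2 & (d1 <= d2)%N].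
Proof.
move=> [m [v [dg [[D hom gen _] eds]]]].
have em : m = 2%N by have := congr1 size eds; rewrite size_sort size_map size_enum_ord.
subst m; have en : enum 'I_2 = [:: ord0; ord_max].
  by rewrite enum_ordSl enum_ordSl /= enum_ord0 /=; congr [:: _; _]; apply: val_inj.
have vh m i : v m i \is (dg m).-homog by have [] := hom m.
move: eds; rewrite en /= => eds.
have [le|lt] := leqP (dg ord0) (dg ord_max).
  move: eds; rewrite (sorted_sort leq_trans) /= ?le //.
  by case=> -> ->; exists v, dg; split.
have es : sort leq [:: dg ord0; dg ord_max] = [:: dg ord_max; dg ord0].
  apply: (sorted_eq leq_trans anti_leq); first exact: (sort_sorted leq_total).
    by rewrite /= (ltnW lt).
  by rewrite perm_sort; apply/seq.permP => x /=; rewrite !addn0 addnC.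
move: eds; rewrite es; case=> -> ->.
exists (fun i => if i == ord0 then v ord_max else v ord0), (fun i => if i == ord0 then dg ord_max else dg ord0).
split=> //.
- by move=> m; case: ifP => _; apply: D.
- by move=> m i; case: ifP.
- move=> w /gen [G hG]; exists (fun i => if i == ord0 then G ord_max else G ord0) => i.
  by rewrite hG !sum2E /= addrC.
- exact: ltnW.
Qed.

(** Uniqueness of the exponents makes the cases exclusive. Since r = d - e - eps, the values e = d2
    and e = d1 give r in the free cases, while e < d1 gives d3 = d1 + d2 - e > d2 and hence r > d2 +
    1 - eps. *)
Lemma classification F d d1 d2 e (r eps : int) :
  (d1 <= d2)%N -> (d1 + d2).+1 = d -> r + eps = d%:Z - e%:Z ->
  [\/ e = d1 /\ has_gens F [:: d2; d1.+1], e = d2 /\ has_gens F [:: d1; d2.+1] |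
      (e < d1)%N /\ has_gens F [:: d1.+1; d2.+1; (d1 + d2 - e)%N]] ->
  [/\ is_free F \/ is_pog F d.+1,
      exactly_one3 (case1 d1 d2 F) (case2 d1 d2 F) (case3 d1 d2 F),
      (case1 d1 d2 F -> exponents F [:: d1; d2.+1] /\ r = d1%:Z + 1 - eps) /\
      (case2 d1 d2 F -> exponents F [:: d1.+1; d2] /\ r = d2%:Z + 1 - eps),
      case3 d1 d2 F -> is_pog F d.+1 /\
        exists d3 : nat, exponents F [:: d1.+1; d2.+1; d3] /\ r = d3%:Z + 1 - eps
    & is_free F <-> r <= d2%:Z + 1 - eps].
Proof.
move=> le dE rE cases.
have nth_uniq ds ds' i : exponents F ds -> exponents F ds' -> nth 0%N ds i = nth 0%N ds' i.
  by move=> h h'; rewrite (exponents_uniq h h').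
have c1_of : exponents F [:: d1; d2.+1] -> r = d1%:Z + 1 - eps -> r <= d2%:Z + 1 - eps -> 
  [/\ is_free F \/ is_pog F d.+1,
      exactly_one3 (case1 d1 d2 F) (case2 d1 d2 F) (case3 d1 d2 F),
      (case1 d1 d2 F -> exponents F [:: d1; d2.+1] /\ r = d1%:Z + 1 - eps) /\
      (case2 d1 d2 F -> exponents F [:: d1.+1; d2] /\ r = d2%:Z + 1 - eps),
      case3 d1 d2 F -> is_pog F d.+1 /\
        exists d3 : nat, exponents F [:: d1.+1; d2.+1; d3] /\ r = d3%:Z + 1 - eps
    & is_free F <-> r <= d2%:Z + 1 - eps].
  move=> ex e1 e2.
  have n2 : ~ case2 d1 d2 F.
    by move=> [_ [ds [h [_ [h0 _]]]]]; move: h0; rewrite (nth_uniq _ _ 0%N h ex) /=; clear; lia.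
  have n3 : ~ case3 d1 d2 F.
    by move=> [ds [h [_ [h0 _]]]]; move: h0; rewrite (nth_uniq _ _ 0%N h ex) /=; clear; lia.
  have fr : is_free F by exists d1, d2.+1.
  split=> //; first by left.
  left; split=> //; by exists [:: d1; d2.+1].
case: cases => [[ee gens]|[ee gens]|[ee gens]].
(* For d1 = d2 the value e = d1 belongs to the first case, since the second one requires d1 < d2. *)
- have [lt|ge] := ltnP d1 d2; last first.
    have e12 : d1 = d2 by apply/eqP; rewrite eqn_leq le.
    apply: c1_of; first by rewrite {1}e12 -{2}e12; apply: exponents_sorted => //=; rewrite e12 leqnSn.
    + by move: rE; rewrite -dE ee; clear -e12; lia.
    + by move: rE; rewrite -dE ee; clear -e12; lia.
  have ex : exponents F [:: d1.+1; d2].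
    have := has_gens_exponents gens; congr exponents.
    apply: (sorted_eq leq_trans anti_leq); first exact: (sort_sorted leq_total).
      by rewrite /= lt.
    by rewrite perm_sort; apply/seq.permP => x /=; rewrite !addn0 addnC.
  have n1 : ~ case1 d1 d2 F.
    by move=> [ds [h [_ [h0 _]]]]; move: h0; rewrite (nth_uniq _ _ 0%N h ex) /=; clear; lia.
  have n3 : ~ case3 d1 d2 F.
    by move=> [ds [h [_ [_ h0]]]]; move: h0; rewrite (nth_uniq _ _ 1%N h ex) /=; clear; lia.
  have fr : is_free F by exists d1.+1, d2.
  have r2 : r = d2%:Z + 1 - eps by move: rE; rewrite -dE ee; clear; lia.
  split=> //; first by left.
    right; left; split=> //; split=> //; split=> //; by exists [:: d1.+1; d2].
  by rewrite r2.
- apply: c1_of.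
  + by apply: exponents_sorted => //=; rewrite andbT leqW.
  + by move: rE; rewrite -dE ee; clear; lia.
  + by move: rE; rewrite -dE ee; clear -le; lia.
have ex : exponents F [:: d1.+1; d2.+1; (d1 + d2 - e)%N].
  by apply: exponents_sorted => //=; move: ee le; clear; lia.
have r3 : r = (d1 + d2 - e)%:Z + 1 - eps by move: rE; rewrite -dE; clear -ee; lia.
have n1 : ~ case1 d1 d2 F.
  by move=> [ds [h [_ [h0 _]]]]; move: h0; rewrite (nth_uniq _ _ 0%N h ex) /=; clear; lia.
have n2 : ~ case2 d1 d2 F.
  by move=> [_ [ds [h [_ [_ h0]]]]]; move: h0; rewrite (nth_uniq _ _ 1%N h ex) /=; clear; lia.
have pg : is_pog F d.+1.
  by exists d1.+1, d2.+1, (d1 + d2 - e)%N; split=> //; rewrite -dE addSn addnS.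
split=> //; first by right.
- right; right; split=> //; split=> //; by exists [:: d1.+1; d2.+1; (d1 + d2 - e)%N].
- by split=> //; exists (d1 + d2 - e)%N.
split=> [[a [b h]]|h]; first by have := congr1 size (exponents_uniq h ex).
by move: h rE; rewrite -dE; clear -ee; lia.
Qed.

Lemma lform_exists (l : P3) : l \is 1.-homog -> l != 0 ->
  exists2 L : 'I_3 -> C, l = lform L & exists i, L i != 0.
Proof.
move=> hl l0; exists (fun i => (l^`M(i))@_0); first exact: lform_of.
apply: NNPP => nex; move/eqP: l0; apply; rewrite (lform_of hl) /lform big1 // => i _.
have -> : (l^`M(i))@_0 = 0 by apply/eqP/negPn/negP => h; apply: nex; exists i.
by rewrite mpolyC0 mul0r.
Qed.

Theorem addition_theorem (d d1 d2 : nat) (f l : P3) : setting d d1 d2 f l ->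
  exists e, [/\ (d1 <= d2)%N, (d1 + d2).+1 = d,
  [\/ e = d1 /\ has_gens (f * l) [:: d2; d1.+1], e = d2 /\ has_gens (f * l) [:: d1; d2.+1] |
      (e < d1)%N /\ has_gens (f * l) [:: d1.+1; d2.+1; (d1 + d2 - e)%N]] &
  forall s, enum_inter f l s ->
    (size s)%:Z + \sum_(q <- s) eps_pair f l q = d%:Z - e%:Z].
Proof.
move=> [[d3 hf f0 f_red] [hl l0 nlf ex]].
have [v [dg [vD vh vgen [<- <-] le]]] := exponents2 ex.
have [L eL L0] := lform_exists hl l0; subst l.
have d0 : (0 < d)%N by apply: leq_trans d3.
have nd : ~ rdiv (lform L) f by move=> [c ec]; apply: nlf; exists c; rewrite ec mulrC.
have [A [B [N [S [T [fr fB]]]]]] := exists_frame L0 hf nd.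
exists (size (gcdp (lin A B (vl L v ord0)) (lin A B (vl L v ord_max)))).-1; split=> //.
- exact: degree_sum d0 hf f0 f_red vh vgen.
- exact (addition_generators d0 hf f0 f_red vD vh vgen fr L0 nd fB le).
move=> s [us hs].
apply: (sum_over_points d0 hf f0 f_red vh vgen fr L0 nd fB us hs) => q /hs [nq [fq lq]].
exact (eps_pairE d0 hf f0 f_red vD vh vgen fr L0 nd fB nq fq lq).
Qed.

End Exponents.

(** * Examples *)

Section SaitoConverse.
Variable C : numClosedFieldType.
Notation P3 := {mpoly C[3]}.
Variables (f : P3) (d : nat).
Hypotheses (d0 : (0 < d)%N) (hf : f \is d.-homog) (f0 : f != 0).
Hypothesis f_red : forall G H : P3, f = G * G * H -> (msize G <= 1)%N.
Variables (u0 u1 : 'I_3 -> P3) (n0 n1 : nat) (c : C).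
Hypotheses (D0 : \sum_i u0 i * f^`M(i) = 0) (D1 : \sum_i u1 i * f^`M(i) = 0).
Hypotheses (h0 : forall i, u0 i \is n0.-homog) (h1 : forall i, u1 i \is n1.-homog).
Hypotheses (c0 : c != 0) (hc : forall i, cross u0 u1 i = c%:MP * f^`M(i)).

(** Both arguments are orthogonal to the gradient, so their cross product is parallel to it, and
    primitivity of the gradient makes the ratio a polynomial. *)
Lemma cross_gradient (u w : 'I_3 -> P3) :
  \sum_i u i * f^`M(i) = 0 -> \sum_i w i * f^`M(i) = 0 ->
  exists a, forall i, cross u w i = a * cross u0 u1 i.
Proof.
move=> Du Dw; have [j fj] := gradient_neq0 d0 hf f0.
have par i : f^`M(j) * cross u w i = cross u w j * f^`M(i).
  have sym (a b : 'I_3) : f^`M(a) * cross u w b = cross u w a * f^`M(b) ->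
    f^`M(b) * cross u w a = cross u w b * f^`M(a) by move=> e; rewrite mulrC -e mulrC.
  have zero x y : x * \sum_i u i * f^`M(i) - y * \sum_i w i * f^`M(i) = 0.
    by rewrite Du Dw !mulr0 subr0.
  have e01 : f^`M(i0) * cross u w i1 = cross u w i0 * f^`M(i1).
    apply/eqP; rewrite -subr_eq0 -(zero (- w i2) (- u i2)) !sum3E /cross /=; apply/eqP; ring.
  have e12 : f^`M(i1) * cross u w i2 = cross u w i1 * f^`M(i2).
    apply/eqP; rewrite -subr_eq0 -(zero (- w i0) (- u i0)) !sum3E /cross /=; apply/eqP; ring.
  have e20 : f^`M(i2) * cross u w i0 = cross u w i2 * f^`M(i0).
    apply/eqP; rewrite -subr_eq0 -(zero (- w i1) (- u i1)) !sum3E /cross /=; apply/eqP; ring.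
  by move: j i {fj}; apply: ord3P; apply: ord3P;
    do [exact: e01 | exact: e12 | exact: e20 | exact: sym | exact: mulrC].
have [k ek] := gradient_multiple d0 hf f_red fj par.
exists ((c^-1)%:MP * k) => i; apply: (mulfI fj).
rewrite par ek hc.
have cc : (c^-1)%:MP * c%:MP = 1 :> P3 by rewrite -mpolyCM mulVf // mpolyC1.
transitivity (((c^-1)%:MP * c%:MP) * k * f^`M(i) * f^`M(j)); last by ring.
by rewrite cc; ring.
Qed.

(** Cramer's rule in cross product form; the last sum vanishes when [w] kills [f]. *)
Lemma cross_expansion (w : 'I_3 -> P3) i j : w i * cross u0 u1 j =
  u0 i * cross w u1 j + u1 i * cross u0 w j + (i == j)%:R * \sum_k w k * cross u0 u1 k.
Proof.
rewrite sum3E; move: i j; apply: ord3P; apply: ord3P; rewrite /cross /= ?mulr1n ?mulr0n; ring.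
Qed.

Lemma saito_converse (w : 'I_3 -> P3) : \sum_i w i * f^`M(i) = 0 ->
  exists a b, forall i, w i = a * u0 i + b * u1 i.
Proof.
move=> Dw; have [a ha] := cross_gradient Dw D1; have [b hb] := cross_gradient D0 Dw.
have [j fj] := gradient_neq0 d0 hf f0.
have cj : cross u0 u1 j != 0 by rewrite hc mulf_neq0 // mpolyC_eq0.
exists a, b => i; apply: (mulIf cj); rewrite cross_expansion ha hb.
rewrite (eq_bigr (fun k => c%:MP * (w k * f^`M(k)))) => [|k _]; last by rewrite hc; ring.
by rewrite -mulr_sumr Dw !mulr0; ring.
Qed.

Lemma saito_has_gens : has_gens f [:: n0; n1].
Proof.
have [j fj] := gradient_neq0 d0 hf f0.
have cj : cross u0 u1 j != 0 by rewrite hc mulf_neq0 // mpolyC_eq0.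
apply: (has_gens2 D0 D1 h0 h1 saito_converse) => a e; move/eqP: cj; apply.
  by rewrite /cross !e; do 2?case: ifP => _; ring.
by rewrite /cross !e; do 2?case: ifP => _; ring.
Qed.

End SaitoConverse.

(** * Three line arrangements realizing the cases *)

Section LineArrangements.
Variable C : numClosedFieldType.
Notation P3 := {mpoly C[3]}.

Definition squarefree_poly (f : P3) := forall G H : P3, f = G * G * H -> (msize G <= 1)%N.

Lemma squarefree1 : squarefree_poly 1.
Proof.
move=> G H e; have : G \is a GRing.unit.
  by apply/unitrPr; exists (G * H); rewrite mulrA.
by move=> /mpoly_unit_const [c _ ->]; apply: msizeC_le1 || rewrite msizeC; case: (c != 0).
Qed.

Lemma not_rdiv_lform (L q : 'I_3 -> C) (f : P3) :
  \sum_i L i * q i = 0 -> f.@[q] != 0 -> ~ rdiv (lform L) f.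
Proof. by move=> Lq fq [h e]; move/eqP: fq; rewrite e mevalM lform_eval Lq mulr0. Qed.

(** A square factor not containing the new line already divides [f], and one containing it would put
    the line into [f]. *)
Lemma squarefree_mul_lform (f : P3) d L : (exists i, L i != 0) -> f \is d.-homog ->
  ~ rdiv (lform L) f -> squarefree_poly f -> squarefree_poly (f * lform L).
Proof.
move=> L0 hf nf sf G H e; have [A [B [N [S [T [fr _]]]]]] := exists_frame L0 hf nf.
have l0 := lform_neq0 L0.
have [[g eg]|nG] := classic (rdiv (lform L) G).
  case: nf; exists (g * g * H); apply: (mulIf l0); rewrite e eg; ring.
have [h eh] : rdiv (lform L) H.
  by do 2 apply: (lform_primeP fr nG); exists f; rewrite mulrA e.
by apply: (sf _ h); apply: (mulIf l0); rewrite e eh; ring.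
Qed.

Definition vec3 (a b c : C) : 'I_3 -> C :=
  fun i => if i == i0 then a else if i == i1 then b else c.

Lemma lform_vec3 a b c :
  lform (vec3 a b c) = a%:MP * 'X_i0 + b%:MP * 'X_i1 + c%:MP * 'X_i2.
Proof. by rewrite /lform sum3E. Qed.

Notation x := ('X_i0 : P3).
Notation y := ('X_i1 : P3).
Notation z := ('X_i2 : P3).

Lemma mderivXE (i j : 'I_3) : ('X_i : P3)^`M(j) = (i == j)%:R.
Proof.
rewrite mderivX mnmE; case: eqP => [->|_]; last by rewrite scale0r.
have -> : (U_(j) - U_(j) = 0 :> 'X_{1..3})%MM by apply/mnmP => k; rewrite !mnmE subnn.
by rewrite scale1r mpolyX0.
Qed.

Lemma dhomogXE (i : 'I_3) : 'X_i \is [in C[3], 1.-homog].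
Proof. by rewrite dhomogX /= mdeg1. Qed.

Lemma lift_i0_max : lift i0 (ord_max : 'I_2) = i2.
Proof. exact: val_inj. Qed.

Definition line_setting (g h : P3) (ds : seq nat) :=
  [/\ g != 0, h \is 1.-homog, h != 0, ~ rdiv h g & has_gens g ds].

Section OneExample.
Variables (f : P3) (d : nat) (u0 u1 : 'I_3 -> P3) (n0 n1 : nat) (c : C).
Hypotheses (d0 : (0 < d)%N) (hf : f \is d.-homog) (f_red : squarefree_poly f).
Hypotheses (D0 : \sum_i u0 i * f^`M(i) = 0) (D1 : \sum_i u1 i * f^`M(i) = 0).
Hypotheses (h0 : forall i, u0 i \is n0.-homog) (h1 : forall i, u1 i \is n1.-homog).
Hypotheses (c0 : c != 0) (hc : forall i, cross u0 u1 i = c%:MP * f^`M(i)).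
Variables (l1 l2 a b a' b' : C).
Hypothesis det : a * b' - a' * b = 1.
Notation L := (vec3 1 l1 l2).
Notation pA := (vec3 (- (l1 * a + l2 * b)) a b).
Notation pB := (vec3 (- (l1 * a' + l2 * b')) a' b').

Lemma line_pt_vec3 p q i : line_pt L i0 p q i = vec3 (- (l1 * p + l2 * q)) p q i.
Proof.
move: i; apply: ord3P.
- by rewrite line_pt_k lift_i0_max /vec3 /= divr1.
- exact: line_pt_0.
- by rewrite -lift_i0_max line_pt_1.
Qed.

Lemma lin_ext (p p' q q' : 'I_3 -> C) : p =1 p' -> q =1 q' -> lin p q =1 lin p' q'.
Proof.
move=> pp qq; apply: (mpoly_rmorph_eq (f := lin p q) (g := lin p' q')) => [k|i].
  by rewrite !linC.
by rewrite !linX pp qq.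
Qed.

Hypotheses (fB : f.@[pB] != 0) (n01 : (n0 <= n1)%N).
Variable e : nat.
Hypothesis size_gcd : size (gcdp (lin pA pB (u0 i0 + l1%:MP * u0 i1 + l2%:MP * u0 i2))
                                 (lin pA pB (u1 i0 + l1%:MP * u1 i1 + l2%:MP * u1 i2))) = e.+1.
Let l : P3 := lform L.
Let f0 : f != 0.
Proof. by apply: contraNneq fB => ->; rewrite meval0. Qed.

Lemma L_neq0 : exists i, L i != 0.
Proof. by exists i0; rewrite /vec3 /= oner_neq0. Qed.

Lemma line_not_component : ~ rdiv l f.
Proof.
apply: not_rdiv_lform fB; rewrite sum3E /vec3 /=; ring.
Qed.

(** Reduces an example to a Saito identity and the gcd of two explicit polynomials in the
    parameter. *)
Lemma example_gens : line_setting f l [:: n0; n1] /\ [\/ e = n0 /\ has_gens (f * l) [:: n1; n0.+1],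
  e = n1 /\ has_gens (f * l) [:: n0; n1.+1] |
  (e < n0)%N /\ has_gens (f * l) [:: n0.+1; n1.+1; (n0 + n1 - e)%N]].
Proof.
split.
  split=> //; [exact: lform_homog | exact: lform_neq0 L_neq0 | exact: line_not_component |].
  exact (saito_has_gens d0 hf f0 f_red D0 D1 h0 h1 c0 hc).
pose v (m : 'I_2) := if m == ord0 then u0 else u1.
pose dg (m : 'I_2) := if m == ord0 then n0 else n1.
have vD m : \sum_i v m i * f^`M(i) = 0 by rewrite /v; case: ifP.
have vh m i : v m i \is (dg m).-homog by rewrite /v /dg; case: ifP.
have vg (w : 'I_3 -> P3) : \sum_i w i * f^`M(i) = 0 ->
    exists G : 'I_2 -> P3, forall i, w i = \sum_m G m * v m i.
  move=> /(saito_converse d0 hf f0 f_red D0 D1 c0 hc) [g [h e1]].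
  by exists (fun m => if m == ord0 then g else h) => i; rewrite sum2E e1.
have Lk : L i0 != 0 by rewrite /vec3 /= oner_neq0.
have fr := frame_line_pt Lk det.
have fB' : f.@[line_pt L i0 a' b'] != 0 by rewrite (meval_ext (line_pt_vec3 a' b')).
have := addition_generators d0 hf f0 f_red vD vh vg fr L_neq0 line_not_component fB' n01.
rewrite !(lin_ext (line_pt_vec3 a b) (line_pt_vec3 a' b')) /vl !sum3E.
by rewrite /= mpolyC1 !mul1r size_gcd.
Qed.

End OneExample.

Definition triangle : P3 := x * y * z.
Definition braid_minus : P3 := triangle * (x - y).

Definition tri0 : 'I_3 -> P3 := fun i => if i == i0 then x else if i == i1 then - y else 0.
Definition tri1 : 'I_3 -> P3 := fun i => if i == i0 then 0 else if i == i1 then y else - z.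

Lemma triangle_homog : triangle \is 3.-homog.
Proof.
rewrite /triangle -[3%N]/(1 + 1 + 1)%N.
by do 2?apply: dhomogM; apply: dhomogXE.
Qed.

Definition dE := (mderivM, mderivB, mderivXE).

Lemma vec3_neq0 p q r : (p != 0) || (q != 0) || (r != 0) -> exists i, vec3 p q r i != 0.
Proof. by case/orP => [/orP[]|] h; [exists i0 | exists i1 | exists i2]. Qed.

Lemma squarefree_triangle : squarefree_poly triangle.
Proof.
have -> : triangle = 1 * lform (vec3 1 0 0) * lform (vec3 0 1 0) * lform (vec3 0 0 1).
  by rewrite !lform_vec3 mpolyC0 mpolyC1 /triangle; ring.
have h1 : 1 * lform (vec3 1 0 0) \is [in C[3], (0 + 1).-homog].
  by apply: dhomogM; [apply: dhomog1 | apply: lform_homog].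
have h2 : 1 * lform (vec3 1 0 0) * lform (vec3 0 1 0) \is [in C[3], (0 + 1 + 1).-homog].
  by apply: dhomogM => //; apply: lform_homog.
apply: (squarefree_mul_lform _ h2); [|apply: (@not_rdiv_lform _ (vec3 1 1 0))|].
- by apply: vec3_neq0; rewrite oner_neq0 !orbT.
- by rewrite sum3E /vec3 /=; ring.
- by rewrite !mevalM meval1 !lform_eval !sum3E /vec3 /= !(mul1r, mulr0, mul0r, addr0, add0r) oner_neq0.
apply: (squarefree_mul_lform _ h1); [|apply: (@not_rdiv_lform _ (vec3 1 0 0))|].
- by apply: vec3_neq0; rewrite oner_neq0 !orbT.
- by rewrite sum3E /vec3 /=; ring.
- by rewrite !mevalM meval1 !lform_eval !sum3E /vec3 /= !(mul1r, mulr0, mul0r, addr0, add0r) oner_neq0.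
apply: (squarefree_mul_lform (d := 0) _ (dhomog1 _ _)); [|apply: (@not_rdiv_lform _ (vec3 0 0 0))|].
- by apply: vec3_neq0; rewrite oner_neq0.
- by rewrite sum3E /vec3 /=; ring.
- by rewrite meval1 oner_neq0.
exact: squarefree1.
Qed.

Lemma triangle_eval p q r : triangle.@[vec3 p q r] = p * q * r.
Proof. by rewrite /triangle !mevalM !mevalXU. Qed.

Lemma braid_minusE : braid_minus = triangle * lform (vec3 1 (- 1) 0).
Proof. by rewrite lform_vec3 mpolyC0 mpolyCN mpolyC1 /braid_minus; ring. Qed.

Lemma braid_minus_eval p q r : braid_minus.@[vec3 p q r] = p * q * r * (p - q).
Proof. by rewrite /braid_minus mevalM triangle_eval mevalB !mevalXU. Qed.

Lemma braid_minus_homog : braid_minus \is 4.-homog.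
Proof.
rewrite braid_minusE -[4%N]/(3 + 1)%N.
by apply: dhomogM; [apply: triangle_homog | apply: lform_homog].
Qed.

Lemma squarefree_braid_minus : squarefree_poly braid_minus.
Proof.
rewrite braid_minusE; apply: (squarefree_mul_lform _ triangle_homog).
- by apply: vec3_neq0; rewrite oner_neq0.
- apply: (@not_rdiv_lform _ (vec3 1 1 1)); first by rewrite sum3E /vec3 /=; ring.
  by rewrite triangle_eval !mul1r oner_neq0.
exact: squarefree_triangle.
Qed.

(** The form has degree 3 in x, y and degree 1 in z, so this combination of the two partial Euler
    fields kills it. *)
Definition bra0 : 'I_3 -> P3 := fun i => if i == i0 then x else if i == i1 then y else - 3%:R * z.
Definition bra1 : 'I_3 -> P3 :=
  fun i => if i == i0 then x * (x - y) else if i == i1 then - (y * (x - y)) else - (z * (x + y)).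

Lemma bra0_D : \sum_i bra0 i * braid_minus^`M(i) = 0.
Proof. rewrite sum3E /bra0 /braid_minus /triangle !dE /=; ring. Qed.

Lemma bra1_D : \sum_i bra1 i * braid_minus^`M(i) = 0.
Proof. rewrite sum3E /bra1 /braid_minus /triangle !dE /=; ring. Qed.

Lemma bra_cross i : cross bra0 bra1 i = (- 2%:R)%:MP * braid_minus^`M(i).
Proof.
move: i; apply: ord3P; rewrite /cross /bra0 /bra1 /braid_minus /triangle !dE mpolyCN
  (rmorph_nat (@mpolyC 3 C)) /=; ring.
Qed.

Lemma bra0_homog i : bra0 i \is 1.-homog.
Proof.
move: i; apply: ord3P; rewrite /bra0 /=; try exact: dhomogXE.
by rewrite mulNr rpredN mulr_natl; apply: rpredMn; apply: dhomogXE.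
Qed.

Lemma bra1_homog i : bra1 i \is 2.-homog.
Proof.
move: i; apply: ord3P; rewrite /bra1 /= ?rpredN -[2%N]/(1 + 1)%N; apply: dhomogM;
  rewrite ?dhomogXE //; [apply: rpredB | apply: rpredB | apply: rpredD]; exact: dhomogXE.
Qed.

Lemma tri0_D : \sum_i tri0 i * triangle^`M(i) = 0.
Proof. rewrite sum3E /tri0 /triangle !dE /=; ring. Qed.

Lemma tri1_D : \sum_i tri1 i * triangle^`M(i) = 0.
Proof. rewrite sum3E /tri1 /triangle !dE /=; ring. Qed.

Lemma tri_cross i : cross tri0 tri1 i = 1%:MP * triangle^`M(i).
Proof. by move: i; apply: ord3P; rewrite /cross /tri0 /tri1 /triangle !dE mpolyC1 /=; ring. Qed.

Lemma tri0_homog i : tri0 i \is 1.-homog.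
Proof. by move: i; apply: ord3P; rewrite /tri0 /= ?rpredN ?dhomog0 ?dhomogXE. Qed.

Lemma tri1_homog i : tri1 i \is 1.-homog.
Proof. by move: i; apply: ord3P; rewrite /tri1 /= ?rpredN ?dhomog0 ?dhomogXE. Qed.

Lemma size_gcdp_mul (p q w : {poly C}) n : q = w * p -> size p = n.+1 ->
  size (gcdp p q) = n.+1.
Proof. by move=> -> <-; apply: eqp_size; apply: dvdp_gcd_idl; apply: dvdp_mull. Qed.

Lemma linN (p q : 'I_3 -> C) F : lin p q (- F) = - lin p q F.
Proof. exact: rmorphN. Qed.

Lemma lin0 (p q : 'I_3 -> C) : lin p q 0 = 0.
Proof. exact: rmorph0. Qed.

Definition linE := (linD, linN, linM, lin0, linC, linX).

Definition polyCE := (polyCD, polyCN, polyCM, polyC0, polyC1).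

Lemma size_natX k : size (k.+1%:R * 'X : {poly C}) = 2%N.
Proof. by rewrite -polyC_natr size_Cmul ?pnatr_eq0 // size_polyX. Qed.

Lemma nat_inv k : (k.+1%:R^-1)%:P * k.+1%:R = 1 :> {poly C}.
Proof. by rewrite -polyC_natr -polyCM mulVf ?pnatr_eq0. Qed.

(** The line x = y passes through a vertex of the triangle; both restrictions are multiples of the
    parameter, so e = 1 = d1 = d2. *)
Lemma example1 : line_setting triangle (lform (vec3 1 (- 1) 0)) [:: 1; 1] /\
  has_gens (triangle * lform (vec3 1 (- 1) 0)) [:: 1; 2].
Proof.
have [||||st []] := @example_gens triangle 3 tri0 tri1 1 1 1 isT triangle_homog squarefree_triangle
  tri0_D tri1_D tri0_homog tri1_homog (oner_neq0 C) tri_cross (- 1) 0 0 (- 1) 1 1 _ _ _ 1 _ => //.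
- by ring.
- by rewrite triangle_eval (_ : _ * _ = 1) ?oner_neq0 //; ring.
- set p := lin _ _ _; set q := lin _ _ _.
  have ep : p = 2%:R * 'X by rewrite /p !linE /tri0 /vec3 /= !polyCE; ring.
  have eq : q = - 'X by rewrite /q !linE /tri1 /vec3 /= !polyCE; ring.
  rewrite ep eq; apply: (@size_gcdp_mul _ _ (- (2%:R^-1)%:P)); last exact: size_natX.
  transitivity (- ((2%:R^-1)%:P * 2%:R) * 'X : {poly C}); last by ring.
  by rewrite nat_inv; ring.
- by case.
- by case.
- by case.
Qed.

(** The line x = z passes through the double point x = z = 0 of the four lines; the restrictions 4 X
    and 2 X^2 give e = 1 = d1 < d2. *)
Lemma example2 : line_setting braid_minus (lform (vec3 1 0 (- 1))) [:: 1; 2] /\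
  has_gens (braid_minus * lform (vec3 1 0 (- 1))) [:: 2; 2].
Proof.
have [|||||st []] := @example_gens braid_minus 4 bra0 bra1 1 2 (- 2%:R) isT braid_minus_homog
  squarefree_braid_minus bra0_D bra1_D bra0_homog bra1_homog _ bra_cross
  0 (- 1) 1 0 2%:R 1 _ _ _ 1 _ => //.
- by rewrite oppr_eq0 pnatr_eq0.
- by ring.
- by rewrite braid_minus_eval (_ : _ * _ = - 2%:R) ?oppr_eq0 ?pnatr_eq0 //; ring.
- set p := lin _ _ _; set q := lin _ _ _.
  have ep : p = 4%:R * 'X.
    by rewrite /p !linE /bra0 /vec3 /= ?linE ?rmorph_nat /vec3 /= !polyCE; ring.
  have eq : q = 2%:R * 'X * 'X.
    by rewrite /q !linE /bra1 /vec3 /= !polyCE; ring.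
  rewrite ep eq; apply: (@size_gcdp_mul _ _ (2%:R * (4%:R^-1)%:P * 'X)); last exact: size_natX.
  transitivity (2%:R * ((4%:R^-1)%:P * 4%:R) * 'X * 'X : {poly C}); last by ring.
  by rewrite nat_inv; ring.
- by case.
- by case.
- by case.
Qed.

(** A line in general position to the triangle: one restriction is constant, so e = 0 and three
    generators remain. *)
Lemma example3 : line_setting triangle (lform (vec3 1 1 1)) [:: 1; 1] /\
  has_gens (triangle * lform (vec3 1 1 1)) [:: 2; 2; 2].
Proof.
have [||||st []] := @example_gens triangle 3 tri0 tri1 1 1 1 isT triangle_homog squarefree_triangle
  tri0_D tri1_D tri0_homog tri1_homog (oner_neq0 C) tri_cross 1 1 1 0 1 1 _ _ _ 0 _ => //.
- by ring.
- by rewrite triangle_eval (_ : _ * _ = - 2%:R) ?oppr_eq0 ?pnatr_eq0 //; ring.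
- set p := lin _ _ _; set q := lin _ _ _.
  have eq : q = 1 by rewrite /q !linE /tri1 /vec3 /= ?linE /vec3 /= !polyCE; ring.
  by rewrite eq (eqp_size (gcdp1 p)) size_poly1.
- by case.
- by case.
- by case.
Qed.

End LineArrangements.

Theorem theorem1p4 :
  (forall (d d1 d2 : nat) (f l : P3), setting d d1 d2 f l ->
   forall s : seq pt, enum_inter f l s ->
   let r : int := (size s)%:Z in
   let eps : int := \sum_(q <- s) eps_pair f l q in
   [/\ is_free (f * l) \/ is_pog (f * l) d.+1,
       exactly_one3 (case1 d1 d2 (f * l)) (case2 d1 d2 (f * l)) (case3 d1 d2 (f * l)),
       (case1 d1 d2 (f * l) ->
         exponents (f * l) [:: d1; d2.+1] /\ r = d1%:Z + 1 - eps) /\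
       (case2 d1 d2 (f * l) ->
         exponents (f * l) [:: d1.+1; d2] /\ r = d2%:Z + 1 - eps),
       case3 d1 d2 (f * l) ->
         is_pog (f * l) d.+1 /\
         exists d3 : nat, exponents (f * l) [:: d1.+1; d2.+1; d3] /\ r = d3%:Z + 1 - eps
     & is_free (f * l) <-> r <= d2%:Z + 1 - eps]) /\
  (exists d d1 d2 (f l : P3), setting d d1 d2 f l /\ case1 d1 d2 (f * l)) /\
  (exists d d1 d2 (f l : P3), setting d d1 d2 f l /\ case2 d1 d2 (f * l)) /\
  (exists d d1 d2 (f l : P3), setting d d1 d2 f l /\ case3 d1 d2 (f * l)).
Proof.
have setI d d1 d2 (f l : P3) : (3 <= d)%N -> f \is d.-homog -> reduced f -> (d1 <= d2)%N ->
    line_setting f l [:: d1; d2] -> setting d d1 d2 f l.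
  move=> d3 hf f_red le [f0 hl l0 nl gens].
  refine (conj (And4 d3 hf f0 f_red) (And4 hl l0 _ _)).
    by move=> [h e]; apply: nl; exists h; rewrite e mulrC.
  by apply: exponents_sorted gens _; rewrite /= le.
split; last split; last split.
- move=> d d1 d2 f l st s hs r eps.
  have [e [le dE gens /(_ s hs) rE]] := addition_theorem st.
  exact: classification le dE rE gens.
- have [st gens] := example1 (Rdefinitions.R[i]).
  exists 3, 1%N, 1%N; do 2 eexists; split.
    by apply: setI st => //; [apply: triangle_homog | apply: squarefree_triangle].
  by exists [:: 1; 2]; split=> //; apply: exponents_sorted gens _.
- have [st gens] := example2 (Rdefinitions.R[i]).
  exists 4, 1%N, 2; do 2 eexists; split.
    by apply: setI st => //; [apply: braid_minus_homog | apply: squarefree_braid_minus].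
  by split=> //; exists [:: 2; 2]; split=> //; apply: exponents_sorted gens _.
- have [st gens] := example3 (Rdefinitions.R[i]).
  exists 3, 1%N, 1%N; do 2 eexists; split.
    by apply: setI st => //; [apply: triangle_homog | apply: squarefree_triangle].
  by exists [:: 2; 2; 2]; split=> //; apply: exponents_sorted gens _.
Qed.
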